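(* Let $X$ be a compact Kähler manifold, let $R(\cdot,\cdot)$ be its Riemann curvature tensor and $\nabla$ its Levi-Civita connection, and let $U,V$ be two smooth real vector fields on $X$. Then the symplectic vector bundle automorphism of $TX$ given by $$\exp(R(U,V))=\exp(\nabla_U\nabla_V-\nabla_V\nabla_U-\nabla_{[U,V]})$$ admits a factorization as a composition of finitely many unipotent symplectic vector bundle automorphisms of $TX$.
   Context: $TX$ is the real tangent bundle, equipped with the symplectic form given by the Kähler form. $R(U,V)=\nabla_U\nabla_V-\nabla_V\nabla_U-\nabla_{[U,V]}$ is regarded as a vector bundle endomorphism of $TX$, and $\exp$ is applied fiberwise. A vector bundle automorphism of $TX$ is a homeomorphism $TX\to TX$ covering the identity of $X$ that is linear on each fiber; it is symplectic if it preserves the symplectic form on each fiber, and unipotent if on every fiber its restriction $s$ satisfies $(s-\mathrm{id})^m=0$ for some $m$. *)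

(* Defs.v *)
From HB Require Import structures.
From mathcomp Require Import all_boot all_order all_algebra.
From mathcomp Require Import all_classical all_reals all_analysis.

Set Implicit Arguments.
Unset Strict Implicit.
Unset Printing Implicit Defensive.

Import Order.TTheory GRing.Theory Num.Theory.
Import numFieldNormedType.Exports.

Local Open Scope classical_set_scope.
Local Open Scope ring_scope.

Section Calculus.
Context {R : realType}.

(* [O] is meant to be open. *)
Fixpoint Ck (V W : normedModType R) (k : nat) (O : set V) (f : V -> W) : Prop :=
  match k with
  | 0 => forall p, O p -> {for p, continuous f}
  | k'.+1 => (forall p, O p -> differentiable f p)
             /\ (forall v, Ck k' O (fun p => 'D_v f p))
  end.

Definition smooth_on (V W : normedModType R) (O : set V) (f : V -> W) : Prop :=
  forall k, Ck k O f.

(* C^n is R^(n+n), the row vector (x, y) standing for x + iy; [mulI] is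
   multiplication by i. *)
Definition mulI n (v : 'rV[R]_(n + n)) : 'rV[R]_(n + n) :=
  row_mx (- rsubmx v) (lsubmx v).

(* Smooth with complex-linear differential, i.e. the Cauchy-Riemann equations. *)
Definition holomorphic_on n (O : set 'rV[R]_(n + n))
    (f : 'rV[R]_(n + n) -> 'rV[R]_(n + n)) : Prop :=
  smooth_on O f /\ forall p v, O p -> 'D_(mulI v) f p = mulI ('D_v f p).

End Calculus.

(* [chart i] and [param i] are total functions; only their restrictions to
   [dom i] and to [chart i @` dom i] are meaningful, where they are inverse
   homeomorphisms.  [at_ x] selects a chart around [x]. *)
Record complex_manifold (R : realType) (n : nat) := ComplexManifold {
  carrier :> topologicalType;
  carrier_hausdorff : hausdorff_space carrier;
  carrier_second_countable : @second_countable carrier;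
  atlas : Type;
  dom : atlas -> set carrier;
  chart : atlas -> carrier -> 'rV[R]_(n + n);
  param : atlas -> 'rV[R]_(n + n) -> carrier;
  dom_open : forall i, open (dom i);
  image_open : forall i, open (chart i @` dom i);
  chartK : forall i x, dom i x -> param i (chart i x) = x;
  chart_continuous : forall i x, dom i x -> {for x, continuous (chart i)};
  param_continuous : forall i x, dom i x ->
    {for chart i x, continuous (param i)};
  at_ : carrier -> atlas;
  at_dom : forall x, dom (at_ x) x;
  transition_holomorphic : forall i j,
    holomorphic_on (chart i @` (dom i `&` dom j)) (chart j \o param i)
}.

Section TangentBundle.
Context {R : realType} {n : nat} {X : complex_manifold R n}.

(* Components in the chart [j] of the tangent vector at [x] whose components
   in the chart [i] are [v]. *)
Definition change_chart (i j : atlas X) (x : X) (v : 'rV[R]_(n + n)) :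
    'rV[R]_(n + n) :=
  'D_v (chart j \o param i) (chart i x).

(* The fibre T_x X is R^(n+n): a tangent vector at [x] is given by its
   components in the chart [at_ x].  As transitions are holomorphic, the
   complex structure of T_x X is [mulI]. *)
Record tangent_bundle := Tangent { foot : X; vec : 'rV[R]_(n + n) }.

HB.instance Definition _ := gen_eqMixin tangent_bundle.
HB.instance Definition _ := gen_choiceMixin tangent_bundle.

(* The local trivializations are the maps
     dom i x R^(n+n) -> TX,  (x, v) |-> the vector with components v in chart i;
   TX carries the finest topology making all of them continuous. *)
Definition tangent_open (A : set tangent_bundle) : Prop :=
  forall i : atlas X, open [set q : X * 'rV[R]_(n + n) |
    dom i q.1 /\ A (Tangent q.1 (change_chart i (at_ q.1) q.1 q.2))].

Let tangent_openT : tangent_open setT.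
Proof.
move=> i; rewrite (_ : [set _ | _] = fst @^-1` (dom i)); last first.
  by apply/seteqP; split => [q []|q].
apply: open_comp; last exact: dom_open.
by move=> q _; exact: cvg_fst.
Qed.

Let tangent_openI : setI_closed tangent_open.
Proof.
move=> A B oA oB i; have := openI (oA i) (oB i).
congr (open _); apply/seteqP; split => q /=.
  by move=> [[? ?] [? ?]].
by move=> [? [? ?]].
Qed.

Let tangent_open_bigcup (I : Type) (f : I -> set tangent_bundle) :
  (forall i, tangent_open (f i)) -> tangent_open (\bigcup_i f i).
Proof.
move=> of_ i.
have /bigcup_open : forall k, [set: I] k -> open [set q : X * 'rV[R]_(n + n) |
    dom i q.1 /\ f k (Tangent q.1 (change_chart i (at_ q.1) q.1 q.2))].
  by move=> k _; exact: of_.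
congr (open _); apply/seteqP; split => q /=.
  by move=> [k _ [? ?]]; split => //; exists k.
by move=> [? [k _ ?]]; exists k.
Qed.

HB.instance Definition _ := isOpenTopological.Build tangent_bundle
  tangent_openT tangent_openI tangent_open_bigcup.

Definition vector_field := X -> 'rV[R]_(n + n).

Definition smooth_fun (O : set X) (f : X -> R) : Prop :=
  forall i, smooth_on (chart i @` (dom i `&` O)) (f \o param i : _ -> R^o).

Definition smooth_field (O : set X) (U : vector_field) : Prop :=
  forall i, smooth_on (chart i @` (dom i `&` O))
    (fun p => change_chart (at_ (param i p)) i (param i p) (U (param i p))).

(* The derivative U f. *)
Definition field_derive (U : vector_field) (f : X -> R) (x : X) : R :=
  'D_(U x) (f \o param (at_ x) : _ -> R^o) (chart (at_ x) x).

(* [U, V] f = U (V f) - V (U f), evaluated on the coordinate functions of the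
   chart [at_ x]. *)
Definition bracket (U V : vector_field) : vector_field := fun x =>
  \row_k (let f y := chart (at_ x) y 0 k in
          field_derive U (field_derive V f) x
          - field_derive V (field_derive U f) x).

(* The component g(v, w) in the chart [i], as a function on the image of [i],
   of a tensor g, the vectors [v] and [w] being constant in that chart. *)
Definition tensor_component (g : X -> 'rV[R]_(n + n) -> 'rV[R]_(n + n) -> R)
    (i : atlas X) (v w : 'rV[R]_(n + n)) : 'rV[R]_(n + n) -> R^o :=
  fun p => let x := param i p in
    g x (change_chart i (at_ x) x v) (change_chart i (at_ x) x w).

End TangentBundle.

Arguments tangent_bundle {R n} X.
Arguments vector_field {R n} X.

(* A complex manifold with a Hermitian metric (given by its real part, a
   Riemannian metric for which multiplication by i is an isometry) whose
   fundamental form is closed. *)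
Record kahler_manifold (R : realType) (n : nat) := KahlerManifold {
  kahler_base :> complex_manifold R n;
  metric : kahler_base -> 'rV[R]_(n + n) -> 'rV[R]_(n + n) -> R;
  metric_linear : forall x v, linear (metric x v : _ -> R^o);
  metric_sym : forall x v w, metric x v w = metric x w v;
  metric_pos : forall x v, v != 0 -> 0 < metric x v v;
  metric_smooth : forall i v w,
    smooth_on (chart i @` dom i) (tensor_component metric i v w);
  metric_hermitian : forall x v w, metric x (mulI v) (mulI w) = metric x v w;
  kahler_closed :
    let omega i := tensor_component (fun x v w => metric x (mulI v) w) i in
    forall i u v w p, (chart i @` dom i) p ->
      'D_u (omega i v w) p + 'D_v (omega i w u) p + 'D_w (omega i u v) p = 0
}.

Section Kahler.
Context {R : realType} {n : nat} {X : kahler_manifold R n}.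

Definition kahler_form (x : X) (v w : 'rV[R]_(n + n)) : R :=
  metric x (mulI v) w.

(* A connection is a morphism of sheaves: it acts on the vector fields defined
   on any open set [O], compatibly with restriction.  A smooth vector field on
   [O] is represented by any total function with the right values on [O]. *)
Record levi_civita (nabla : vector_field X -> vector_field X -> vector_field X)
    : Prop := LeviCivita {
  lc_smooth : forall O U V, open O -> smooth_field O U -> smooth_field O V ->
    smooth_field O (nabla U V);
  lc_restrict : forall O U U' V V', open O ->
    smooth_field O U -> smooth_field O U' ->
    smooth_field O V -> smooth_field O V' ->
    (forall x, O x -> U x = U' x) -> (forall x, O x -> V x = V' x) ->
    forall x, O x -> nabla U V x = nabla U' V' x;
  lc_linear : forall O f U U' V, open O -> smooth_fun O f ->
    smooth_field O U -> smooth_field O U' -> smooth_field O V ->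
    forall x, O x -> nabla (fun y => f y *: U y + U' y) V x
                     = f x *: nabla U V x + nabla U' V x;
  lc_additive : forall O U V V', open O ->
    smooth_field O U -> smooth_field O V -> smooth_field O V' ->
    forall x, O x -> nabla U (fun y => V y + V' y) x
                     = nabla U V x + nabla U V' x;
  lc_leibniz : forall O f U V, open O -> smooth_fun O f ->
    smooth_field O U -> smooth_field O V ->
    forall x, O x -> nabla U (fun y => f y *: V y) x
                     = f x *: nabla U V x + field_derive U f x *: V x;
  lc_metric : forall O U V W, open O ->
    smooth_field O U -> smooth_field O V -> smooth_field O W ->
    forall x, O x -> field_derive U (fun y => metric y (V y) (W y)) x
                     = metric x (nabla U V x) (W x)
                       + metric x (V x) (nabla U W x);
  lc_torsion : forall O U V, open O -> smooth_field O U -> smooth_field O V ->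
    forall x, O x -> nabla U V x - nabla V U x = bracket U V x
}.

Variable nabla : vector_field X -> vector_field X -> vector_field X.

(* The endomorphism R(U, V) of T_x X sends [w] to
     (nabla_U nabla_V W - nabla_V nabla_U W - nabla_[U, V] W) (x)
   for any vector field W, smooth around x, with W(x) = w. *)
Definition curvature (U V : vector_field X) (x : X) (w : 'rV[R]_(n + n)) :
    'rV[R]_(n + n) :=
  get [set r | exists O (W : vector_field X),
    [/\ open O, O x, smooth_field O W, W x = w
      & r = nabla U (nabla V W) x - nabla V (nabla U W) x
            - nabla (bracket U V) W x]].

(* exp A v, the sum over k of A^k v / k!, for an endomorphism A of R^(n+n). *)
Definition exp_endo (A : 'rV[R]_(n + n) -> 'rV[R]_(n + n))
    (v : 'rV[R]_(n + n)) : 'rV[R]_(n + n) :=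
  lim (series (fun k => (k`!%:R)^-1 *: iter k A v) @ \oo).

Definition exp_curvature (U V : vector_field X) (e : tangent_bundle X) :
    tangent_bundle X :=
  Tangent (foot e) (exp_endo (curvature U V (foot e)) (vec e)).

Definition on_fiber (s : tangent_bundle X -> tangent_bundle X) (x : X)
    (v : 'rV[R]_(n + n)) : 'rV[R]_(n + n) :=
  vec (s (Tangent x v)).

Definition bundle_automorphism (s : tangent_bundle X -> tangent_bundle X)
    : Prop :=
  [/\ exists t : tangent_bundle X -> tangent_bundle X,
        [/\ cancel s t, cancel t s, continuous s & continuous t],
      forall e, foot (s e) = foot e
    & forall x, linear (on_fiber s x)].

Definition symplectic (s : tangent_bundle X -> tangent_bundle X) : Prop :=
  forall x v w,
    kahler_form x (on_fiber s x v) (on_fiber s x w) = kahler_form x v w.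

Definition unipotent (s : tangent_bundle X -> tangent_bundle X) : Prop :=
  forall x, exists m, forall v, iter m (fun w => on_fiber s x w - w) v = 0.

End Kahler.

(* Main.v *)
(** Let J be the complex structure, g the metric and omega = g(J., .) the
    symplectic form.  As nabla is a metric connection, R(U, V) is skew for g;
    as the metric is Kaehler, nabla J = 0 (Koszul formula and d omega = 0), so
    R(U, V) commutes with J and is a continuous section of the bundle of
    symplectic Lie algebras.  Near x0 and for small t, exp(t R) is close to the
    identity, and symplectic elimination along a unitary frame writes it as a
    product of maps 1 + N with N of square zero, depending continuously on (x, t)
    and equal to the identity where t = 0.  Since multiples of R commute,
    exp(psi R) = exp((psi / k) R)^k is thus such a product for every psi with
    values in [0, 1] and support in a small open set, the factors extending by the
    identity.  Finally exp(c R) = exp(phi c R) exp((1 - phi) c R) reduces exp(R) to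
    finitely many such functions, by compactness and Urysohn's lemma. *)

Require Import Defs.
From HB Require Import structures.
From mathcomp Require Import all_boot all_order all_algebra.
From mathcomp Require Import all_classical all_reals all_analysis.
From mathcomp Require Import ring lra.
Set Implicit Arguments.
Unset Strict Implicit.
Unset Printing Implicit Defensive.
Import Order.TTheory GRing.Theory Num.Theory.
Import numFieldNormedType.Exports.
Local Open Scope classical_set_scope.
Local Open Scope ring_scope.

(** * Smooth maps and second derivatives *)

Section Calculus.
Context {R : realType}.
Implicit Types V W : normedModType R.

(** The divisor in the elimination formulas is 1 at the identity but may vanish elsewhere, and TX
    need not have a global frame; only small automorphisms over small open sets are accessible. The
    factors 1 + N cannot be cut off one by one: multiplying each N by a bump function changes the
    product. The exponent can be cut off, because the factors depend on the pair (x, t), and t may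
    be replaced by any continuous function of x with small values. This is why the local problem
    lives over X x R and not over X, and why each N has to vanish wherever the matrix to be factored
    is 1: extension by zero is then continuous. Two encodings shape the rest. A fibre is given by
    coordinates in the chart [at_ x], which jumps with x, so that continuity and smoothness are
    always tested in a fixed chart. And [curvature] picks the value of some local extension of a
    vector; it becomes usable only once tensoriality is known, which the calculus of charts and
    brackets provides. *)

Lemma near0_differentiable V W (h : V -> W) (p : V) :
  (\forall q \near p, h q = 0) -> differentiable h p.
Proof.
move=> h0; have hp : h p = 0 := nbhs_singleton h0.
have E : h \o shift p = cst (h p) + (0 : V -> W) +o_ 0 id.
  apply/eqaddoP => _/posnumP[e]; near=> k.
  rewrite hp /= -[(_ - _) k]/(h (k + p) - (0 + 0)) addr0 subr0.
  rewrite (_ : h (k + p) = 0) ?normr0 ?mulr_ge0//.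
  near: k; have := h0; rewrite (near_shift 0 p); apply: filterS => k /=.
  by rewrite /= subr0.
have cont0 : continuous (0 : V -> W) by move=> x; exact: cvg_cst.
have dE : 'd h p = 0 :> (V -> W) by exact/diff_unique.
by apply/diff_locallyP; rewrite dE; split.
Unshelve. all: by end_near. Qed.

Lemma near_eq_differentiable V W (f g : V -> W) (p : V) :
  {near p, f =1 g} -> differentiable f p -> differentiable g p.
Proof.
move=> fg df; rewrite (_ : g = f + (g - f)); last first.
  by apply/funext => q /=; rewrite -[RHS]/(f q + (g q - f q)) addrC subrK.
apply: differentiableD => //; apply: near0_differentiable.
near=> q; rewrite -[LHS]/(g q - f q); apply/eqP; rewrite subr_eq0.
by apply/eqP/esym; near: q.
Unshelve. all: by end_near. Qed.

(** Openness turns equality on O into equality of germs, which is all that limits and directional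
    derivatives see. *)
Lemma Ck_ext V W k (O : set V) (f g : V -> W) : open O ->
  (forall p, O p -> f p = g p) -> Ck k O f -> Ck k O g.
Proof.
move=> oO; elim: k f g => [|k IH] f g fg /=.
  move=> cf p Op; have fgp : f p = g p by exact: fg.
  rewrite /prop_for /continuous_at -fgp.
  apply: cvg_trans (cf p Op); apply: near_eq_cvg.
  by have := open_nbhs_nbhs (conj oO Op); apply: filterS => q /fg.
move=> [df Df]; have nfg p : O p -> {near p, f =1 g}.
  by move=> Op; have := open_nbhs_nbhs (conj oO Op); apply: filterS => q /fg.
split=> [p Op|v]; first by apply: near_eq_differentiable (df p Op); exact: nfg.
by apply: IH (Df v) => p Op; apply: near_eq_derive; exact: nfg.
Qed.

Lemma Ck_sub V W k (O O' : set V) (f : V -> W) :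
  O' `<=` O -> Ck k O f -> Ck k O' f.
Proof.
move=> OO'; elim: k f => [|k IH] f /=; first by move=> cf p /OO'; exact: cf.
by move=> [df Df]; split=> [p /OO'|v]; [exact: df|exact: IH].
Qed.

Lemma Ck_pred V W k (O : set V) (f : V -> W) : Ck k.+1 O f -> Ck k O f.
Proof.
elim: k f => [|k IH] f [df Df].
  by move=> p Op; apply: differentiable_continuous; exact: df.
by split=> // v; exact: IH.
Qed.

Lemma Ck_cst V W k (O : set V) (a : W) : Ck k O (cst a : V -> W).
Proof.
elim: k a => [|k IH] a /=; first by move=> p _; exact: cvg_cst.
split=> [p _|v]; first exact: differentiable_cst.
by rewrite (_ : (fun p => _) = cst 0) //; apply/funext => p; exact: derive_cst.
Qed.

Lemma Ck_add V W k (O : set V) (f g : V -> W) : open O ->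
  Ck k O f -> Ck k O g -> Ck k O (fun p => f p + g p).
Proof.
move=> oO; elim: k f g => [|k IH] f g /=.
  by move=> cf cg p Op; apply: cvgD; [exact: cf|exact: cg].
move=> [df Df] [dg Dg]; split=> [p Op|v].
  by apply: differentiableD; [exact: df|exact: dg].
apply: (Ck_ext oO) (IH _ _ (Df v) (Dg v)) => p Op.
by rewrite -(deriveD (diff_derivable (df p Op)) (diff_derivable (dg p Op))).
Qed.

Lemma Ck_mul V k (O : set V) (f g : V -> R) : open O ->
  Ck k O (f : V -> R^o) -> Ck k O (g : V -> R^o) ->
  Ck k O (fun p => f p * g p : R^o).
Proof.
move=> oO; elim: k f g => [|k IH] f g.
  by move=> cf cg p Op; apply: cvgM; [exact: cf|exact: cg].
move=> cf cg; have cf' := Ck_pred cf; have cg' := Ck_pred cg.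
case: cf cg => df Df [dg Dg]; split=> [p Op|v].
  by apply: differentiableM; [exact: df|exact: dg].
apply: (Ck_ext oO) (Ck_add oO (IH _ _ cf' (Dg v)) (IH _ _ cg' (Df v))) => p Op.
by rewrite (deriveM (diff_derivable (df p Op)) (diff_derivable (dg p Op))).
Qed.

Lemma Ck_sum V W k (O : set V) (I : Type) (r : seq I) (f : I -> V -> W) :
  open O -> (forall i, Ck k O (f i)) -> Ck k O (fun p => \sum_(i <- r) f i p).
Proof.
move=> oO cf; elim: r => [|i r IH].
  by rewrite (_ : (fun p => _) = cst 0); [exact: Ck_cst|
    apply/funext => p; rewrite big_nil].
rewrite (_ : (fun p => _) = fun p => f i p + \sum_(i <- r) f i p); last first.
  by apply/funext => p; rewrite big_cons.
exact: Ck_add.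
Qed.

Lemma differentiable_rVP V m (f : V -> 'rV[R]_m) p :
  differentiable f p <-> forall j, differentiable (fun q => f q 0 j : R^o) p.
Proof.
split=> [df j|df].
  exact: (@differentiable_comp _ _ _ _ f (fun M : 'rV[R]_m => M 0 j : R^o) p df
    (differentiable_coord _ _ _)).
rewrite (_ : f = \sum_(j < m) (fun q => f q 0 j *: delta_mx 0 j)).
  by apply: differentiable_sum => j; apply: differentiableZl; exact: df.
by apply/funext => q; rewrite {1}[f q]row_sum_delta fct_sumE.
Qed.

Lemma derive_rV V m (f : V -> 'rV[R]_m) p v j : differentiable f p ->
  'D_v f p 0 j = 'D_v (fun q => f q 0 j : R^o) p.
Proof. by move=> df; rewrite (derive_mx (diff_derivable df)) mxE. Qed.

(** Reduces vector-valued maps to real functions, for which products are available. *)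
Lemma Ck_rVP V m k (O : set V) (f : V -> 'rV[R]_m) : open O ->
  Ck k O f <-> forall j, Ck k O (fun q => f q 0 j : R^o).
Proof.
move=> oO; elim: k f => [|k IH] f.
  split=> [cf j p Op|cf p Op].
    exact: (cvg_comp _ _ (cf p Op) (@coord_continuous _ _ _ 0 j (f p))).
  apply/cvgrPdist_lt => e e0; near=> q.
  rewrite /Num.Def.normr/= mx_normrE (bigmax_lt _ e0)//= => -[i j] _.
  rewrite !mxE /= !ord1; move: j; near: q; apply: filter_forall => j.
  exact: ((cvgrPdist_lt _ _).1 (cf j p Op)).
split=> [[df Df] j|cf].
  split=> [p Op|v]; first exact: (differentiable_rVP _ _).1 (df p Op) j.
  by apply: (Ck_ext oO) ((IH _).1 (Df v) j) => p Op; rewrite derive_rV //; exact: df.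
have df p : O p -> differentiable f p.
  by move=> Op; apply/differentiable_rVP => j; case: (cf j) => + _; exact.
split=> // v; apply/IH => j; case: (cf j) => _ /(_ v).
by apply: Ck_ext => // p Op; rewrite derive_rV //; exact: df.
Unshelve. all: by end_near. Qed.

Lemma derive_comp_rV V W m (f : 'rV[R]_m -> W) (g : V -> 'rV[R]_m) p v :
  differentiable f (g p) -> differentiable g p ->
  'D_v (f \o g) p = 'D_('D_v g p) f (g p).
Proof.
move=> df dg; rewrite !deriveE //; last exact: differentiable_comp.
by rewrite diff_comp.
Qed.

Lemma derive_rV_sum W m (f : 'rV[R]_m -> W) p v : differentiable f p ->
  'D_v f p = \sum_j v 0 j *: 'D_(delta_mx 0 j) f p.
Proof.
move=> df; rewrite deriveE // {1}[v]row_sum_delta linear_sum.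
by apply: eq_bigr => j _; rewrite linearZ deriveE.
Qed.

(** The chain rule gives a derivative of f in the direction ['D_v g p], which varies with p, while
    [Ck] speaks of fixed directions. Expanding that direction in the standard basis leaves a sum of
    products to which the induction applies. *)
Lemma Ck_comp V m k (O : set V) (O' : set 'rV[R]_m) (f : 'rV[R]_m -> R)
    (g : V -> 'rV[R]_m) : open O ->
  (forall p, O p -> O' (g p)) -> Ck k O' (f : _ -> R^o) -> Ck k O g ->
  Ck k O (f \o g : _ -> R^o).
Proof.
move=> oO gO; elim: k f g gO => [|k IH] f g gO.
  by move=> cf cg p Op; apply: continuous_comp; [exact: cg|exact/cf/gO].
move=> [df Df] cg; have cg' := Ck_pred cg; case: cg => dg Dg.
split=> [p Op|v].
  by apply: differentiable_comp; [exact: dg|exact/df/gO].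
apply: (@Ck_ext _ _ _ _ (fun p => \sum_j 'D_v g p 0 j *
    'D_(delta_mx 0 j) (f : _ -> R^o) (g p) : R^o)) => //.
  move=> p Op; rewrite derive_comp_rV; [|exact/df/gO|exact: dg].
  by rewrite derive_rV_sum; last exact/df/gO.
apply: Ck_sum => // j; apply: Ck_mul => //.
  by apply: (Ck_rVP _ _ oO).1; exact: Dg.
exact: (IH _ g gO (Df _) cg').
Qed.

Lemma derive_sum_prod V m (c g : 'I_m -> V -> R) p v :
  (forall a, differentiable (c a : V -> R^o) p) ->
  (forall a, differentiable (g a : V -> R^o) p) ->
  'D_v (fun q => \sum_a c a q * g a q : R^o) p =
  \sum_a (c a p * 'D_v (g a : V -> R^o) p + 'D_v (c a : V -> R^o) p * g a p).
Proof.
move=> dc dg.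
rewrite (_ : (fun q => _) = \sum_a (c a * g a : V -> R^o)); last first.
  by apply/funext => q; rewrite fct_sumE.
rewrite derive_sum; last by move=> a; apply: derivableM; exact: diff_derivable.
apply: eq_bigr => a _.
by rewrite (deriveM (diff_derivable (dc a)) (diff_derivable (dg a))) [_ *: 'D_v (c a) p]mulrC.
Qed.

Lemma derive_sum_scale V m (c : 'I_m -> R) (g : 'I_m -> V -> R) p v :
  (forall a, differentiable (g a : V -> R^o) p) ->
  'D_v (fun q => \sum_a c a * g a q : R^o) p =
  \sum_a c a * 'D_v (g a : V -> R^o) p.
Proof.
move=> dg; rewrite (derive_sum_prod v (fun a => differentiable_cst (c a : R^o) p) dg).
by apply: eq_bigr => a _; rewrite derive_cst mul0r addr0.
Qed.

End Calculus.

Section Schwarz.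
Context {R : realType} {V : normedModType R}.

Lemma line_mvt (h : V -> R^o) (q u : V) (t : R) : 0 < t ->
  (forall s, 0 <= s <= t -> differentiable h (q + s *: u)) ->
  exists2 s, 0 < s < t & h (q + t *: u) - h q = t * 'D_u h (q + s *: u).
Proof.
move=> t0 dh; pose line (s : R) := q + s *: u.
have dl s : is_diff s line (fun r => r *: u).
  by apply: is_diff_eq; apply/funext => r; rewrite /= add0r.
have dhl s : 0 <= s <= t -> is_diff s (h \o line) ('d h (line s) \o (fun r => r *: u)).
  by move=> /dh/differentiableP dhs; apply: is_diff_comp.
have [||s] := @MVT _ (h \o line) (fun s => 'D_u h (line s)) 0 t t0.
- move=> s; rewrite in_itv /= => /andP[/ltW s0 /ltW st].
  have := dhl s; rewrite s0 st => /(_ isT) dhs.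
  split; first by apply: diff_derivable; exact: ex_diff.
  rewrite deriveE; last exact: ex_diff.
  rewrite [LHS](_ : _ = 'd h (line s) u); last by rewrite diff_val /= scale1r.
  by rewrite deriveE //; apply: dh; rewrite s0.
- apply/continuous_in_subspaceT => s; rewrite inE /= in_itv /= => st.
  apply: differentiable_continuous; exact: (@ex_diff _ _ _ _ _ _ _ (dhl s st)).
- by rewrite in_itv /= => st; rewrite /line /= scale0r addr0 subr0 mulrC => E; exists s.
Qed.

(** The mean value theorem along u for phi q = f (q + t v) - f q, then along v for the derivative of
    f along u. *)
Lemma second_difference (O : set V) (f : V -> R^o) (p u v : V) (t : R) :
  Ck 2 O f -> 0 < t ->
  (forall s r, 0 <= s <= t -> 0 <= r <= t -> O (p + s *: u + r *: v)) ->
  exists s r, [/\ 0 < s < t, 0 < r < t &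
    (f (p + t *: u + t *: v) - f (p + t *: u)) - (f (p + t *: v) - f p) =
    t * (t * 'D_v ('D_u f) (p + s *: u + r *: v))].
Proof.
move=> [df Df] t0 pO; have tt : 0 <= t <= t by rewrite lexx ltW.
have zt : 0 <= (0 : R) <= t by rewrite lexx ltW.
have pO0 s : 0 <= s <= t -> O (p + s *: u).
  by move=> st; have := pO s 0 st zt; rewrite scale0r addr0.
pose phi q := f (q + t *: v) - f q.
have dsh q : O (q + t *: v) ->
    is_diff q (fun q => f (q + t *: v)) ('d f (q + t *: v)).
  move=> Oq; have d1 : is_diff q (fun q => q + t *: v) id.
    by apply: is_diff_eq; apply/funext => r /=; rewrite addr0.
  have d2 : is_diff (q + t *: v) f ('d f (q + t *: v)) by exact/differentiableP/df.
  exact: (is_diff_comp d1 d2).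
have dphi q : O q -> O (q + t *: v) -> differentiable phi q.
  move=> Oq Oq'; have d1 := dsh q Oq'; apply: differentiableB; last exact: df.
  exact: ex_diff.
have [s st E1] : exists2 s, 0 < s < t &
    phi (p + t *: u) - phi p = t * 'D_u phi (p + s *: u).
  by apply: line_mvt => // s st; apply: dphi; [exact: pO0|exact: pO].
have st' : 0 <= s <= t by case/andP: st => /ltW-> /ltW->.
have [r rt E2] : exists2 r, 0 < r < t & 'D_u f (p + s *: u + t *: v) -
    'D_u f (p + s *: u) = t * 'D_v ('D_u f) (p + s *: u + r *: v).
  apply: (@line_mvt ('D_u f)) => // r rt; case: (Df u) => + _; apply.
  exact: pO.
exists s, r; split => //; rewrite -/(phi _) -E2 -/(phi p) E1; congr (_ * _).
have d1 := dsh _ (pO s t st' tt).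
rewrite (@deriveB _ _ _ (fun q => f (q + t *: v)) f).
- congr (_ - _); rewrite deriveE ?diff_val; last exact: (@ex_diff _ _ _ _ _ _ _ d1).
  by rewrite deriveE //; exact: df (pO s t st' tt).
- exact/diff_derivable/ex_diff.
- exact/diff_derivable/df/pO0.
Qed.

(** The conclusion is absurd on purpose: no z is closer to both x and y than half their distance. It
    supplies the contradiction when two mixed derivatives are supposed to differ. *)
Lemma near_half_dist (x y z : R) :
  `|x - z| < `|x - y| / 2 -> `|y - z| < `|x - y| / 2 -> `|x - y| < `|x - y|.
Proof.
move=> xz yz; rewrite [ltRHS]splitr -(subrKA z x (- y)).
apply: le_lt_trans (ler_normD _ _) _; rewrite subrKA.
by apply: ltrD => //; rewrite distrC.
Qed.

(* The second difference is symmetric in [u] and [v]; two applications of the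
   mean value theorem, in either order, express it by either mixed derivative. *)
Lemma derive_swap (O : set V) (f : V -> R^o) (p u v : V) : open O -> O p ->
  Ck 2 O f -> 'D_u ('D_v f) p = 'D_v ('D_u f) p.
Proof.
move=> oO Op cf; apply/eqP/negPn/negP => neq.
set a := 'D_u ('D_v f) p; set b := 'D_v ('D_u f) p.
have e0 : 0 < `|a - b| / 2 by rewrite divr_gt0 // normr_gt0 subr_eq0.
have ca : {for p, continuous ('D_u ('D_v f))}.
  exact: ((cf.2 v).2 u p Op).
have cb : {for p, continuous ('D_v ('D_u f))}.
  exact: ((cf.2 u).2 v p Op).
have n1 : \forall q \near p, O q := open_nbhs_nbhs (conj oO Op).
have n2 : \forall q \near p, `|a - 'D_u ('D_v f) q| < `|a - b| / 2.
  by move/cvgrPdist_lt : ca; apply.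
have n3 : \forall q \near p, `|b - 'D_v ('D_u f) q| < `|a - b| / 2.
  by move/cvgrPdist_lt : cb; apply.
have /nbhs_ballP[d /= d0 dP] : nbhs p (fun q => O q /\
    (`|a - 'D_u ('D_v f) q| < `|a - b| / 2 /\
     `|b - 'D_v ('D_u f) q| < `|a - b| / 2)).
  exact: filterI n1 (filterI n2 n3).
(* The 1 keeps the divisor positive when u = v = 0; the whole parallelogram with sides t u and t v
   at p then lies in the ball of radius d. *)
pose t := d / (`|u| + `|v| + 1) / 2.
have uv0 : 0 < `|u| + `|v| + 1 by rewrite ltr_wpDl // addr_ge0.
have t0 : 0 < t by rewrite !divr_gt0.
have tP w w' s r : `|w| + `|w'| = `|u| + `|v| ->
    0 <= s <= t -> 0 <= r <= t -> ball p d (p + s *: w + r *: w').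
  move=> E /andP[s0 st] /andP[r0 rt]; rewrite -ball_normE /=.
  rewrite -addrA opprD addNKr normrN.
  apply: le_lt_trans (ler_normD _ _) _; rewrite !normrZ !ger0_norm //.
  apply: (@le_lt_trans _ _ (t * (`|u| + `|v|))).
    by rewrite -E mulrDr lerD // ler_wpM2r.
  apply: (@lt_le_trans _ _ (t * (`|u| + `|v| + 1))).
    by rewrite ltr_pM2l // ltrDl.
  have -> : t * (`|u| + `|v| + 1) = d / 2.
    by rewrite /t -mulrA (mulrC 2^-1) mulrA divfK // gt_eqF.
  by rewrite ler_pdivrMr // ler_peMr ?ler1n // ltW.
have le_t s : 0 < s < t -> 0 <= s <= t by case/andP => /ltW-> /ltW->.
have [s [r [/le_t st /le_t rt E1]]] := second_difference cf t0
  (fun s r st rt => let: conj Oq _ := dP _ (tP u v s r erefl st rt) in Oq).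
have [s' [r' [/le_t st' /le_t rt' E2]]] := second_difference cf t0
  (fun s r st rt => let: conj Oq _ := dP _ (tP v u s r (addrC _ _) st rt) in Oq).
have [_ [_ d1]] := dP _ (tP u v s r erefl st rt).
have [_ [d2 _]] := dP _ (tP v u s' r' (addrC _ _) st' rt').
have E : 'D_v ('D_u f) (p + s *: u + r *: v) = 'D_u ('D_v f) (p + s' *: v + r' *: u).
  (* After multiplication by t twice, both sides are the same second difference with its two middle
     terms exchanged. *)
  apply: (mulfI (lt0r_neq0 t0)); apply: (mulfI (lt0r_neq0 t0)).
  apply: etrans (esym E1) _; apply: etrans _ E2.
  by rewrite (addrAC p (t *: v)) !opprD !opprK addrACA.
rewrite E in d1.
by have := near_half_dist d2 d1; rewrite ltxx.
Qed.

End Schwarz.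

(** * Charts and vector fields *)

Lemma near_eq_continuous (T S : topologicalType) (f g : T -> S) (x : T) :
  {near x, f =1 g} -> {for x, continuous f} -> {for x, continuous g}.
Proof.
move=> fg cf; rewrite /prop_for /continuous_at -(nbhs_singleton fg).
by apply: cvg_trans cf; exact: near_eq_cvg.
Qed.

Section ComplexStructure.
Context {R : realType} {n : nat}.
Implicit Types v w : 'rV[R]_(n + n).

Lemma mulI_linear : linear (@mulI R n).
Proof.
move=> a v w; rewrite /mulI !linearP /= -add_row_mx -scale_row_mx.
by [].
Qed.

HB.instance Definition _ := GRing.isLinear.Build R 'rV[R]_(n + n) 'rV[R]_(n + n)
  *:%R (@mulI R n) mulI_linear.

Lemma mulIK v : mulI (mulI v) = - v.
Proof. by rewrite /mulI row_mxKr row_mxKl -opp_row_mx hsubmxK. Qed.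

Lemma mulI_mx v : mulI v = v *m lin1_mx (@mulI R n).
Proof. by rewrite mul_rV_lin1. Qed.

End ComplexStructure.

Section Charts.
Context {R : realType} {n : nat} {X : complex_manifold R n}.
Local Notation m := (n + n)%N.
Implicit Types (i j k : atlas X) (x : X) (U V W : vector_field X) (O : set X).

Definition chart_image i O : set 'rV[R]_m := chart i @` (dom i `&` O).

Lemma chart_imageP i O x : dom i x -> O x -> chart_image i O (chart i x).
Proof. by move=> ix Ox; exists x. Qed.

Lemma chart_imageS i O O' : O `<=` O' -> chart_image i O `<=` chart_image i O'.
Proof. by move=> OO' _ [x [ix Ox] <-]; exists x => //; split => //; exact: OO'. Qed.

Lemma open_chart_image i O : open O -> open (chart_image i O).
Proof.
move=> oO; rewrite openE => _ [x [ix Ox] <-] /=; rewrite /interior.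
have ni : nbhs (chart i x) (chart i @` dom i).
  by apply: open_nbhs_nbhs; split; [exact: image_open|exists x].
have nO : nbhs (chart i x) (param i @^-1` O).
  by apply: (param_continuous ix); rewrite chartK //; exact: open_nbhs_nbhs.
near=> q; have [y iy yq] : (chart i @` dom i) q by near: q.
exists y => //; split => //; rewrite -(chartK iy) yq.
by near: q.
Unshelve. all: by end_near. Qed.

Definition transition i j : 'rV[R]_m -> 'rV[R]_m := chart j \o param i.

Lemma transition_chart i j x : dom i x -> transition i j (chart i x) = chart j x.
Proof. by move=> ix; rewrite /transition /= chartK. Qed.

Lemma transition_smooth i j O : O `<=` dom j ->
  smooth_on (chart_image i O) (transition i j).
Proof.
move=> Oj k; apply: Ck_sub ((transition_holomorphic i j).1 k).
exact: chart_imageS.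
Qed.

Lemma transition_differentiable i j x : dom i x -> dom j x ->
  differentiable (transition i j) (chart i x).
Proof.
move=> ix jx; have [+ _] := @transition_smooth i j _ (@subset_refl _ (dom j)) 1.
by apply; exact: chart_imageP.
Qed.

(** The lock keeps conversion from unfolding a Jacobian down to limits. Matrices act on row vectors
    from the right, so products follow the order in which charts are changed. *)
Fact change_mx_key : unit. Proof. exact: tt. Qed.
Definition change_mx i j x : 'M[R]_m :=
  locked_with change_mx_key (jacobian (transition i j) (chart i x)).

Lemma change_chartE i j x v : dom i x -> dom j x ->
  change_chart i j x v = v *m change_mx i j x.
Proof.
move=> ix jx; rewrite /change_mx unlock /change_chart deriveEjacobian //.
exact: transition_differentiable.
Qed.

Lemma change_chartD i j x v :
  change_chart i j x v = 'D_v (transition i j) (chart i x).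
Proof. by []. Qed.
#[local] Opaque change_chart.

Lemma change_mx_row i j x a b : dom i x -> dom j x ->
  change_mx i j x a b = 'D_(delta_mx 0 a) (transition i j) (chart i x) 0 b.
Proof.
move=> ix jx; rewrite -change_chartD (change_chartE _ ix jx) -rowE.
by rewrite [RHS]mxE.
Qed.

Lemma near_chart i O x (P : 'rV[R]_m -> Prop) : open O -> dom i x -> O x ->
  (forall y, dom i y -> O y -> P (chart i y)) -> \forall p \near chart i x, P p.
Proof.
move=> oO ix Ox PO; have: nbhs (chart i x) (chart_image i O).
  apply: open_nbhs_nbhs; split; [exact: open_chart_image|exact: chart_imageP].
by apply: filterS => _ [y [iy Oy] <-]; exact: PO.
Qed.

(** The chain rule; the transition from i to k factors through j only near [chart i x], which
    suffices for derivatives. *)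
Lemma change_chart_trans i j k x v : dom i x -> dom j x -> dom k x ->
  change_chart j k x (change_chart i j x v) = change_chart i k x v.
Proof.
move=> ix jx kx; rewrite !change_chartD -(transition_chart j ix) -derive_comp_rV.
- apply: near_eq_derive; apply: (near_chart (dom_open j)) => // y iy jy.
  by rewrite /transition /= !chartK.
- by rewrite transition_chart //; exact: transition_differentiable.
- exact: transition_differentiable.
Qed.

Lemma change_chart_id i x v : dom i x -> change_chart i i x v = v.
Proof.
move=> ix; rewrite change_chartD -[RHS](derive_id (chart i x)).
apply: near_eq_derive; apply: (near_chart (dom_open i)) => // y iy _.
exact: transition_chart.
Qed.

Lemma change_mx_trans i j k x : dom i x -> dom j x -> dom k x ->
  change_mx i j x *m change_mx j k x = change_mx i k x.
Proof.
move=> ix jx kx; apply/row_matrixP => a; rewrite !rowE mulmxA.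
have := change_chart_trans (delta_mx 0 a) ix jx kx.
by rewrite (change_chartE _ ix jx) (change_chartE _ jx kx) (change_chartE _ ix kx).
Qed.

Lemma change_mx1 i x : dom i x -> change_mx i i x = 1%:M.
Proof.
move=> ix; apply/row_matrixP => a; rewrite !rowE mulmx1.
by have := change_chart_id (delta_mx 0 a) ix; rewrite (change_chartE _ ix ix).
Qed.

Lemma change_mxV i j x : dom i x -> dom j x ->
  change_mx i j x *m change_mx j i x = 1%:M.
Proof. by move=> ix jx; rewrite change_mx_trans // change_mx1. Qed.

Lemma change_chartK i j x v : dom i x -> dom j x ->
  change_chart j i x (change_chart i j x v) = v.
Proof. by move=> ix jx; rewrite change_chart_trans // change_chart_id. Qed.

Lemma change_chart_linear i j x : dom i x -> dom j x -> linear (change_chart i j x).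
Proof. by move=> ix jx a v w; rewrite !change_chartE // mulmxDl scalemxAl. Qed.

Lemma change_chart_mulI i j x v : dom i x -> dom j x ->
  change_chart i j x (mulI v) = mulI (change_chart i j x v).
Proof.
move=> ix jx; rewrite !change_chartD [LHS](transition_holomorphic i j).2 //.
exact: chart_imageP.
Qed.

Lemma change_mx_continuous i j x : dom i x -> dom j x ->
  forall a b, {for x, continuous (fun y => change_mx i j y a b)}.
Proof.
move=> ix jx a b; have ox : nbhs x (dom i `&` dom j).
  by apply: open_nbhs_nbhs; split; [apply: openI; exact: dom_open|].
have [_ /(_ (delta_mx 0 a)) sm] := @transition_smooth i j _ (@subset_refl _ (dom j)) 1.
have c := sm _ (chart_imageP ix jx).
apply: (@near_eq_continuous _ _ (fun y => 'D_(delta_mx 0 a) (transition i j) (chart i y) 0 b)).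
  by apply: filterS ox => y [iy jy]; rewrite change_mx_row.
exact: (cvg_comp _ _ (cvg_comp _ _ (chart_continuous ix) c) (@coord_continuous _ _ _ 0 b _)).
Qed.

End Charts.

(* Unification would otherwise unfold directional derivatives down to limits. *)
#[local] Opaque change_chart.

Section Fields.
Context {R : realType} {n : nat} {X : complex_manifold R n}.
Local Notation m := (n + n)%N.
Implicit Types (i j : atlas X) (x : X) (U V W : vector_field X) (O : set X).

Definition component i U (p : 'rV[R]_m) : 'rV[R]_m :=
  change_chart (at_ (param i p)) i (param i p) (U (param i p)).

Lemma component_chart i U x : dom i x ->
  component i U (chart i x) = change_chart (at_ x) i x (U x).
Proof. by move=> ix; rewrite /component chartK. Qed.

(** Meaningful on [dom i] only. For constant u these are the coordinate fields, the local frame of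
    all later computations. *)
Definition chart_field i (u : 'rV[R]_m -> 'rV[R]_m) : vector_field X :=
  fun x => change_chart i (at_ x) x (u (chart i x)).

Lemma component_chart_field i u x : dom i x ->
  component i (chart_field i u) (chart i x) = u (chart i x).
Proof.
by move=> ix; rewrite component_chart // change_chartK //; exact: at_dom.
Qed.

Lemma chart_field_component i U x : dom i x ->
  chart_field i (component i U) x = U x.
Proof.
by move=> ix; rewrite /chart_field component_chart // change_chartK //; exact: at_dom.
Qed.

Lemma smooth_field_sub O O' W : O' `<=` O -> smooth_field O W -> smooth_field O' W.
Proof. by move=> OO' sf i k; apply: Ck_sub (sf i k); exact: chart_imageS. Qed.

Lemma smooth_fun_chart i O (f : X -> R) : open O -> O `<=` dom i ->
  smooth_on (chart_image i O) (f \o param i : _ -> R^o) -> smooth_fun O f.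
Proof.
move=> oO Oi sf j k; apply: (@Ck_ext _ _ _ _ _ ((f \o param i) \o transition j i)).
- exact: (open_chart_image (i := j)).
- by move=> _ [y [jy Oy] <-]; rewrite /transition /= !chartK //; exact: Oi.
- apply: (@Ck_comp _ _ _ _ _ (chart_image i O)).
  + exact: (open_chart_image (i := j)).
  + move=> _ [y [jy Oy] <-]; rewrite transition_chart //; apply: chart_imageP => //.
    exact: Oi.
  + exact: sf.
  + exact: transition_smooth.
Qed.

Lemma smooth_fieldP O W :
  smooth_field O W <-> forall i, smooth_on (chart_image i O) (component i W).
Proof. by []. Qed.

(** Components in another chart arise by multiplication with Jacobian entries of a transition map,
    which are smooth; one chart containing O is therefore enough. *)
Lemma smooth_field_chart i O W : open O -> O `<=` dom i ->
  smooth_on (chart_image i O) (component i W) -> smooth_field O W.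
Proof.
move=> oO Oi sW; apply/smooth_fieldP => j k.
have oj : open (chart_image j O) by exact: open_chart_image.
apply/(Ck_rVP _ _ oj) => b.
apply: (@Ck_ext _ _ _ _ _ (fun q => \sum_a component i W (transition j i q) 0 a *
   'D_(delta_mx 0 a) (transition i j) (transition j i q) 0 b : R^o)) => //.
  move=> _ [y [jy Oy] <-]; have iy := Oi y Oy; have ay := at_dom y.
  rewrite transition_chart // !component_chart //.
  rewrite -(change_chart_trans (W y) ay iy jy) (change_chartE _ iy jy).
  rewrite mxE; apply: eq_bigr => a _.
  by rewrite [change_mx _ _ _ _ _]change_mx_row.
have tO : forall q, chart_image j O q -> chart_image i O (transition j i q).
  move=> _ [y [jy Oy] <-]; rewrite transition_chart //; apply: chart_imageP => //.
  exact: Oi.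
have st : smooth_on (chart_image j O) (transition j i) by exact: transition_smooth.
apply: Ck_sum => // a; apply: Ck_mul => //.
  apply: (@Ck_comp _ _ _ _ _ (chart_image i O)
    (fun p => component i W p 0 a)) => //.
  apply: (Ck_rVP _ _ _).1; [exact: open_chart_image|exact: sW].
apply: (@Ck_comp _ _ _ _ _ (chart_image i (dom j))
  (fun p => 'D_(delta_mx 0 a) (transition i j) p 0 b)) => //.
  by move=> q [y [jy Oy] <-]; rewrite transition_chart; [exact/chart_imageP/jy/Oi|].
apply: (Ck_rVP _ _ _).1; first exact/open_chart_image/dom_open.
(* The Jacobian costs one derivative, hence the order [k.+1] for the transition map. *)
exact: ((@transition_smooth _ _ X i j _ (@subset_refl _ _) k.+1).2 _).
Qed.

Lemma smooth_const_field i O v : open O -> O `<=` dom i ->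
  smooth_field O (chart_field i (cst v)).
Proof.
move=> oO Oi; apply: (smooth_field_chart oO Oi) => k.
apply: (@Ck_ext _ _ _ _ _ (cst v)); first exact: open_chart_image.
  by move=> _ [y [iy _] <-]; rewrite component_chart_field.
exact: Ck_cst.
Qed.

Lemma smooth_fun_coord i O W a : open O -> O `<=` dom i -> smooth_field O W ->
  smooth_fun O (fun x => component i W (chart i x) 0 a).
Proof.
move=> oO Oi sW; apply: (smooth_fun_chart oO Oi) => k.
apply: (@Ck_ext _ _ _ _ _ (fun p => component i W p 0 a : R^o)).
- exact: open_chart_image.
- by move=> _ [y [iy _] <-]; rewrite /= chartK.
- by apply: (Ck_rVP _ _ _).1; [exact: open_chart_image|exact: sW].
Qed.

Lemma component_linear i O f U V x : dom i x ->
  component i (fun y => f y *: U y + V y) (chart i x) =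
  f x *: component i U (chart i x) + component i V (chart i x).
Proof.
by move=> ix; rewrite !component_chart // (change_chart_linear (at_dom x) ix).
Qed.

Lemma smooth_fieldP' O W : open O -> smooth_field O W <-> forall i a k,
  Ck k (chart_image i O) (fun p => component i W p 0 a : R^o).
Proof.
move=> oO; split=> [sW i a k|sW i k].
  by apply: (Ck_rVP _ _ _).1; [exact: open_chart_image|exact: sW].
by apply/Ck_rVP; [exact: open_chart_image|move=> a; exact: sW].
Qed.

Lemma smooth_field_ext O U V : open O -> (forall x, O x -> U x = V x) ->
  smooth_field O U -> smooth_field O V.
Proof.
move=> oO UV sU i k; apply: Ck_ext (sU i k); first exact: open_chart_image.
by move=> _ [y [iy Oy] <-]; rewrite !chartK // UV.
Qed.

Lemma smooth_field_linear O f U V : open O -> smooth_fun O f ->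
  smooth_field O U -> smooth_field O V ->
  smooth_field O (fun x => f x *: U x + V x).
Proof.
move=> oO sf /(smooth_fieldP' _ oO) sU /(smooth_fieldP' _ oO) sV.
apply/(smooth_fieldP' _ oO) => i a k; have oi := open_chart_image (i := i) oO.
apply: (@Ck_ext _ _ _ _ _ (fun p => f (param i p) * component i U p 0 a
  + component i V p 0 a : R^o)) => //.
  move=> _ [y [iy Oy] <-]; rewrite component_linear // chartK // [RHS]mxE.
  by rewrite [X in _ = X + _]mxE.
by apply: Ck_add => //; apply: Ck_mul => //; exact: sf.
Qed.

Lemma smooth_cst O (c : R) : smooth_fun (X := X) O (cst c).
Proof. by move=> i k; exact: Ck_cst. Qed.

Lemma smooth_zero O : open O -> smooth_field (X := X) O (fun _ => 0).
Proof.
move=> oO; apply/smooth_fieldP' => // i a k.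
apply: (@Ck_ext _ _ _ _ _ (cst 0)); first exact: open_chart_image.
  move=> _ [y [iy Oy] <-]; rewrite component_chart //.
  by rewrite (change_chartE _ (at_dom y) iy) mul0mx mxE.
exact: Ck_cst.
Qed.

Lemma smooth_add O U V : open O -> smooth_field O U -> smooth_field O V ->
  smooth_field O (fun x => U x + V x).
Proof.
move=> oO sU sV; have := smooth_field_linear oO (@smooth_cst O 1) sU sV.
by apply: smooth_field_ext => // x _; rewrite scale1r.
Qed.

Lemma smooth_scale O f U : open O -> smooth_fun O f -> smooth_field O U ->
  smooth_field O (fun x => f x *: U x).
Proof.
move=> oO sf sU; have := smooth_field_linear oO sf sU (smooth_zero oO).
by apply: smooth_field_ext => // x _; rewrite addr0.
Qed.

Lemma smooth_sub O U V : open O -> smooth_field O U -> smooth_field O V ->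
  smooth_field O (fun x => U x - V x).
Proof.
move=> oO sU sV; have := smooth_field_linear oO (@smooth_cst O (-1)) sV sU.
by apply: smooth_field_ext => // x _; rewrite scaleN1r addrC.
Qed.

Lemma smooth_sum O (I : Type) (r : seq I) (W : I -> vector_field X) : open O ->
  (forall a, smooth_field O (W a)) -> smooth_field O (fun x => \sum_(a <- r) W a x).
Proof.
move=> oO sW; elim: r => [|a r IH].
  by apply: smooth_field_ext (smooth_zero oO) => // x _; rewrite big_nil.
by apply: smooth_field_ext (smooth_add oO (sW a) IH) => // x _; rewrite big_cons.
Qed.

Lemma smooth_mulI O U : open O -> smooth_field O U ->
  smooth_field O (fun x => mulI (U x)).
Proof.
move=> oO /(smooth_fieldP' _ oO) sU.
apply/(smooth_fieldP' _ oO) => i a k; have oi := open_chart_image (i := i) oO.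
apply: (@Ck_ext _ _ _ _ _ (fun p => \sum_b component i U p 0 b *
   cst (lin1_mx (@mulI R n) b a) p : R^o)) => //.
  move=> _ [y [iy Oy] <-]; rewrite !component_chart //.
  by rewrite (change_chart_mulI _ (at_dom y) iy) mulI_mx mxE.
apply: Ck_sum => // b; apply: Ck_mul => //; exact: Ck_cst.
Qed.

Lemma chart_field_sum i W x : dom i x ->
  W x = \sum_a component i W (chart i x) 0 a *: chart_field i (cst (delta_mx 0 a)) x.
Proof.
move=> ix; rewrite -[LHS](chart_field_component W ix) /chart_field.
rewrite (change_chartE _ ix (at_dom x)) {1}[component _ _ _]row_sum_delta.
rewrite mulmx_suml; apply: eq_bigr => a _.
by rewrite (change_chartE _ ix (at_dom x)) scalemxAl.
Qed.

End Fields.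

(** * Derivatives along vector fields and Lie brackets *)

Lemma derive_dirB (R : realType) (V W : normedModType R) (f : V -> W) p v w :
  differentiable f p -> 'D_(v - w) f p = 'D_v f p - 'D_w f p.
Proof. by move=> df; rewrite !deriveE // linearB. Qed.

Lemma subr_addr_cancel (R : zmodType) (a b c d : R) : b = d -> a + b - (c + d) = a - c.
Proof. by move=> ->; rewrite opprD addrACA subrr addr0. Qed.

Lemma derive_near_cst (R : realType) (V W : normedModType R) (f : V -> W) p v :
  (exists a, \forall q \near p, f q = a) -> 'D_v f p = 0.
Proof.
by move=> [a fa]; rewrite (near_eq_derive (g := cst a)) ?derive_cst //.
Qed.

Section VectorFieldDerivatives.
Context {R : realType} {n : nat} {X : complex_manifold R n}.
Local Notation m := (n + n)%N.
Implicit Types (i j : atlas X) (x : X) (U V W : vector_field X) (O : set X) (f : X -> R).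

Lemma smooth_fun_differentiable i O f x : open O -> smooth_fun O f -> dom i x -> O x ->
  differentiable (f \o param i : _ -> R^o) (chart i x).
Proof. by move=> oO sf ix Ox; apply: (sf i 1).1; exact: chart_imageP. Qed.

(** The definition uses the chart [at_ x], which changes with x. By the chain rule a fixed chart
    gives the same value, so that U f can be differentiated again. *)
Lemma field_derive_chart i O U f x : open O -> smooth_fun O f -> dom i x -> O x ->
  field_derive U f x =
  'D_(component i U (chart i x)) (f \o param i : _ -> R^o) (chart i x).
Proof.
move=> oO sf ix Ox; have ax := at_dom x; rewrite component_chart //.
rewrite change_chartD -(transition_chart i ax) -derive_comp_rV.
- apply: near_eq_derive; apply: (near_chart (openI oO (dom_open i))) => //.
  by move=> y ay [Oy iy]; rewrite /transition /= (chartK ay) (chartK iy).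
- by rewrite transition_chart //; exact: smooth_fun_differentiable sf ix Ox.
- exact: transition_differentiable.
Qed.

Lemma derive_sum_mul (O : set 'rV[R]_m) (phi : 'rV[R]_m -> R^o) p v : Ck 1 O phi -> O p ->
  'D_v phi p = \sum_k v 0 k * 'D_(delta_mx 0 k) phi p.
Proof. by move=> [dphi _] Op; exact/derive_rV_sum/dphi. Qed.

Lemma smooth_field_derive O U f : open O -> smooth_field O U -> smooth_fun O f ->
  smooth_fun O (field_derive U f).
Proof.
move=> oO /(smooth_fieldP' _ oO) sU sf i k; have oi := open_chart_image (i := i) oO.
apply: (@Ck_ext _ _ _ _ _ (fun p => \sum_a component i U p 0 a *
   'D_(delta_mx 0 a) (f \o param i : _ -> R^o) p : R^o)) => //.
  move=> _ [y [iy Oy] <-]; rewrite /= (chartK iy) (field_derive_chart U oO sf iy Oy).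
  by rewrite (derive_sum_mul _ (sf i 1)) //; exact: chart_imageP.
apply: Ck_sum => // a; apply: Ck_mul => //; first exact: sU.
exact: (sf i k.+1).2 (delta_mx 0 a).
Qed.

(** The product rule for V f, the sum of the components of V times the partial derivatives of f. The
    first term survives in the bracket; in the second the components of V are frozen at p, which
    makes it symmetric in U and V. *)
Lemma second_field_derive i O U V f x : open O -> smooth_field O V ->
    smooth_fun O f -> dom i x -> O x ->
  let p := chart i x in let u := component i U p in
  let phi := f \o param i : _ -> R^o in
  field_derive U (field_derive V f) x =
  'D_('D_u (component i V) p) phi p + 'D_u ('D_(component i V p) phi) p.
Proof.
move=> oO sV sf ix Ox p u phi; have oi := open_chart_image (i := i) oO.
have pO : chart_image i O p by exact: chart_imageP.
rewrite (field_derive_chart U oO (smooth_field_derive oO sV sf) ix Ox) -/p -/u.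
have dV : differentiable (component i V) p by apply: (sV i 1).1.
have dVa a := (differentiable_rVP _ _).1 dV a.
have dphi a : differentiable ('D_(delta_mx 0 a) phi) p.
  by apply: ((sf i 2).2 (delta_mx 0 a)).1.
transitivity ('D_u (fun q => \sum_a component i V q 0 a * 'D_(delta_mx 0 a) phi q : R^o) p).
  apply: near_eq_derive; apply: (near_chart oO) => // y iy Oy.
  rewrite /= (chartK iy) (field_derive_chart V oO sf iy Oy).
  by rewrite (derive_sum_mul _ (sf i 1)) //; exact: chart_imageP.
have -> : 'D_u ('D_(component i V p) phi) p =
    'D_u (fun q => \sum_a component i V p 0 a * 'D_(delta_mx 0 a) phi q : R^o) p.
  apply: near_eq_derive; apply: (near_chart oO) => // y iy Oy.
  by rewrite (derive_sum_mul _ (sf i 1)) //; exact: chart_imageP.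
rewrite (derive_sum_prod _ dVa dphi) (derive_sum_scale (fun a => component i V p 0 a) _ dphi).
rewrite (derive_sum_mul _ (sf i 1) pO) -big_split /=; apply: eq_bigr => a _.
rewrite [RHS]addrC; congr (_ + _ * _); exact/esym/derive_rV.
Qed.

Lemma smooth_chart_coord i O a : open O -> O `<=` dom i ->
  smooth_fun O (fun y => chart i y 0 a).
Proof.
move=> oO Oi; apply: (smooth_fun_chart oO Oi) => k.
apply: (@Ck_ext _ _ _ _ _ (fun p : 'rV[R]_m => p 0 a : R^o)); first exact: open_chart_image.
  by move=> _ [y [iy _] <-]; rewrite /= chartK.
have oi := open_chart_image (i := i) oO.
case: k => [p _|k]; first exact: coord_continuous.
split=> [p _|v]; first exact: differentiable_coord.
rewrite (_ : (fun p => _) = cst (v 0 a)); first exact: Ck_cst.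
apply/funext => p; rewrite -derive_rV; last exact: (@ex_diff _ _ _ _ _ id).
by rewrite derive_id.
Qed.

(** On a coordinate function a derivative in a fixed direction is constant, so the second-order term
    vanishes. *)
Lemma bracket_component O U V x : open O -> smooth_field O U -> smooth_field O V ->
  O x -> let p := chart (at_ x) x in
  bracket U V x = 'D_(U x) (component (at_ x) V) p - 'D_(V x) (component (at_ x) U) p.
Proof.
move=> oO sU sV Ox p; apply/rowP => a; rewrite [LHS]mxE [RHS]mxE [X in _ = _ + X]mxE.
set i := at_ x; have ix : dom i x by exact: at_dom.
set O' := O `&` dom i; have oO' : open O' by apply: openI => //; exact: dom_open.
have O'i : O' `<=` dom i by move=> y [].
have O'O : O' `<=` O by move=> y [].
have Ox' : O' x by [].
have sf := smooth_chart_coord a oO' O'i.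
have coordE v y : O' y -> 'D_v ((fun y => chart i y 0 a) \o param i : _ -> R^o) (chart i y) = v 0 a.
  move=> [Oy iy]; rewrite (near_eq_derive (g := (fun p : 'rV[R]_m => p 0 a : R^o))).
    by rewrite -(@derive_rV _ _ _ id) ?derive_id //; exact: (@ex_diff _ _ _ _ _ id).
  apply: (near_chart oO) => // z iz Oz; by rewrite /= chartK.
have main U' V' : smooth_field O V' ->
    field_derive U' (field_derive V' (fun y => chart i y 0 a)) x =
    'D_(U' x) (component i V') p 0 a.
  move=> sV'; rewrite (second_field_derive U' oO' (smooth_field_sub O'O sV') sf ix Ox').
  rewrite coordE // [X in _ + X]derive_near_cst ?addr0.
    by rewrite (component_chart U' ix) (change_chart_id _ ix).
  exists (component i V' p 0 a).
  by apply: (near_chart oO') => // y iy Oy; rewrite coordE.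
cbv zeta; apply: (f_equal2 (fun s t : R => s - t)); [exact: (main U V sV)|exact: (main V U sU)].
Qed.

(** The bracket is defined through coordinate functions only. For general f the second-order terms
    of U V f and V U f cancel by symmetry of mixed derivatives. *)
Lemma field_derive_bracket O U V f x : open O -> smooth_field O U ->
    smooth_field O V -> smooth_fun O f -> O x ->
  field_derive (bracket U V) f x =
  field_derive U (field_derive V f) x - field_derive V (field_derive U f) x.
Proof.
move=> oO sU sV sf Ox; have ix := at_dom x; have oi := open_chart_image (i := at_ x) oO.
rewrite (second_field_derive U oO sV sf ix Ox) (second_field_derive V oO sU sf ix Ox) /=.
have pO : chart_image (at_ x) O (chart (at_ x) x) by exact: chart_imageP.
apply: etrans; last exact/esym/subr_addr_cancel/(derive_swap _ _ oi pO (sf (at_ x) 2)).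
rewrite (component_chart U ix) (component_chart V ix).
rewrite (change_chart_id (U x) ix) (change_chart_id (V x) ix).
have dphi := smooth_fun_differentiable oO sf ix Ox.
apply: etrans _ (derive_dirB _ _ dphi).
have := bracket_component oO sU sV Ox; rewrite /= => bE.
by rewrite -bE.
Qed.

(** [bracket] is evaluated on the coordinates of [at_ x], which need not be affine in the chart i;
    it vanishes because partial derivatives in i commute. *)
Lemma bracket_const i O v w x : open O -> O `<=` dom i -> O x ->
  bracket (chart_field i (cst v)) (chart_field i (cst w)) x = 0.
Proof.
move=> oO Oi Ox; apply/rowP => a; rewrite 2!mxE.
set O' := O `&` dom (at_ x).
have oO' : open O' by apply: openI => //; exact: dom_open.
have O'i : O' `<=` dom i by move=> y [/Oi].
have Ox' : O' x by split => //; exact: at_dom.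
have O'a : O' `<=` dom (at_ x) by move=> y [].
have sf := smooth_chart_coord a oO' O'a.
have ix := Oi x Ox; have pO := chart_imageP ix Ox'.
have sc u := smooth_const_field u oO' O'i.
have main u u' : field_derive (chart_field i (cst u))
    (field_derive (chart_field i (cst u')) (fun y => chart (at_ x) y 0 a)) x =
    'D_u ('D_u' ((fun y => chart (at_ x) y 0 a) \o param i : _ -> R^o)) (chart i x).
  rewrite (second_field_derive _ oO' (sc u') sf ix Ox') !(component_chart_field _ ix).
  rewrite (derive_near_cst (f := component _ _)) ?derive0 ?add0r //.
  exists u'; by apply: (near_chart oO') => // y iy Oy; rewrite component_chart_field.
apply/eqP; rewrite subr_eq0; apply/eqP; apply: etrans (main v w) _.
apply: etrans _ (esym (main w v)).
exact: derive_swap (open_chart_image (i := i) oO') pO (sf i 2).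
Qed.

End VectorFieldDerivatives.

#[local] Opaque field_derive.

(** * The curvature of a Kaehler manifold *)

Section Metric.
Context {R : realType} {n : nat} {X : kahler_manifold R n}.
Local Notation m := (n + n)%N.
Implicit Types (i j : atlas X) (x : X) (U V W : vector_field X) (O : set X) (f : X -> R).

Lemma metricDr x u v w : metric (k := X) x u (v + w) = metric x u v + metric x u w.
Proof. by have := metric_linear x u 1 v w; rewrite scale1r => ->; rewrite scale1r. Qed.

Lemma metric0r x u : metric (k := X) x u 0 = 0.
Proof. by apply: (addrI (metric x u 0)); rewrite -metricDr !addr0. Qed.

Lemma metricZr x u a v : metric (k := X) x u (a *: v) = a * metric x u v.
Proof.
by have := metric_linear x u a v 0; rewrite addr0 metric0r => ->; rewrite addr0.
Qed.

Lemma metricDl x u v w : metric (k := X) x (v + w) u = metric x v u + metric x w u.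
Proof. by rewrite Defs.metric_sym metricDr !(Defs.metric_sym x u). Qed.

Lemma metricZl x u a v : metric (k := X) x (a *: v) u = a * metric x v u.
Proof. by rewrite Defs.metric_sym metricZr Defs.metric_sym. Qed.

Lemma metricNr x u v : metric (k := X) x u (- v) = - metric x u v.
Proof. by rewrite -scaleN1r metricZr mulN1r. Qed.

Lemma metricNl x u v : metric (k := X) x (- v) u = - metric x v u.
Proof. by rewrite -scaleN1r metricZl mulN1r. Qed.

Lemma metric_sumr x u (I : Type) (r : seq I) (F : I -> 'rV[R]_m) :
  metric (k := X) x u (\sum_(a <- r) F a) = \sum_(a <- r) metric x u (F a).
Proof.
elim: r => [|a r IH]; first by rewrite !big_nil metric0r.
by rewrite !big_cons metricDr IH.
Qed.

Lemma metric_suml x u (I : Type) (r : seq I) (F : I -> 'rV[R]_m) :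
  metric (k := X) x (\sum_(a <- r) F a) u = \sum_(a <- r) metric x (F a) u.
Proof. by rewrite Defs.metric_sym metric_sumr; apply: eq_bigr => a _; rewrite Defs.metric_sym. Qed.

Lemma metric_mulIl x v w : metric (k := X) x (mulI v) w = - metric x v (mulI w).
Proof. by rewrite -metric_hermitian mulIK metricNl. Qed.

Lemma metric_eq0 x v : (forall w, metric (k := X) x v w = 0) -> v = 0.
Proof.
move=> v0; apply/eqP; apply/negPn/negP => /(@metric_pos _ _ X x).
by rewrite v0 ltxx.
Qed.

Lemma smooth_metric O V W : open O -> smooth_field O V -> smooth_field O W ->
  smooth_fun O (fun y => metric y (V y) (W y)).
Proof.
move=> oO /(smooth_fieldP' _ oO) sV /(smooth_fieldP' _ oO) sW i k.
have oi := open_chart_image (i := i) oO.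
pose phi (p : 'rV[R]_m) : R^o := \sum_a \sum_b component i V p 0 a *
  (component i W p 0 b * tensor_component (@metric _ _ X) i (delta_mx 0 a) (delta_mx 0 b) p).
apply: (@Ck_ext _ _ _ _ _ phi) => //.
  move=> _ [y [iy Oy] <-]; rewrite /= (chartK iy).
  rewrite (chart_field_sum V iy) (chart_field_sum W iy) metric_suml.
  apply: eq_bigr => a _; rewrite metric_sumr; apply: eq_bigr => b _.
  by rewrite metricZl metricZr /tensor_component (chartK iy).
apply: Ck_sum => // a; apply: Ck_sum => // b; apply: Ck_mul => //; first exact: sV.
apply: Ck_mul => //; first exact: sW.
by apply: Ck_sub (metric_smooth i _ _ k) => _ [y [iy Oy] <-]; exists y.
Qed.

Lemma field_derive_ext O U f g x : open O -> smooth_fun O f -> smooth_fun O g -> O x ->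
  (forall y, O y -> f y = g y) -> field_derive U f x = field_derive U g x.
Proof.
move=> oO sf sg Ox fg; have ax := at_dom x.
rewrite (field_derive_chart U oO sf ax Ox) (field_derive_chart U oO sg ax Ox).
apply: near_eq_derive; apply: (near_chart oO) => // y ay Oy.
by rewrite /= (chartK ay) (fg y Oy).
Qed.

Lemma smooth_funD O f g : open O -> smooth_fun O f -> smooth_fun O g ->
  smooth_fun O (fun y => f y + g y).
Proof.
move=> oO sf sg i k; have oi := open_chart_image (i := i) oO.
by apply: (Ck_add oi); [exact: sf|exact: sg].
Qed.

Lemma field_deriveD O U f g x : open O -> smooth_fun O f -> smooth_fun O g -> O x ->
  field_derive U (fun y => f y + g y) x = field_derive U f x + field_derive U g x.
Proof.
move=> oO sf sg Ox; have ax := at_dom x.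
rewrite (field_derive_chart U oO sf ax Ox) (field_derive_chart U oO sg ax Ox).
rewrite (field_derive_chart U oO (smooth_funD oO sf sg) ax Ox).
apply: deriveD; apply: diff_derivable; exact: smooth_fun_differentiable ax Ox.
Qed.

End Metric.

Section Tensoriality.
Context {R : realType} {n : nat} {X : complex_manifold R n}.
Local Notation m := (n + n)%N.

(* A local operator that is linear over functions at x depends on W x only. *)
Lemma tensorial (T : vector_field X -> 'rV[R]_m) (i : atlas X) (O : set X) (x : X) :
  open O -> O `<=` dom i -> O x ->
  (forall W W', smooth_field O W -> smooth_field O W' ->
    (forall y, O y -> W y = W' y) -> T W = T W') ->
  (forall W W', smooth_field O W -> smooth_field O W' ->
    T (fun y => W y + W' y) = T W + T W') ->
  (forall f W, smooth_fun O f -> smooth_field O W ->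
    T (fun y => f y *: W y) = f x *: T W) ->
  forall W, smooth_field O W ->
  T W = \sum_a component i W (chart i x) 0 a *: T (chart_field i (cst (delta_mx 0 a))).
Proof.
move=> oO Oi Ox Text Tadd Tscale W sW; have s0 := smooth_zero oO.
have T0 : T (fun _ => 0) = 0.
  have E0 : T (fun y => 0 + 0) = T (fun _ => 0).
    by congr (T _); apply/funext => y; rewrite addr0.
  by apply: (addrI (T (fun _ => 0))); rewrite -(Tadd _ _ s0 s0) E0 addr0.
have sE a := smooth_const_field (delta_mx 0 a) oO Oi.
have sc a := smooth_fun_coord a oO Oi sW.
pose D a y := component i W (chart i y) 0 a *: chart_field i (cst (delta_mx 0 a)) y.
have sD a : smooth_field O (D a) := smooth_scale oO (sc a) (sE a).
have Tsum r : T (fun y => \sum_(a <- r) D a y) = \sum_(a <- r) T (D a).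
  elim: r => [|a r IH].
    by rewrite big_nil -T0; congr (T _); apply/funext => y; rewrite big_nil.
  rewrite big_cons -IH -(Tadd _ _ (sD a) (smooth_sum r oO sD)).
  by congr (T _); apply/funext => y; rewrite big_cons.
have WD y : O y -> W y = \sum_a D a y by move=> Oy; exact/chart_field_sum/Oi.
rewrite (Text _ _ sW (smooth_sum _ oO sD) WD) Tsum.
by apply: eq_bigr => a _; exact: Tscale (sc a) (sE a).
Qed.

End Tensoriality.

(** * The complex structure is parallel *)

Section Parallel.
Context {R : realType} {n : nat} {X : kahler_manifold R n}.
Local Notation m := (n + n)%N.
Implicit Types (i j : atlas X) (x : X) (U V W : vector_field X) (O : set X) (f : X -> R).
Variable nabla : vector_field X -> vector_field X -> vector_field X.
Hypothesis lc : levi_civita nabla.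

Local Notation g i v w := (tensor_component (@metric _ _ X) i v w : _ -> R^o).

Lemma mulI_const_field i v x : dom i x ->
  mulI (chart_field (X := X) i (cst v) x) = chart_field i (cst (mulI v)) x.
Proof. by move=> ix; rewrite /chart_field -(change_chart_mulI _ ix (at_dom x)). Qed.

Definition metric_deriv i u v w x : R := 'D_u (g i v w) (chart i x).

(** Coordinate fields commute, so the Koszul formula loses its bracket terms: metric compatibility
    gives each derivative of g as a sum of two products, and symmetry of the connection identifies
    these in pairs. *)
Lemma koszul i a b c x : dom i x ->
  let E v := chart_field (X := X) i (cst v) in
  2 * metric x (nabla (E a) (E b) x) (E c x) =
  metric_deriv i a b c x + metric_deriv i b a c x - metric_deriv i c a b x.
Proof.
move=> ix E; have oi := dom_open i.
have sE v : smooth_field (dom i) (E v) by apply: smooth_const_field.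
have sgE v w := smooth_metric oi (sE v) (sE w).
pose M u v w := metric x (nabla (E u) (E v) x) (E w x).
have DE u v w : metric_deriv i u v w x = M u v w + M u w v.
  rewrite [M u w v]Defs.metric_sym -(lc_metric lc oi (sE u) (sE v) (sE w) ix).
  rewrite (field_derive_chart (E u) oi (sgE v w) ix ix).
  by rewrite (component_chart_field _ ix).
have sym u v w : M u v w = M v u w.
  have s0 : nabla (E u) (E v) x - nabla (E v) (E u) x = 0.
    by rewrite (lc_torsion lc oi (sE u) (sE v) ix) (bracket_const _ _ oi (@subset_refl _ _) ix).
  by rewrite /M (subr0_eq s0).
rewrite -/(M a b c); clearbody M.
rewrite (DE a b c) (DE b a c) (DE c a b) (sym c a) (sym c b) (sym b a); lra.
Qed.

Lemma metric_derivN i u v w v' w' x : dom i x ->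
  (forall y, dom i y ->
    g i v w (chart i y) = - g i v' w' (chart i y)) ->
  metric_deriv i u v w x = - metric_deriv i u v' w' x.
Proof.
rewrite /metric_deriv => ix gN; have dg : differentiable (g i v' w') (chart i x).
  by apply: (metric_smooth i v' w' 1).1; exists x.
rewrite -(deriveN (diff_derivable dg)); apply: near_eq_derive.
apply: (near_chart (dom_open i)) => // y iy _; exact: gN.
Qed.

Lemma kahler_const i a b c x : dom i x ->
  metric_deriv i a (mulI b) c x + metric_deriv i b (mulI c) a x
  + metric_deriv i c (mulI a) b x = 0.
Proof.
move=> ix; pose p := chart i x.
pose om v w := tensor_component (fun x v w => metric x (mulI v) w) i v w : _ -> R^o.
have cl : 'D_a (om b c) p + 'D_b (om c a) p + 'D_c (om a b) p = 0.
  by apply: (@kahler_closed _ _ X i a b c p); exists x.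
have E u v w : metric_deriv i u (mulI v) w x = 'D_u (om v w) p.
  apply: near_eq_derive; apply: (near_chart (dom_open i)) => // y iy _.
  by rewrite /om /tensor_component (chartK iy) (change_chart_mulI _ iy (at_dom y)).
by rewrite (E a b c) (E b c a) (E c a b); exact: cl.
Qed.

(* The Koszul formulas for (a, ib, c) and (a, b, ic) add up to the difference of
   the closedness relations for (a, b, c) and (a, ib, ic). *)
Lemma nabla_mulI_const i a b x : dom i x ->
  let E v := chart_field (X := X) i (cst v) in
  nabla (E a) (E (mulI b)) x = mulI (nabla (E a) (E b) x).
Proof.
move=> ix E; apply/eqP; rewrite -subr_eq0; apply/eqP/(@metric_eq0 _ _ _ x) => w.
have [c ->] : exists c, w = E c x.
  exists (change_chart (at_ x) i x w).
  by rewrite /E /chart_field /cst change_chartK //; exact: at_dom.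
rewrite metricDl metricNl metric_mulIl opprK (mulI_const_field _ ix) -/(E _).
have k1 : 2 * metric x (nabla (E a) (E (mulI b)) x) (E c x) = _ := koszul a (mulI b) c ix.
have k2 : 2 * metric x (nabla (E a) (E b) x) (E (mulI c) x) = _ := koszul a b (mulI c) ix.
have w1 := kahler_const a b c ix; have w2 := kahler_const a (mulI b) (mulI c) ix.
pose D u v w := metric_deriv i u v w x.
have sym u v v' : D u v v' = D u v' v.
  have gE : g i v v' = g i v' v by apply/funext => q; exact: Defs.metric_sym.
  by rewrite /D /metric_deriv gE.
have HJ u v v' : D u (mulI v) v' = - D u v (mulI v').
  apply: metric_derivN ix _ => y iy; rewrite /tensor_component (chartK iy).
  by rewrite !(change_chart_mulI _ iy (at_dom y)) metric_mulIl.
have HN u v v' : D u (- v) v' = - D u v v'.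
  apply: metric_derivN ix _ => y iy; rewrite /tensor_component (chartK iy).
  by rewrite !(change_chartE _ iy (at_dom y)) mulNmx metricNl.
move: k1 k2 w1 w2; rewrite -!/(D _ _ _) !mulIK => k1 k2 w1 w2.
(* The instances of symmetry, of i-skewness and of sign that match the terms of the Koszul and
   closedness relations; the rest is linear arithmetic. *)
have e1 := HJ a b c; have e2 := sym b (mulI c) a; have e3 := HJ c a b.
have e4 := HN a b (mulI c); have e5 := HN (mulI b) c a; have e6 := sym (mulI b) c a.
have e7 := HJ (mulI c) a (mulI b); rewrite mulIK in e7.
have e8 := sym (mulI c) a (- b); have e9 := HN (mulI c) b a.
have e10 := sym (mulI c) b a.
move: k1 k2; clearbody D; clear sym HJ HN.
generalize (metric x (nabla (E a) (E (mulI b)) x) (E c x)).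
generalize (metric x (nabla (E a) (E b) x) (E (mulI c) x)) => s t k1 k2.
lra.
Qed.

(** The defect nabla_A (iW) - i nabla_A W is tensorial in A, and also in W: the derivative of f in
    the Leibniz rule multiplies iW in both terms and cancels. Two uses of [tensorial] reduce to
    coordinate fields. *)
Lemma nabla_mulI O A W x : open O -> smooth_field O A -> smooth_field O W -> O x ->
  nabla A (fun y => mulI (W y)) x = mulI (nabla A W x).
Proof.
move=> oO0 sA0 sW0 Ox0; pose i := at_ x; have ix : dom i x := at_dom x.
pose O' := O `&` dom i; have oO : open O' by apply: openI => //; exact: dom_open.
have Oi : O' `<=` dom i by move=> y [].
have Ox : O' x by [].
have OO : O' `<=` O by move=> y [].
have sA : smooth_field O' A by apply: smooth_field_sub sA0.
have sW : smooth_field O' W by apply: smooth_field_sub sW0.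
have sE v : smooth_field O' (chart_field i (cst v)) := smooth_const_field v oO Oi.
apply/eqP; rewrite -subr_eq0; apply/eqP.
pose T W := nabla A (fun y => mulI (W y)) x - mulI (nabla A W x).
have TE b : T (chart_field i (cst (delta_mx 0 b))) = 0.
  pose S A := nabla A (fun y => mulI (chart_field i (cst (delta_mx 0 b)) y)) x
    - mulI (nabla A (chart_field i (cst (delta_mx 0 b))) x).
  have sEb := sE (delta_mx 0 b); have sJb := smooth_mulI oO sEb.
  rewrite -[LHS]/(S A) (@tensorial _ _ _ S i O' x oO Oi Ox) //.
  - apply: big1 => a _; rewrite /S.
    have JE y : O' y -> mulI (chart_field i (cst (delta_mx 0 b)) y) =
        chart_field i (cst (mulI (delta_mx 0 b))) y.
      by move=> /Oi; exact: mulI_const_field.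
    have sEa := sE (delta_mx 0 a); have sEJ := sE (mulI (delta_mx 0 b)).
    rewrite (lc_restrict lc oO sEa sEa sJb sEJ (fun _ _ => erefl) JE Ox).
    by rewrite (nabla_mulI_const _ _ ix) subrr scaler0.
  - move=> B B' sB sB' BB'; rewrite /S.
    rewrite (lc_restrict lc oO sB sB' sJb sJb BB' (fun _ _ => erefl) Ox).
    by rewrite (lc_restrict lc oO sB sB' sEb sEb BB' (fun _ _ => erefl) Ox).
  - move=> B B' sB sB'; rewrite /S.
    have cE : (fun y => B y + B' y) = (fun y => cst 1 y *: B y + B' y).
      by apply/funext => y; rewrite scale1r.
    rewrite cE (lc_linear lc oO (smooth_cst (X := X) O' 1) sB sB' sJb Ox).
    rewrite (lc_linear lc oO (smooth_cst (X := X) O' 1) sB sB' sEb Ox).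
    by rewrite !scale1r linearD opprD addrACA.
  - move=> f B sf sB; rewrite /S; have s0 := smooth_zero (X := X) oO.
    (* [lc_linear] treats f U + U' only. That nabla vanishes on the zero field follows from 0 = 1 *
       0 + 0, and scaling alone is then the case U' = 0. *)
    have n0 V : smooth_field O' V -> nabla (fun _ => 0) V x = 0.
      move=> sV; have := lc_linear lc oO (smooth_cst (X := X) O' 1) s0 s0 sV Ox.
      rewrite (_ : (fun y => _) = (fun _ => 0)); last first.
        by apply/funext => y; rewrite scaler0 addr0.
      rewrite scale1r => E; apply: (addrI (nabla (fun _ => 0) V x)).
      by rewrite -E addr0.
    have cE : (fun y => f y *: B y) = (fun y => f y *: B y + 0).
      by apply/funext => y; rewrite addr0.
    rewrite cE (lc_linear lc oO sf sB s0 sJb Ox) (lc_linear lc oO sf sB s0 sEb Ox).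
    by rewrite (n0 _ sJb) (n0 _ sEb) !addr0 linearZ scalerBr.
rewrite -[LHS]/(T W) (@tensorial _ _ _ T i O' x oO Oi Ox) //.
- by apply: big1 => a _; rewrite TE scaler0.
- move=> B B' sB sB' BB'; rewrite /T.
  have sJ := smooth_mulI oO sB; have sJ' := smooth_mulI oO sB'.
  rewrite (lc_restrict lc oO sA sA sB sB' (fun _ _ => erefl) BB' Ox).
  have JBB' y : O' y -> mulI (B y) = mulI (B' y) by move=> /BB' ->.
  by rewrite (lc_restrict lc oO sA sA sJ sJ' (fun _ _ => erefl) JBB' Ox).
- move=> B B' sB sB'; rewrite /T.
  have sJ := smooth_mulI oO sB; have sJ' := smooth_mulI oO sB'.
  rewrite (_ : (fun y => mulI (B y + B' y)) = (fun y => mulI (B y) + mulI (B' y))); last first.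
    by apply/funext => y; rewrite linearD.
  rewrite (lc_additive lc oO sA sJ sJ' Ox) (lc_additive lc oO sA sB sB' Ox).
  by rewrite linearD opprD addrACA.
- move=> f B sf sB; rewrite /T; have sJ := smooth_mulI oO sB.
  rewrite (_ : (fun y => mulI (f y *: B y)) = (fun y => f y *: mulI (B y))); last first.
    by apply/funext => y; rewrite linearZ.
  rewrite (lc_leibniz lc oO sf sA sJ Ox) (lc_leibniz lc oO sf sA sB Ox).
  by rewrite linearD !linearZ opprD addrACA subrr addr0 scalerBr.
Qed.

End Parallel.

(** * Tensoriality and symmetries of the curvature *)

Section Curvature.
Context {R : realType} {n : nat} {X : kahler_manifold R n}.
Local Notation m := (n + n)%N.
Implicit Types (i j : atlas X) (x : X) (U V W : vector_field X) (O : set X) (f : X -> R).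
Variable nabla : vector_field X -> vector_field X -> vector_field X.
Hypothesis lc : levi_civita nabla.

(** The value that [curvature] takes at W x if W is the extension selected; being a field, it can be
    tested for smoothness. *)
Definition curvature_field U V W : vector_field X := fun x =>
  nabla U (nabla V W) x - nabla V (nabla U W) x - nabla (bracket U V) W x.

(* Torsion-freeness transfers smoothness from the connection to the bracket. *)
Lemma smooth_bracket O U V : open O -> smooth_field O U -> smooth_field O V ->
  smooth_field O (bracket U V).
Proof.
move=> oO sU sV.
apply: (smooth_field_ext oO _
  (smooth_sub oO (lc_smooth lc oO sU sV) (lc_smooth lc oO sV sU))).
by move=> y Oy; exact: (lc_torsion lc oO sU sV Oy).
Qed.

Variables (O : set X) (U V : vector_field X).
Hypotheses (oO : open O) (sU : smooth_field O U) (sV : smooth_field O V).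
Let sB := smooth_bracket oO sU sV.

Lemma smooth_curvature_field W : smooth_field O W -> smooth_field O (curvature_field U V W).
Proof.
move=> sW; have s1 := lc_smooth lc oO sU (lc_smooth lc oO sV sW).
have s2 := lc_smooth lc oO sV (lc_smooth lc oO sU sW).
exact: smooth_sub oO (smooth_sub oO s1 s2) (lc_smooth lc oO sB sW).
Qed.

Lemma curvature_field_ext W W' x : smooth_field O W -> smooth_field O W' ->
  (forall y, O y -> W y = W' y) -> O x ->
  curvature_field U V W x = curvature_field U V W' x.
Proof.
move=> sW sW' WW' Ox; have r Z (sZ : smooth_field O Z) y :=
  @lc_restrict _ _ _ _ lc O Z Z W W' oO sZ sZ sW sW' (fun _ _ => erefl) WW' y.
rewrite /curvature_field (r _ sB x Ox).
have sVW := lc_smooth lc oO sV sW; have sVW' := lc_smooth lc oO sV sW'.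
have sUW := lc_smooth lc oO sU sW; have sUW' := lc_smooth lc oO sU sW'.
rewrite (lc_restrict lc oO sU sU sVW sVW' (fun _ _ => erefl) (r _ sV) Ox).
by rewrite (lc_restrict lc oO sV sV sUW sUW' (fun _ _ => erefl) (r _ sU) Ox).
Qed.

Lemma curvature_fieldD W W' x : smooth_field O W -> smooth_field O W' -> O x ->
  curvature_field U V (fun y => W y + W' y) x =
  curvature_field U V W x + curvature_field U V W' x.
Proof.
move=> sW sW' Ox; have sWW := smooth_add oO sW sW'.
have second Z Z' : smooth_field O Z -> smooth_field O Z' ->
    nabla Z (nabla Z' (fun y => W y + W' y)) x =
    nabla Z (nabla Z' W) x + nabla Z (nabla Z' W') x.
  move=> sZ sZ'; have s1 := lc_smooth lc oO sZ' sW; have s2 := lc_smooth lc oO sZ' sW'.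
  rewrite -(lc_additive lc oO sZ s1 s2 Ox).
  apply: (lc_restrict lc oO sZ sZ (lc_smooth lc oO sZ' sWW) (smooth_add oO s1 s2)
    (fun _ _ => erefl) _ Ox) => y Oy.
  exact: (lc_additive lc oO sZ' sW sW' Oy).
rewrite /curvature_field (second U V sU sV) (second V U sV sU).
rewrite (lc_additive lc oO sB sW sW' Ox).
move: (nabla U (nabla V W) x) (nabla U (nabla V W') x) (nabla V (nabla U W) x)
  (nabla V (nabla U W') x) (nabla (bracket U V) W x) (nabla (bracket U V) W' x).
by move=> *; apply/rowP => k; rewrite !mxE; ring.
Qed.

(** The terms (U f) nabla_V W and (V f) nabla_U W occur in both orders and cancel; the second
    derivatives of f leave ([U, V] f) W, which the bracket term of the curvature removes. *)
Lemma curvature_fieldZ f W x : smooth_fun O f -> smooth_field O W -> O x ->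
  curvature_field U V (fun y => f y *: W y) x = f x *: curvature_field U V W x.
Proof.
move=> sf sW Ox; have sfW := smooth_scale oO sf sW.
have second Z Z' : smooth_field O Z -> smooth_field O Z' ->
    nabla Z (nabla Z' (fun y => f y *: W y)) x =
    f x *: nabla Z (nabla Z' W) x + field_derive Z f x *: nabla Z' W x +
    (field_derive Z' f x *: nabla Z W x + field_derive Z (field_derive Z' f) x *: W x).
  move=> sZ sZ'; have s1 := lc_smooth lc oO sZ' sW; have s2 := lc_smooth lc oO sZ' sfW.
  have sf' := smooth_field_derive oO sZ' sf.
  have s3 := smooth_scale oO sf s1; have s4 := smooth_scale oO sf' sW.
  have E y : O y -> nabla Z' (fun y => f y *: W y) y =
      f y *: nabla Z' W y + field_derive Z' f y *: W y.
    exact: (lc_leibniz lc oO sf sZ' sW).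
  rewrite (lc_restrict lc oO sZ sZ s2 (smooth_add oO s3 s4) (fun _ _ => erefl) E Ox).
  rewrite (lc_additive lc oO sZ s3 s4 Ox) (lc_leibniz lc oO sf sZ s1 Ox).
  by rewrite (lc_leibniz lc oO sf' sZ sW Ox).
rewrite /curvature_field (second U V sU sV) (second V U sV sU).
rewrite (lc_leibniz lc oO sf sB sW Ox) (field_derive_bracket oO sU sV sf Ox).
move: (nabla U (nabla V W) x) (nabla V (nabla U W) x) (nabla V W x) (nabla U W x)
  (nabla (bracket U V) W x) (W x) (f x) (field_derive U f x) (field_derive V f x)
  (field_derive U (field_derive V f) x) (field_derive V (field_derive U f) x).
move=> a b c d e w s t u p q; apply/rowP => k; rewrite !mxE; ring.
Qed.

(** U V - V U - [U, V] annihilates the function g(W, W'). Expanding with metric compatibility, the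
    mixed products cancel and the two curvature terms remain. *)
Lemma curvature_field_metric W W' x : smooth_field O W -> smooth_field O W' -> O x ->
  metric x (curvature_field U V W x) (W' x) = - metric x (W x) (curvature_field U V W' x).
Proof.
move=> sW sW' Ox; have sF := smooth_metric oO sW sW'.
have second Z Z' : smooth_field O Z -> smooth_field O Z' ->
    field_derive Z (field_derive Z' (fun y => metric y (W y) (W' y))) x =
    metric x (nabla Z (nabla Z' W) x) (W' x) + metric x (nabla Z' W x) (nabla Z W' x) +
    (metric x (nabla Z W x) (nabla Z' W' x) + metric x (W x) (nabla Z (nabla Z' W') x)).
  move=> sZ sZ'; have s1 := lc_smooth lc oO sZ' sW; have s2 := lc_smooth lc oO sZ' sW'.
  have m1 := smooth_metric oO s1 sW'; have m2 := smooth_metric oO sW s2.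
  rewrite -(lc_metric lc oO sZ s1 sW' Ox) -(lc_metric lc oO sZ sW s2 Ox).
  rewrite -(field_deriveD Z oO m1 m2 Ox).
  apply: (field_derive_ext Z oO (smooth_field_derive oO sZ' sF) (smooth_funD oO m1 m2) Ox).
  by move=> y Oy; exact: (lc_metric lc oO sZ' sW sW' Oy).
have := field_derive_bracket oO sU sV sF Ox.
rewrite (second U V sU sV) (second V U sV sU) (lc_metric lc oO sB sW sW' Ox).
rewrite /curvature_field !metricDl !metricDr !metricNl !metricNr.
generalize (metric x (nabla U (nabla V W) x) (W' x)) (metric x (nabla V W x) (nabla U W' x))
  (metric x (nabla U W x) (nabla V W' x)) (metric x (W x) (nabla U (nabla V W') x))
  (metric x (nabla V (nabla U W) x) (W' x)) (metric x (W x) (nabla V (nabla U W') x))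
  (metric x (nabla (bracket U V) W x) (W' x)) (metric x (W x) (nabla (bracket U V) W' x)).
move=> *; lra.
Qed.

Lemma curvature_field_mulI W x : smooth_field O W -> O x ->
  curvature_field U V (fun y => mulI (W y)) x = mulI (curvature_field U V W x).
Proof.
move=> sW Ox; have sJ := smooth_mulI oO sW.
have second Z Z' : smooth_field O Z -> smooth_field O Z' ->
    nabla Z (nabla Z' (fun y => mulI (W y))) x = mulI (nabla Z (nabla Z' W) x).
  move=> sZ sZ'; have s1 := lc_smooth lc oO sZ' sW; have s2 := lc_smooth lc oO sZ' sJ.
  rewrite -(nabla_mulI lc oO sZ s1 Ox).
  have E y : O y -> nabla Z' (fun y => mulI (W y)) y = mulI (nabla Z' W y).
    exact: (nabla_mulI lc oO sZ' sW).
  exact: (lc_restrict lc oO sZ sZ s2 (smooth_mulI oO s1) (fun _ _ => erefl) E Ox).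
rewrite /curvature_field (second U V sU sV) (second V U sV sU).
by rewrite (nabla_mulI lc oO sB sW Ox) !linearB.
Qed.

End Curvature.

(** * The matrix exponential *)

Section MatrixContinuity.
Context {R : realType}.

Lemma continuous_mxP (Y : topologicalType) p q (A : Y -> 'M[R]_(p, q)) (y : Y) :
  {for y, continuous A} <-> forall i j, {for y, continuous (fun z => A z i j)}.
Proof.
split=> [cA i j|cA].
  exact: (cvg_comp _ _ cA (@coord_continuous _ _ _ i j (A y))).
apply/cvgrPdist_lt => e e0; near=> z.
rewrite /Num.Def.normr/= mx_normrE (bigmax_lt _ e0)//= => -[i j] _.
rewrite !mxE /=; move: i j; near: z; apply: filter_forall => i.
apply: filter_forall => j; exact: ((cvgrPdist_lt _ _).1 (cA i j)).
Unshelve. all: by end_near. Qed.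

Lemma continuous_sum (Y : topologicalType) (V : normedModType R) (I : Type) (r : seq I)
    (f : I -> Y -> V) (y : Y) : (forall i, {for y, continuous (f i)}) ->
  {for y, continuous (fun z => \sum_(i <- r) f i z)}.
Proof.
move=> cf; elim: r => [|i r IH].
  rewrite (_ : (fun z => _) = cst 0); first exact: cvg_cst.
  by apply/funext => z; rewrite big_nil.
rewrite (_ : (fun z => _) = fun z => f i z + \sum_(i <- r) f i z).
  by apply: cvgD => //; exact: cf.
by apply/funext => z; rewrite big_cons.
Qed.

Lemma continuous_mulmx (Y : topologicalType) p q r (A : Y -> 'M[R]_(p, q))
    (B : Y -> 'M[R]_(q, r)) (y : Y) :
  {for y, continuous A} -> {for y, continuous B} ->
  {for y, continuous (fun z => A z *m B z)}.
Proof.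
move=> /continuous_mxP cA /continuous_mxP cB; apply/continuous_mxP => i j.
rewrite (_ : (fun z => _) = fun z => \sum_k A z i k * B z k j); last first.
  by apply/funext => z; rewrite mxE.
by apply: continuous_sum => k; apply: cvgM; [exact: cA|exact: cB].
Qed.

Lemma continuous_trmx (Y : topologicalType) p q (A : Y -> 'M[R]_(p, q)) (y : Y) :
  {for y, continuous A} -> {for y, continuous (fun z => (A z)^T)}.
Proof.
move=> /continuous_mxP cA; apply/continuous_mxP => i j.
rewrite (_ : (fun z => _) = fun z => A z j i); first exact: cA.
by apply/funext => z; rewrite mxE.
Qed.

Lemma continuous_cst (Y Z : topologicalType) (a : Z) (y : Y) :
  {for y, continuous (fun _ : Y => a)}.
Proof. exact: cvg_cst. Qed.

End MatrixContinuity.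

Section MatrixExponential.
Context {R : realType} {m : nat}.
Implicit Types (M : 'M[R]_m) (s t : R).

Lemma ler_eq (x y : R) : x = y -> x <= y.
Proof. by move=> ->. Qed.

Lemma entry_le_norm p q (A : 'M[R]_(p, q)) i j : `|A i j| <= `|A|.
Proof.
rewrite [leRHS]/Num.Def.normr/= mx_normrE.
exact: (le_bigmax _ (fun i0 => `|A i0.1 i0.2|) (i, j)).
Qed.

Lemma norm_le_entry p q (A : 'M[R]_(p, q)) c :
  0 <= c -> (forall i j, `|A i j| <= c) -> `|A| <= c.
Proof.
move=> c0 Ac; rewrite [leLHS]/Num.Def.normr/= mx_normrE.
by apply: bigmax_le => // -[i j] _; exact: Ac.
Qed.

(** The norm is the largest absolute value of an entry, submultiplicative only up to the inner
    dimension; hence the factor m attached to norms below. *)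
Lemma mulmx_norm p q r (A : 'M[R]_(p, q)) (B : 'M[R]_(q, r)) :
  `|A *m B| <= q%:R * (`|A| * `|B|).
Proof.
apply: norm_le_entry => [|i j]; first by rewrite !mulr_ge0.
rewrite mxE; apply: le_trans (ler_norm_sum _ _ _) _ => /=.
apply: (@le_trans _ _ (\sum_(k < q) `|A| * `|B|)).
  by apply: ler_sum => k _; rewrite normrM; apply: ler_pM => //; exact: entry_le_norm.
by rewrite sumr_const card_ord mulr_natl.
Qed.

Lemma norm1_le1 : `|1%:M : 'M[R]_m| <= 1.
Proof.
apply: norm_le_entry => // i j.
by rewrite mxE; case: (_ == _); rewrite ?normr1 ?normr0.
Qed.

Lemma norm_expmx M k : `|M ^+ k| <= (m%:R * `|M|) ^+ k.
Proof.
elim: k => [|k IH]; first by rewrite !expr0; exact: norm1_le1.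
rewrite !exprS; apply: le_trans (mulmx_norm _ _) _.
by rewrite mulrA ler_pM // mulr_ge0.
Qed.

Definition exp_term M k := (k`!%:R)^-1 *: M ^+ k.

Lemma norm_exp_term M k : `|exp_term M k| <= exp_coeff (m%:R * `|M|) k.
Proof.
rewrite /exp_term /exp_coeff /= normrZ ger0_norm ?invr_ge0 // mulrC.
by rewrite ler_wpM2r ?invr_ge0 // norm_expmx.
Qed.

Lemma cvg_exp_term M : cvgn (series (exp_term M)).
Proof.
have : cvgn [normed series (exp_term M)].
  apply: (series_le_cvg _ _ (norm_exp_term M)).
  - by move=> k; exact: normr_ge0.
  - by move=> k; apply: exp_coeff_ge0; rewrite mulr_ge0.
  - exact: is_cvg_series_exp_coeff.
move=> /cauchy_cvgP/cauchy_seriesP normed.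
apply/cauchy_cvgP/cauchy_seriesP => e /normed.
apply: filterS => k /=; rewrite ger0_norm ?sumr_ge0//.
by apply: le_lt_trans; apply: ler_norm_sum.
Qed.

Definition expmx M : 'M[R]_m := limn (series (exp_term M)).

(** P and Q may be rectangular, so that conjugation, one-sided products and the action on a row
    vector are all instances. *)
Lemma expmx_lim p q (P : 'M[R]_(p, m)) (Q : 'M[R]_(m, q)) M :
  series (fun k => P *m exp_term M k *m Q) @ \oo --> P *m expmx M *m Q.
Proof.
rewrite (_ : series _ = fun N => P *m series (exp_term M) N *m Q); last first.
  by apply/funext => N; rewrite /series /= mulmx_sumr mulmx_suml.
have c : {for expmx M, continuous (fun A => P *m A *m Q)}.
  apply: continuous_mulmx; last exact: continuous_cst.
  by apply: continuous_mulmx; [exact: continuous_cst|exact: cvg_id].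
exact: (cvg_comp _ _ (@cvg_exp_term M) c).
Qed.

(* In the product of two partial sums, the terms with i + j < N are those of the
   Cauchy product. *)
Lemma sum_square_triangle (V : zmodType) (F : nat -> nat -> V) N :
  \sum_(0 <= i < N) \sum_(0 <= j < N) F i j =
  \sum_(0 <= k < N) \sum_(0 <= i < k.+1) F i (k - i)%N +
  \sum_(0 <= i < N) \sum_(N - i <= j < N) F i j.
Proof.
have tri : \sum_(0 <= k < N) \sum_(0 <= i < k.+1) F i (k - i)%N =
    \sum_(0 <= i < N) \sum_(0 <= j < N - i) F i j.
  elim: N => [|N IH]; first by rewrite !big_nil.
  rewrite big_nat_recr //= IH; apply/esym.
  transitivity (\sum_(0 <= i < N.+1) (\sum_(0 <= j < N - i) F i j + F i (N - i)%N)).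
    apply: eq_big_nat => i /andP[_ iN]; rewrite subSn // big_nat_recr //=.
  by rewrite big_split /= big_nat_recr //= subnn big_nil addr0.
rewrite tri -big_split /=; apply: eq_big_nat => i /andP[_ iN].
by rewrite -big_cat_nat //= leq_subr.
Qed.

Lemma exp_coeffD s t k :
  \sum_(0 <= i < k.+1) exp_coeff s i * exp_coeff t (k - i)%N = exp_coeff (s + t) k.
Proof.
rewrite /exp_coeff /= addrC exprDn mulr_suml big_mkord; apply: eq_bigr => i _.
have ik : (i <= k)%N by rewrite -ltnS.
have fn0 (j : nat) : j`!%:R != 0 :> R by rewrite pnatr_eq0 -lt0n fact_gt0.
have : (k`!%:R : R) = 'C(k, i)%:R * (i`!%:R * (k - i)`!%:R).
  by rewrite -!natrM bin_fact.
move=> E; apply: (mulIf (fn0 k)); rewrite divfK // {1}E -mulr_natl.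
by field; rewrite !fn0.
Qed.

Lemma exp_termZ s M k : exp_term (s *: M) k = exp_coeff s k *: M ^+ k.
Proof.
rewrite /exp_term (_ : (s *: M) ^+ k = s ^+ k *: M ^+ k).
  by rewrite scalerA mulrC.
elim: k => [|k IH]; first by rewrite !expr0 scale1r.
rewrite !exprS IH -[LHS]/(s *: M *m (s ^+ k *: M ^+ k)) -scalemxAl -scalemxAr.
by rewrite scalerA.
Qed.

Lemma series_mulmx (a b : nat -> 'M[R]_m) N :
  series a N *m series b N = \sum_(0 <= i < N) \sum_(0 <= j < N) a i *m b j.
Proof. by rewrite /series /= mulmx_suml; apply: eq_bigr => i _; rewrite mulmx_sumr. Qed.

Lemma series_mulr (a b : nat -> R) N :
  series a N * series b N = \sum_(0 <= i < N) \sum_(0 <= j < N) a i * b j.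
Proof. by rewrite /series /= mulr_suml; apply: eq_bigr => i _; rewrite mulr_sumr. Qed.

(** The product of the partial sums differs from the partial sum at s + t by the terms with i + j >=
    N. They are dominated by the corresponding terms of the real series at |s| c and |t| c, whose
    sum tends to 0 because [expR] is multiplicative. *)
Lemma expmxD s t M : expmx (s *: M) *m expmx (t *: M) = expmx ((s + t) *: M).
Proof.
pose S u := series (exp_term (u *: M)); pose c := m%:R * `|M|.
have c0 : 0 <= c by rewrite mulr_ge0.
have Sl u : S u @ \oo --> expmx (u *: M) by exact: cvg_exp_term.
apply/eqP; rewrite -subr_eq0; apply/eqP.
pose D N := S s N *m S t N - S (s + t) N.
have D1 : D @ \oo --> expmx (s *: M) *m expmx (t *: M) - expmx ((s + t) *: M).
  apply: cvgB; last exact: Sl.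
  have cm : {for (expmx (s *: M), expmx (t *: M)),
      continuous (fun AB : 'M[R]_m * 'M[R]_m => AB.1 *m AB.2)}.
    by apply: continuous_mulmx; [exact: cvg_fst|exact: cvg_snd].
  exact: (cvg_comp _ _ (cvg_pair (Sl s) (Sl t)) cm).
pose r (N : nat) : R := series (exp_coeff (`|s| * c)) N * series (exp_coeff (`|t| * c)) N
   - series (exp_coeff (`|s| * c + `|t| * c)) N.
have r0 : r @ \oo --> (0 : R).
  rewrite -(subrr (expR (`|s| * c + `|t| * c))) {1}expRD.
  by apply: cvgB; [apply: cvgM|]; exact: is_cvg_series_exp_coeff.
have Dr N : `|D N| <= r N.
  have -> : D N = \sum_(0 <= i < N) \sum_(N - i <= j < N)
      exp_term (s *: M) i *m exp_term (t *: M) j.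
    rewrite /D /S series_mulmx sum_square_triangle addrAC -[RHS]add0r; congr (_ + _).
    apply/eqP; rewrite subr_eq0; apply/eqP; apply: eq_bigr => k _.
    rewrite exp_termZ -exp_coeffD scaler_suml; apply: eq_big_nat => i /andP[_ ik].
    rewrite !exp_termZ -scalemxAl -scalemxAr scalerA; congr (_ *: _).
    by rewrite -[LHS]/(M ^+ i * M ^+ (k - i)%N) -exprD subnKC.
  have -> : r N = \sum_(0 <= i < N) \sum_(N - i <= j < N)
      exp_coeff (`|s| * c) i * exp_coeff (`|t| * c) j.
    rewrite /r series_mulr sum_square_triangle addrAC -[RHS]add0r; congr (_ + _).
    apply/eqP; rewrite subr_eq0; apply/eqP; apply: eq_bigr => k _.
    exact: exp_coeffD.
  apply: le_trans (ler_norm_sum _ _ _) _; apply: ler_sum => i _.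
  apply: le_trans (ler_norm_sum _ _ _) _; apply: ler_sum => j _.
  rewrite !exp_termZ -scalemxAl -scalemxAr scalerA normrZ.
  have -> : exp_coeff (`|s| * c) i * exp_coeff (`|t| * c) j =
      `|exp_coeff s i * exp_coeff t j| * c ^+ (i + j).
    rewrite /exp_coeff /= !normrM !normfV !normrX !normr_nat !exprMn !exprD.
    by ring.
  rewrite ler_wpM2l // -[X in `|X|]/(M ^+ i * M ^+ j) -exprD; exact: norm_expmx.
have D2 : D @ \oo --> (0 : 'M[R]_m).
  apply/norm_cvg0P; apply: (@squeeze_cvgr _ _ _ _ (fun=> 0) r).
  - by near=> N; rewrite normr_ge0 Dr.
  - exact: cvg_cst.
  - exact: r0.
exact: (cvg_unique (@norm_hausdorff _ _) D1 D2).
Unshelve. all: by end_near. Qed.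

Lemma exp_coeff0S (k : nat) : exp_coeff (0 : R) k.+1 = 0.
Proof. by rewrite /exp_coeff /= expr0n mul0r. Qed.

Lemma expmx0 : expmx (0 : 'M[R]_m) = 1%:M.
Proof.
apply: cvg_lim => //; apply/cvgrPdist_lt => e e0; near=> N.
have -> : series (exp_term (0 : 'M[R]_m)) N = 1%:M.
  (* The empty partial sum is 0, not 1. *)
  have [k ->] : exists k, N = k.+1.
    by exists N.-1; rewrite prednK //; near: N; exists 1%N.
  rewrite /series /= big_nat_recl // big1 => [|i _].
    by rewrite addr0 /exp_term expr0 fact0 invr1 scale1r.
  by have := exp_termZ 0 (0 : 'M[R]_m) i.+1; rewrite scale0r exp_coeff0S scale0r.
by rewrite subrr normr0.
Unshelve. all: by end_near. Qed.

Lemma expmx_unit M : expmx M *m expmx (- M) = 1%:M.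
Proof.
by rewrite -{1}(scale1r M) -scaleN1r expmxD subrr scale0r expmx0.
Qed.

(** Differences of powers telescope, with bound (k + 1) c^k d; division by (k + 1)! turns this into
    the exponential series of c times d. *)
Lemma expmx_lipschitz (c : R) (M M' : 'M[R]_m) : m%:R * `|M| <= c -> m%:R * `|M'| <= c ->
  `|expmx M - expmx M'| <= expR c * (m%:R * `|M - M'|).
Proof.
move=> Mc M'c; have c0 : 0 <= c by apply: le_trans Mc; rewrite mulr_ge0.
(* The estimate of the first power needs |M - M'| <= m |M - M'|, that is m >= 1 unless M = M'. *)
have [m0|m0] := eqVneq m 0%N.
  have -> : M = M' by apply/matrixP => i; have := ltn_ord i; rewrite {2}m0.
  by rewrite !subrr normr0 !mulr0.
set d := m%:R * `|M - M'|; have d0 : 0 <= d by rewrite mulr_ge0.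
have pw (A : 'M[R]_m) k : m%:R * `|A| <= c -> `|A ^+ k| <= c ^+ k.
  by move=> Ac; apply: le_trans (norm_expmx A k) _; rewrite lerXn2r // nnegrE mulr_ge0.
have dpow k : `|M ^+ k.+1 - M' ^+ k.+1| <= k.+1%:R * c ^+ k * d.
  elim: k => [|k IH].
    by rewrite !expr1 expr0 mulr1 mul1r /d ler_peMl // ler1n lt0n.
  have -> : M ^+ k.+2 - M' ^+ k.+2 = M ^+ k.+1 *m (M - M') + (M ^+ k.+1 - M' ^+ k.+1) *m M'.
    rewrite mulmxBr mulmxBl subrKA ![_ ^+ k.+2]exprSr.
    by congr (_ - _).
  apply: le_trans (ler_normD _ _) _.
  apply: (@le_trans _ _ (c ^+ k.+1 * d + k.+1%:R * c ^+ k * d * c)).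
    apply: lerD; apply: le_trans (mulmx_norm _ _) _.
      by rewrite mulrCA ler_wpM2r // pw.
    by rewrite mulrCA ler_pM // mulr_ge0.
  by rewrite -[k.+2]addn1 natrD exprS; apply: ler_eq; ring.
have partial N : `|series (exp_term M) N - series (exp_term M') N| <= expR c * d.
  case: N => [|N].
    by rewrite /series /= !big_nil subrr normr0 mulr_ge0 // expR_ge0.
  rewrite /series /= -sumrB big_nat_recl //= /exp_term !expr0 subrr add0r.
  apply: le_trans (ler_norm_sum _ _ _) _.
  apply: (@le_trans _ _ (series (exp_coeff c) N * d)).
    rewrite /series /= mulr_suml; apply: ler_sum => k _.
    rewrite -scalerBr normrZ ger0_norm ?invr_ge0 //.
    apply: le_trans (ler_wpM2l _ (dpow k)) _; first by rewrite invr_ge0.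
    rewrite factS natrM /exp_coeff /=; apply: ler_eq.
    have k0 : k`!%:R != 0 :> R by rewrite pnatr_eq0 -lt0n fact_gt0.
    by field; rewrite k0 /= addrC natr1 pnatr_eq0.
  rewrite ler_wpM2r //; apply: nondecreasing_cvgn_le; last exact: is_cvg_series_exp_coeff.
  by apply: nondecreasing_series => k _ _; apply: exp_coeff_ge0.
have cD : series (exp_term M) N - series (exp_term M') N @[N --> \oo] -->
    expmx M - expmx M' by apply: cvgB; exact: cvg_exp_term.
rewrite -(cvg_lim _ (cvg_norm cD)) //; apply: limr_le; first by apply/cvg_ex; eexists; exact: cvg_norm cD.
by near=> N; exact: partial.
Unshelve. all: by end_near. Qed.

Lemma continuous_expmx (Y : topologicalType) (A : Y -> 'M[R]_m) (y : Y) :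
  {for y, continuous A} -> {for y, continuous (fun z => expmx (A z))}.
Proof.
move=> cA; apply/cvgrPdist_lt => e e0; pose c := m%:R * (`|A y| + 1).
have K0 : 0 < expR c * m%:R + 1 by rewrite ltr_wpDl // mulr_ge0 // expR_ge0.
near=> z.
(* The bound 1 makes c valid for both matrices; the other bound offsets the Lipschitz constant,
   increased by 1 to be positive. *)
have : `|A y - A z| < Num.min 1 (e / (expR c * m%:R + 1)).
  near: z; move/cvgrPdist_lt: cA; apply.
  by rewrite lt_min ltr01 divr_gt0.
rewrite lt_min => /andP[M1 Me].
apply: le_lt_trans (@expmx_lipschitz c (A y) (A z) _ _) _.
- by rewrite ler_wpM2l // lerDl.
- rewrite ler_wpM2l // -[leLHS](_ : `|A y - (A y - A z)| = _); last by rewrite subKr.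
  by apply: le_trans (ler_normB _ _) _; rewrite lerD2l ltW.
- rewrite mulrA; apply: (@le_lt_trans _ _ ((expR c * m%:R + 1) * `|A y - A z|)).
    by rewrite ler_wpM2r // lerDl.
  by rewrite mulrC -ltr_pdivlMr.
Unshelve. all: by end_near. Qed.

(** The hypothesis moves powers of M across Om, turning them into powers of -M^T. So exp M Om = Om
    exp (-M^T), and exp (-M^T) is inverse to the transpose of exp M. *)
Lemma expmx_isometry (Om M : 'M[R]_m) : M *m Om = - (Om *m M^T) ->
  expmx M *m Om *m (expmx M)^T = Om.
Proof.
move=> MO.
have E1 : expmx M *m Om = Om *m expmx (- M^T).
  have l1 := @expmx_lim _ _ 1%:M Om M; have l2 := @expmx_lim _ _ Om 1%:M (- M^T).
  have termE : (fun k => 1%:M *m exp_term M k *m Om) =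
      (fun k => Om *m exp_term (- M^T) k *m 1%:M).
    apply/funext => k; rewrite mul1mx mulmx1 /exp_term -scalemxAl -scalemxAr.
    congr (_ *: _); elim: k => [|k IH]; first by rewrite !expr0 mul1mx mulmx1.
    rewrite !exprSr -[M ^+ k * M]/(M ^+ k *m M) -mulmxA MO mulmxN mulmxA IH.
    by rewrite -[_ ^+ k * _]/((- M^T) ^+ k *m (- M^T)) !mulmxN mulmxA.
  move: l1; rewrite termE => l1.
  by have := cvg_unique (@norm_hausdorff _ _) l1 l2; rewrite mul1mx mulmx1; apply.
have E2 : (expmx M)^T = expmx M^T.
  have ct : {for expmx M, continuous (fun A : 'M[R]_m => A^T)}.
    by apply: continuous_trmx; exact: cvg_id.
  apply/esym/cvg_lim => //; have := cvg_comp _ _ (@cvg_exp_term M) ct.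
  apply: cvg_trans; apply: near_eq_cvg; near=> N => /=.
  rewrite /series /= raddf_sum; apply: eq_bigr => k _.
  rewrite /exp_term; have <- : (M ^+ k)^T = M^T ^+ k.
    elim: k => [|k IH]; first by rewrite !expr0 trmx1.
    by rewrite exprS exprSr -[LHS]/((M *m M ^+ k)^T) trmx_mul IH.
  by apply/matrixP => i j; rewrite !mxE.
by rewrite E1 E2 -mulmxA -{2}(opprK M^T) expmx_unit mulmx1.
Unshelve. all: by end_near. Qed.

End MatrixExponential.

Section ExponentialEndomorphism.
Context {R : realType} {n : nat}.

Lemma exp_endo_mx (A : 'rV[R]_(n + n) -> 'rV[R]_(n + n)) (P M : 'M[R]_(n + n)) :
  (forall v, A (v *m P) = v *m M *m P) ->
  forall v, exp_endo A (v *m P) = v *m expmx M *m P.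
Proof.
move=> AP v; apply: cvg_lim => //.
rewrite (_ : (fun k => _) = (fun k => v *m exp_term M k *m P)); first exact: expmx_lim.
apply/funext => k; rewrite /exp_term -scalemxAr -scalemxAl; congr (_ *: _).
elim: k => [|k IH]; first by rewrite expr0 mulmx1.
by rewrite iterS IH AP exprSr -[M ^+ k * M]/(M ^+ k *m M) mulmxA.
Qed.

End ExponentialEndomorphism.

(** * Symplectic elimination *)

Section SymplecticShears.
Context {R : realType} {m : nat}.
Implicit Types (Om S N : 'M[R]_m) (v w a b e f z : 'rV[R]_m) (c : R).

Definition om Om v w : R := (v *m Om *m w^T) 0 0.

Lemma omDl Om u v w : om Om (u + v) w = om Om u w + om Om v w.
Proof. by rewrite /om !mulmxDl mxE. Qed.

Lemma omDr Om u v w : om Om u (v + w) = om Om u v + om Om u w.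
Proof. by rewrite /om raddfD /= mulmxDr mxE. Qed.

Lemma omZl Om c v w : om Om (c *: v) w = c * om Om v w.
Proof. by rewrite /om -!scalemxAl mxE. Qed.

Lemma omZr Om c v w : om Om v (c *: w) = c * om Om v w.
Proof.
rewrite /om (_ : (c *: w)^T = c *: w^T); last by apply/matrixP => i j; rewrite !mxE.
by rewrite -scalemxAr mxE.
Qed.

Lemma omNl Om v w : om Om (- v) w = - om Om v w.
Proof. by rewrite -scaleN1r omZl mulN1r. Qed.

Lemma omNr Om v w : om Om v (- w) = - om Om v w.
Proof. by rewrite -scaleN1r omZr mulN1r. Qed.

Lemma om_mul Om S v w : S *m Om *m S^T = Om -> om Om (v *m S) (w *m S) = om Om v w.
Proof. by move=> SO; rewrite /om trmx_mul !mulmxA -(mulmxA v) -(mulmxA v) SO. Qed.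

Lemma om_mx Om v w : (v *m Om *m w^T) = (om Om v w)%:M.
Proof. by rewrite [LHS]mx11_scalar. Qed.

(* The endomorphism v |-> om v a b + om v b a, of square zero when om a b = 0;
   matrices act on row vectors from the right. *)
Definition nilp Om a b : 'M[R]_m := Om *m (a^T *m b + b^T *m a).

Lemma nilpE Om a b v : v *m nilp Om a b = om Om v a *: b + om Om v b *: a.
Proof.
by rewrite /nilp !mulmxDr !mulmxA !om_mx !mul_scalar_mx.
Qed.

Lemma nilp0 Om a : nilp Om a 0 = 0.
Proof. by rewrite /nilp mulmx0 trmx0 mul0mx addr0 mulmx0. Qed.

Section Skew.
Variable Om : 'M[R]_m.
Hypothesis skew : Om^T = - Om.

Lemma omC v w : om Om v w = - om Om w v.
Proof.
rewrite /om -[LHS](_ : (v *m Om *m w^T)^T 0 0 = _); last by rewrite mxE.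
by rewrite !trmx_mul trmxK skew mulNmx mulmxN mulmxA mxE.
Qed.

Lemma om_self v : om Om v v = 0.
Proof. by have := omC v v; lra. Qed.

(** The image lies in the span of a and b, which is isotropic and hence killed. *)
Lemma nilp_square a b : om Om a b = 0 -> nilp Om a b *m nilp Om a b = 0.
Proof.
move=> ab; have ba : om Om b a = 0 by rewrite omC ab oppr0.
apply/row_matrixP => i; rewrite !rowE mulmxA mulmx0 [_ *m nilp _ _ _]nilpE.
by rewrite nilpE !(omDl, omZl) !om_self ab ba !mulr0 !addr0 !scale0r addr0.
Qed.

Lemma nilp_skew a b : nilp Om a b *m Om = - (Om *m (nilp Om a b)^T).
Proof.
rewrite /nilp; set T := _ + _; have TT : T^T = T.
  by rewrite /T raddfD /= !trmx_mul !trmxK addrC.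
by rewrite trmx_mul TT skew !mulmxN opprK mulmxA.
Qed.

(** The first-order terms cancel by skewness, and N Om N^T = - N N Om = 0. *)
Lemma isometry_add_nilpotent N : N *m N = 0 -> N *m Om = - (Om *m N^T) ->
  (1%:M + N) *m Om *m (1%:M + N)^T = Om.
Proof.
move=> NN NO; have ON : Om *m N^T = - (N *m Om) by rewrite NO opprK.
rewrite raddfD /= trmx1 mulmxDr mulmx1 mulmxDl mul1mx mulmxDl -(mulmxA N) ON.
by rewrite mulmxN mulmxA NN mul0mx oppr0 addr0 addrK.
Qed.

Variables (e f : 'rV[R]_m).
Hypothesis ef : om Om e f = 1.
Let fe : om Om f e = -1. Proof. by rewrite omC ef. Qed.

(* For an isometry S, [shear1] makes the e-component of the image of e equal
   to 1, [shear2] then brings that image back to e, and [shear3] brings the image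
   of f back to f without moving e.  All three vanish at S = 1. *)
Definition shear1 S := nilp Om (e + f)
  (((1 - om Om (e *m S) f) / (om Om (e *m S) f - om Om e (e *m S)) / 2) *: (e + f)).

Definition shear2 S := let d := e *m S - e in
  nilp Om f (- (d - (om Om e d / 2) *: f)).

Definition shear3 S := let d := f *m S - f in nilp Om e (d + (om Om f d / 2) *: e).

Section Isometry.
Variable S : 'M[R]_m.
Hypothesis iso : S *m Om *m S^T = Om.

(** Put al = om (eS) f and be = om e (eS). The transvection along e + f with coefficient c adds 2 c
    (al - be) to al, which determines c. Along e alone the divisor would be -be, which is 0 at S =
    1; along e + f it is 1 there. *)
Lemma shear1P : om Om (e *m S) f - om Om e (e *m S) != 0 ->
  om Om (e *m (S *m (1%:M + shear1 S))) f = 1.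
Proof.
rewrite mulmxA mulmxDr mulmx1 /shear1 nilpE !omZr !omDr.
set w := e *m S => wd; have we : om Om w e = - om Om e w := omC _ _.
rewrite !omDl !omZl !omDl om_self ef we.
move: (om Om w f) (om Om e w) wd => al be wd; field.
by rewrite wd.
Qed.

Lemma shear1_square : shear1 S *m shear1 S = 0.
Proof. by apply: nilp_square; rewrite omZr om_self mulr0. Qed.

Lemma shear1_fix z : z *m S = z -> om Om z e = 0 -> om Om z f = 0 ->
  z *m (S *m (1%:M + shear1 S)) = z.
Proof.
move=> zS ze zf; rewrite mulmxA zS mulmxDr mulmx1 nilpE omZr !omDr ze zf !addr0.
by apply/rowP => j; rewrite !mxE; ring.
Qed.

Lemma shear1_id : S = 1%:M -> shear1 S = 0.
Proof. by move=> ->; rewrite /shear1 mulmx1 ef subrr !mul0r scale0r nilp0. Qed.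

Section Shear2.
Hypothesis eSf : om Om (e *m S) f = 1.

(** Since om (eS) f = 1, the shear moves eS by -d and by two multiples of f, with coefficients half
    of om e d and of opposite signs; these cancel. *)
Lemma shear2P : e *m (S *m (1%:M + shear2 S)) = e.
Proof.
rewrite mulmxA mulmxDr mulmx1 /shear2 nilpE; have h := eSf; set w := e *m S in h *.
rewrite !(omNr, omDr, omZr) h (omC w e) om_self om_self.
by apply/rowP => j; rewrite !mxE; field.
Qed.

Lemma shear2_square : shear2 S *m shear2 S = 0.
Proof.
apply: nilp_square; rewrite !(omNr, omDr, omZr) !om_self (omC f (e *m S)) eSf (omC f e) ef.
by ring.
Qed.

(** A vector fixed by the isometry S and orthogonal to e is orthogonal to eS too. This keeps the
    pairs already restored in place. *)
Lemma shear2_fix z : z *m S = z -> om Om z e = 0 -> om Om z f = 0 ->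
  z *m (S *m (1%:M + shear2 S)) = z.
Proof.
move=> zS ze zf; rewrite mulmxA zS mulmxDr mulmx1 nilpE !(omNr, omDr, omZr) ze zf.
have -> : om Om z (e *m S) = 0 by rewrite -{1}zS om_mul.
by apply/rowP => j; rewrite !mxE; ring.
Qed.
End Shear2.

Lemma shear2_id : S = 1%:M -> shear2 S = 0.
Proof.
move=> ->; rewrite /shear2 mulmx1 subrr (_ : om Om e 0 = 0).
  by rewrite mul0r scale0r subr0 oppr0 nilp0.
by rewrite /om trmx0 mulmx0 mxE.
Qed.

Section Shear3.
Hypothesis eS : e *m S = e.
Let fSe : om Om (f *m S) e = -1. Proof. by rewrite -[X in om _ _ X]eS om_mul. Qed.

(** As S fixes e, the difference fS - f is orthogonal to e. The cancellation is that of [shear2]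
    with e and f exchanged, and the same orthogonality leaves e fixed. *)
Lemma shear3P : f *m (S *m (1%:M + shear3 S)) = f.
Proof.
rewrite mulmxA mulmxDr mulmx1 /shear3 nilpE; have h := fSe; set w := f *m S in h *.
rewrite !(omNr, omDr, omZr) h (omC w f) om_self om_self.
by apply/rowP => j; rewrite !mxE; field.
Qed.

Lemma shear3_square : shear3 S *m shear3 S = 0.
Proof.
apply: nilp_square; rewrite !(omNr, omDr, omZr) !om_self (omC e (f *m S)) fSe ef.
by ring.
Qed.

Lemma shear3_fix z : z *m S = z -> om Om z e = 0 -> om Om z f = 0 ->
  z *m (S *m (1%:M + shear3 S)) = z.
Proof.
move=> zS ze zf; rewrite mulmxA zS mulmxDr mulmx1 nilpE !(omNr, omDr, omZr) ze zf.
have -> : om Om z (f *m S) = 0 by rewrite -{1}zS om_mul.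
by apply/rowP => j; rewrite !mxE; ring.
Qed.

Lemma shear3_fix_e : e *m (S *m (1%:M + shear3 S)) = e.
Proof.
rewrite mulmxA eS mulmxDr mulmx1 nilpE !(omNr, omDr, omZr) om_self ef.
by rewrite (omC e (f *m S)) fSe; apply/rowP => j; rewrite !mxE; ring.
Qed.
End Shear3.

Lemma shear3_id : S = 1%:M -> shear3 S = 0.
Proof.
move=> ->; rewrite /shear3 mulmx1 subrr (_ : om Om f 0 = 0).
  by rewrite mul0r scale0r addr0 nilp0.
by rewrite /om trmx0 mulmx0 mxE.
Qed.

End Isometry.
End Skew.
End SymplecticShears.

(** * Elimination in continuous families *)

Section SymplecticFamilies.
Context {R : realType} {m : nat} {Y : topologicalType}.
Implicit Types (Om S N : Y -> 'M[R]_m) (e f v w : Y -> 'rV[R]_m) (y : Y).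

Lemma continuous_add p q (A B : Y -> 'M[R]_(p, q)) y : {for y, continuous A} ->
  {for y, continuous B} -> {for y, continuous (fun z => A z + B z)}.
Proof. by move=> cA cB; apply: cvgD. Qed.

Lemma continuous_opp p q (A : Y -> 'M[R]_(p, q)) y : {for y, continuous A} ->
  {for y, continuous (fun z => - A z)}.
Proof. by move=> cA; apply: cvgN. Qed.

Lemma continuous_scale p q (c : Y -> R) (A : Y -> 'M[R]_(p, q)) y :
  {for y, continuous c} -> {for y, continuous A} ->
  {for y, continuous (fun z => c z *: A z)}.
Proof. by move=> cc cA; apply: cvgZ. Qed.

Lemma continuous_mulr (c d : Y -> R) y : {for y, continuous c} ->
  {for y, continuous d} -> {for y, continuous (fun z => c z * d z)}.
Proof. by move=> cc cd; apply: cvgM. Qed.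

Lemma continuous_subr (c d : Y -> R) y : {for y, continuous c} ->
  {for y, continuous d} -> {for y, continuous (fun z => c z - d z)}.
Proof. by move=> cc cd; apply: cvgB. Qed.

Lemma continuous_invr (c : Y -> R) y : c y != 0 -> {for y, continuous c} ->
  {for y, continuous (fun z => (c z)^-1)}.
Proof. by move=> c0 cc; apply: cvgV. Qed.

Lemma continuous_om Om v w y : {for y, continuous Om} -> {for y, continuous v} ->
  {for y, continuous w} -> {for y, continuous (fun z => om (Om z) (v z) (w z))}.
Proof.
move=> cO cv cw.
exact: (continuous_mxP _ _).1 (continuous_mulmx (continuous_mulmx cv cO) (continuous_trmx cw)) 0 0.
Qed.

Lemma continuous_nilp Om v w y : {for y, continuous Om} -> {for y, continuous v} ->
  {for y, continuous w} -> {for y, continuous (fun z => nilp (Om z) (v z) (w z))}.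
Proof.
move=> cO cv cw; exact: (continuous_mulmx cO (continuous_add
  (continuous_mulmx (continuous_trmx cv) cw) (continuous_mulmx (continuous_trmx cw) cv))).
Qed.

Lemma continuous_shear1 Om S e f y : {for y, continuous Om} -> {for y, continuous S} ->
  {for y, continuous e} -> {for y, continuous f} ->
  om (Om y) (e y *m S y) (f y) - om (Om y) (e y) (e y *m S y) != 0 ->
  {for y, continuous (fun z => shear1 (Om z) (e z) (f z) (S z))}.
Proof.
move=> cO cS ce cf d0; have cw := continuous_mulmx ce cS.
have cal := continuous_om cO cw cf; have cbe := continuous_om cO ce cw.
have cef := continuous_add ce cf.
have cd := continuous_invr d0 (continuous_subr cal cbe).
have cn := continuous_subr (@continuous_cst Y R 1 y) cal.
have cq := continuous_mulr (continuous_mulr cn cd) (@continuous_cst Y R 2^-1 y).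
exact: (continuous_nilp cO cef (continuous_scale cq cef)).
Qed.

Lemma continuous_shear2 Om S e f y : {for y, continuous Om} -> {for y, continuous S} ->
  {for y, continuous e} -> {for y, continuous f} ->
  {for y, continuous (fun z => shear2 (Om z) (e z) (f z) (S z))}.
Proof.
move=> cO cS ce cf.
have cd := continuous_add (continuous_mulmx ce cS) (continuous_opp ce).
have ch := continuous_mulr (continuous_om cO ce cd) (@continuous_cst Y R 2^-1 y).
exact: (continuous_nilp cO cf (continuous_opp
  (continuous_add cd (continuous_opp (continuous_scale ch cf))))).
Qed.

Lemma continuous_shear3 Om S e f y : {for y, continuous Om} -> {for y, continuous S} ->
  {for y, continuous e} -> {for y, continuous f} ->
  {for y, continuous (fun z => shear3 (Om z) (e z) (f z) (S z))}.
Proof.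
move=> cO cS ce cf.
have cd := continuous_add (continuous_mulmx cf cS) (continuous_opp cf).
have ch := continuous_mulr (continuous_om cO cf cd) (@continuous_cst Y R 2^-1 y).
exact: (continuous_nilp cO ce (continuous_add cd (continuous_scale ch ce))).
Qed.

Variable y0 : Y.

(** Continuity is required at all points near y0, since the factors are later evaluated along a
    graph away from y0. The last clause makes extension by the identity possible. *)
Definition shear_near Om S N := \forall y \near y0,
  [/\ {for y, continuous N}, N y *m N y = 0, N y *m Om y = - (Om y *m (N y)^T)
    & S y = 1%:M -> N y = 0].

Definition isometry_near Om S := \forall y \near y0,
  [/\ {for y, continuous Om}, (Om y)^T = - Om y, {for y, continuous S}
    & S y *m Om y *m (S y)^T = Om y].

Definition sheared S N y := S y *m (1%:M + N y).

Lemma sheared_isometry Om S N : isometry_near Om S -> shear_near Om S N ->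
  isometry_near Om (sheared S N).
Proof.
move=> iS sN; near=> y.
have [cO sk cS iso] : [/\ {for y, continuous Om}, (Om y)^T = - Om y, {for y, continuous S}
    & S y *m Om y *m (S y)^T = Om y] by near: y.
have [cN NN NO _] : [/\ {for y, continuous N}, N y *m N y = 0,
  N y *m Om y = - (Om y *m (N y)^T) & S y = 1%:M -> N y = 0] by near: y.
split; [exact: cO|exact: sk| |].
  exact: (continuous_mulmx cS (continuous_add (@continuous_cst Y 'M[R]_m 1%:M y) cN)).
rewrite /sheared trmx_mul mulmxA -(mulmxA (S y)) -(mulmxA (S y)).
by rewrite (isometry_add_nilpotent NN NO).
Unshelve. all: by end_near. Qed.

(** [sheared S N] is 1 wherever S is, so every factor of a word can be tested against the initial
    S. *)
Lemma shear_near_sheared Om S N N' : shear_near Om S N ->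
  shear_near Om (sheared S N) N' -> shear_near Om S N'.
Proof.
move=> sN sN'; near=> y.
have [_ _ _ N1] : [/\ {for y, continuous N}, N y *m N y = 0,
  N y *m Om y = - (Om y *m (N y)^T) & S y = 1%:M -> N y = 0] by near: y.
have [? ? ? N1'] : [/\ {for y, continuous N'}, N' y *m N' y = 0,
  N' y *m Om y = - (Om y *m (N' y)^T) & sheared S N y = 1%:M -> N' y = 0] by near: y.
by split => // S1; apply: N1'; rewrite /sheared N1 // S1 addr0 mulmx1.
Unshelve. all: by end_near. Qed.

Lemma sheared_id Om S N : shear_near Om S N -> S y0 = 1%:M -> sheared S N y0 = 1%:M.
Proof.
by move=> /nbhs_singleton[_ _ _ N1] S1; rewrite /sheared N1 // S1 addr0 mulmx1.
Qed.

Lemma eliminate_pair Om S e f : isometry_near Om S -> S y0 = 1%:M ->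
  (\forall y \near y0, [/\ {for y, continuous e}, {for y, continuous f}
    & om (Om y) (e y) (f y) = 1]) ->
  exists N1 N2 N3,
   [/\ shear_near Om S N1, shear_near Om (sheared S N1) N2,
       shear_near Om (sheared (sheared S N1) N2) N3
     & \forall y \near y0, let S' := sheared (sheared (sheared S N1) N2) N3 y in
       [/\ e y *m S' = e y, f y *m S' = f y
         & forall z, z *m S y = z -> om (Om y) z (e y) = 0 -> om (Om y) z (f y) = 0 ->
           z *m S' = z]].
Proof.
move=> iS S0 ef.
pose N1 y := shear1 (Om y) (e y) (f y) (S y).
pose al y := om (Om y) (e y *m S y) (f y) - om (Om y) (e y) (e y *m S y).
(* Closeness to the identity enters here: the divisor of [shear1] is 1 at y0. *)
have al0 : \forall y \near y0, al y != 0.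
  have [cO sk cS _] := nbhs_singleton iS; have [ce cf ef0] := nbhs_singleton ef.
  have cal : {for y0, continuous al}.
    have cw := continuous_mulmx ce cS.
    exact: (continuous_subr (continuous_om cO cw cf) (continuous_om cO ce cw)).
  have a1 : al y0 = 1 by rewrite /al S0 mulmx1 ef0 om_self // subr0.
  have : \forall y \near y0, 0 < al y.
    by apply: (cvgr_gt (al y0) cal); rewrite a1.
  by apply: filterS => y; case: ltgtP.
have s1 : shear_near Om S N1.
  apply: filterS3 al0 iS ef => y a0 [cO sk cS iso] [ce cf ef1]; split.
  - exact: continuous_shear1.
  - exact: shear1_square.
  - exact: nilp_skew.
  - exact: shear1_id.
have iS1 := sheared_isometry iS s1; set S1 := sheared S N1 in iS1 *.
pose N2 y := shear2 (Om y) (e y) (f y) (S1 y).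
have e1 : \forall y \near y0, om (Om y) (e y *m S1 y) (f y) = 1.
  apply: filterS3 al0 iS ef => y a0 [cO sk cS iso] [ce cf ef1].
  exact: shear1P.
have s2 : shear_near Om S1 N2.
  apply: filterS3 e1 iS1 ef => y a0 [cO sk cS iso] [ce cf ef1]; split.
  - exact: continuous_shear2.
  - exact: shear2_square.
  - exact: nilp_skew.
  - exact: shear2_id.
have iS2 := sheared_isometry iS1 s2; set S2 := sheared S1 N2 in iS2 *.
pose N3 y := shear3 (Om y) (e y) (f y) (S2 y).
have e2 : \forall y \near y0, e y *m S2 y = e y.
  apply: filterS3 e1 iS1 ef => y a0 [cO sk cS iso] [ce cf ef1].
  exact: shear2P.
have s3 : shear_near Om S2 N3.
  apply: filterS3 e2 iS2 ef => y a0 [cO sk cS iso] [ce cf ef1]; split.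
  - exact: continuous_shear3.
  - exact: shear3_square.
  - exact: nilp_skew.
  - exact: shear3_id.
exists N1, N2, N3; split => //.
near=> y.
have [cO sk cS iso] : [/\ {for y, continuous Om}, (Om y)^T = - Om y, {for y, continuous S}
    & S y *m Om y *m (S y)^T = Om y] by near: y.
have [_ _ _ iso1] : [/\ {for y, continuous Om}, (Om y)^T = - Om y, {for y, continuous S1}
    & S1 y *m Om y *m (S1 y)^T = Om y] by near: y.
have [_ _ _ iso2] : [/\ {for y, continuous Om}, (Om y)^T = - Om y, {for y, continuous S2}
    & S2 y *m Om y *m (S2 y)^T = Om y] by near: y.
have [ce cf ef1] : [/\ {for y, continuous e}, {for y, continuous f}
    & om (Om y) (e y) (f y) = 1] by near: y.
have eS2 : e y *m S2 y = e y by near: y.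
have eS1 : om (Om y) (e y *m S1 y) (f y) = 1 by near: y.
split.
- exact: shear3_fix_e.
- exact: shear3P.
- move=> z zS ze zf.
  have zS1 : z *m S1 y = z by exact: shear1_fix.
  have zS2 : z *m S2 y = z by exact: shear2_fix.
  exact: shear3_fix.
Unshelve. all: by end_near. Qed.

Definition sheared_seq S (l : seq (Y -> 'M[R]_m)) y := foldl (fun A N => A *m (1%:M + N y)) (S y) l.

Fixpoint shears_near Om S (l : seq (Y -> 'M[R]_m)) : Prop :=
  if l is N :: l' then shear_near Om S N /\ shears_near Om (sheared S N) l' else True.

Definition frame_near Om (k : nat) (e f : nat -> Y -> 'rV[R]_m) := \forall y \near y0,
  (forall j, (j < k)%N -> [/\ {for y, continuous (e j)}, {for y, continuous (f j)}
     & om (Om y) (e j y) (f j y) = 1]) /\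
  (forall i j, (i < j < k)%N -> [/\ om (Om y) (e i y) (e j y) = 0,
     om (Om y) (e i y) (f j y) = 0, om (Om y) (f i y) (e j y) = 0
     & om (Om y) (f i y) (f j y) = 0]).

(** Three shears restore the k-th pair. Earlier pairs are fixed by the current product and
    orthogonal to the k-th, so they stay fixed. *)
Lemma eliminate_frame Om S k (e f : nat -> Y -> 'rV[R]_m) : isometry_near Om S -> S y0 = 1%:M ->
  frame_near Om k e f ->
  exists l : seq (Y -> 'M[R]_m), [/\ shears_near Om S l,
      isometry_near Om (sheared_seq S l), sheared_seq S l y0 = 1%:M
    & \forall y \near y0, forall j, (j < k)%N ->
       e j y *m sheared_seq S l y = e j y /\ f j y *m sheared_seq S l y = f j y].
Proof.
move=> iS S0; elim: k => [|k IH] fr.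
  by exists [::]; split => //; near=> y.
have /IH[l [sl il l0 fl]] : frame_near Om k e f.
  apply: filterS fr => y [h1 h2]; split => [j jk|i j /andP[ij jk]].
    by apply: h1; rewrite ltnW.
  by apply: h2; rewrite ij ltnW.
have ef : \forall y \near y0, [/\ {for y, continuous (e k)}, {for y, continuous (f k)}
    & om (Om y) (e k y) (f k y) = 1].
  by apply: filterS fr => y [h1 _]; exact: h1.
have [N1 [N2 [N3 [s1 s2 s3 fix3]]]] := eliminate_pair il l0 ef.
have E : sheared_seq S (l ++ [:: N1; N2; N3]) =
    sheared (sheared (sheared (sheared_seq S l) N1) N2) N3.
  by apply/funext => y; rewrite /sheared_seq foldl_cat.
have i1 := sheared_isometry il s1; have i2 := sheared_isometry i1 s2.
exists (l ++ [:: N1; N2; N3]); rewrite E; split.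
- have: shears_near Om (sheared_seq S l) [:: N1; N2; N3] by [].
  move: sl; rewrite (_ : sheared_seq S l = fun y => sheared_seq S l y) //.
  elim: l {il l0 fl fix3 E i1 i2 s1 s2 s3} S {iS S0 IH} => [//|N l IHl] S /= [sN sl] s.
  by split => //; exact: IHl.
- exact: (sheared_isometry i2 s3).
- exact: (sheared_id s3 (sheared_id s2 (sheared_id s1 l0))).
- apply: filterS3 fr fl fix3 => y [h1 h2] fly [ek fk fz] j.
  rewrite ltnS leq_eqVlt => /orP[/eqP->//|jk].
  have [ee ef' fe ff] := h2 j k (ltac:(by rewrite jk leqnn)).
  by have [ej fj] := fly j jk; split; apply: fz.
Unshelve. all: by end_near. Qed.

End SymplecticFamilies.

(** * Unitary frames by Gram-Schmidt *)

Section UnitaryFrame.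
Context {R : realType} {n : nat}.
Local Notation m := (n + n)%N.

Lemma mulI_lshift (v : 'rV[R]_m) (i : 'I_n) : mulI v 0 (lshift n i) = - v 0 (rshift n i).
Proof. by rewrite /mulI row_mxEl !mxE. Qed.

Lemma mulI_rshift (v : 'rV[R]_m) (i : 'I_n) : mulI v 0 (rshift n i) = v 0 (lshift n i).
Proof. by rewrite /mulI row_mxEr mxE. Qed.

Definition cbasis (i : 'I_n) : 'rV[R]_m := delta_mx 0 (lshift n i).

Lemma mulI_cbasis i : mulI (cbasis i) = delta_mx 0 (rshift n i).
Proof.
apply/rowP => j; case: (split_ordP j) => k ->.
  by rewrite mulI_lshift !mxE eq_lrshift eq_rlshift oppr0.
by rewrite mulI_rshift !mxE eq_lshift eq_rshift.
Qed.

Variable (Om : 'M[R]_m).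

Definition unitary_form :=
  [/\ Om^T = - Om, forall v, v != 0 -> 0 < om Om v (mulI v)
    & forall v w, om Om (mulI v) (mulI w) = om Om v w].

(** The invariant of Gram-Schmidt over the complex basis. The e j are not normalized; f j is i e j
    divided by om (e j) (i e j), which avoids square roots and explains the scalar in [frame_mulI].
    [frame_triangular] makes the next vector nonzero. [frame_span] says that the pairs span the
    first k complex coordinate lines, in the form in which it is used. *)
Record frame_inv (k : nat) (e f : nat -> 'rV[R]_m) : Prop := FrameInv {
  frame_dual : forall j, (j < k)%N -> om Om (e j) (f j) = 1;
  frame_mulI : forall j, (j < k)%N -> exists2 q, q != 0 & mulI (e j) = q *: f j;
  frame_orth : forall i j, (i < j < k)%N -> [/\ om Om (e i) (e j) = 0,
     om Om (e i) (f j) = 0, om Om (f i) (e j) = 0 & om Om (f i) (f j) = 0];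
  frame_triangular : forall j (i : 'I_n), (j < k <= i)%N ->
     e j 0 (lshift n i) = 0 /\ e j 0 (rshift n i) = 0;
  frame_span : forall S : 'M[R]_m,
     (forall j, (j < k)%N -> e j *m S = e j /\ f j *m S = f j) ->
     forall i : 'I_n, (i < k)%N ->
     cbasis i *m S = cbasis i /\ mulI (cbasis i) *m S = mulI (cbasis i) }.

(* Symplectic projection along the span of the pairs (e j, f j), j < k. *)
Definition gram_schmidt k (e f : nat -> 'rV[R]_m) (v : 'rV[R]_m) :=
  v - \sum_(j < k) (om Om v (f j) *: e j - om Om v (e j) *: f j).

Lemma om_suml (I : Type) (r : seq I) (F : I -> 'rV[R]_m) w :
  om Om (\sum_(i <- r) F i) w = \sum_(i <- r) om Om (F i) w.
Proof.
elim: r => [|i r IH]; first by rewrite !big_nil /om !mul0mx mxE.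
by rewrite !big_cons omDl IH.
Qed.

Hypothesis uOm : unitary_form.

Lemma gram_schmidt_orth k e f v i : frame_inv k e f -> (i < k)%N ->
  om Om (gram_schmidt k e f v) (e i) = 0 /\ om Om (gram_schmidt k e f v) (f i) = 0.
Proof.
move=> fr ik; have [sk _ _] := uOm.
have orth j : (j < k)%N -> j != i -> [/\ om Om (e j) (e i) = 0,
     om Om (e j) (f i) = 0, om Om (f j) (e i) = 0 & om Om (f j) (f i) = 0].
  move=> jk; rewrite neq_ltn => /orP[ji|ij].
    by have := @frame_orth _ _ _ fr j i; rewrite ji ik; exact.
  have [h1 h2 h3 h4] : [/\ om Om (e i) (e j) = 0, om Om (e i) (f j) = 0,
     om Om (f i) (e j) = 0 & om Om (f i) (f j) = 0].
    by have := @frame_orth _ _ _ fr i j; rewrite ij jk; exact.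
  by split; rewrite (omC sk) ?h1 ?h2 ?h3 ?h4 oppr0.
have ei := frame_dual fr ik; have fi : om Om (f i) (e i) = -1 by rewrite (omC sk) ei.
by rewrite /gram_schmidt; split; rewrite omDl omNl om_suml (bigD1 (Ordinal ik)) //= big1
   ?addr0 ?omDl ?omNl ?omZl ?(om_self sk) ?ei ?fi; first [ring |
   move=> j; rewrite -val_eqE /= => /(orth j (ltn_ord j))[h1 h2 h3 h4];
   rewrite omDl omNl !omZl ?h1 ?h2 ?h3 ?h4; ring].
Qed.

Lemma gram_schmidt_triangular k e f v : frame_inv k e f -> forall i : 'I_n, (k <= i)%N ->
  gram_schmidt k e f v 0 (lshift n i) = v 0 (lshift n i) /\
  gram_schmidt k e f v 0 (rshift n i) = v 0 (rshift n i).
Proof.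
move=> fr i ki.
have tri (j : 'I_k) : [/\ e j 0 (lshift n i) = 0, e j 0 (rshift n i) = 0,
    f j 0 (lshift n i) = 0 & f j 0 (rshift n i) = 0].
  have [h1 h2] : e j 0 (lshift n i) = 0 /\ e j 0 (rshift n i) = 0.
    by apply: (@frame_triangular _ _ _ fr); rewrite ltn_ord.
  have [q q0 Je] := frame_mulI fr (ltn_ord j).
  split => //; apply: (mulfI q0); rewrite mulr0.
    by have := congr1 (fun w : 'rV_m => w 0 (lshift n i)) Je; rewrite mulI_lshift h2 oppr0 mxE.
  by have := congr1 (fun w : 'rV_m => w 0 (rshift n i)) Je; rewrite mulI_rshift h1 mxE.
rewrite /gram_schmidt !mxE !summxE !big1 ?subr0 // => j _; have [h1 h2 h3 h4] := tri j.
  by rewrite !mxE h2 h4 !mulr0 subrr.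
by rewrite !mxE h1 h3 !mulr0 subrr.
Qed.

Definition next_e k e f (kn : (k < n)%N) := gram_schmidt k e f (cbasis (Ordinal kn)).
Definition next_f k e f (kn : (k < n)%N) := let e' := next_e e f kn in
  (om Om e' (mulI e'))^-1 *: mulI e'.
Definition extend (k : nat) (e : nat -> 'rV[R]_m) v j := if j == k then v else e j.

(** The vectors subtracted have no component along the k-th complex coordinate, so that [next_e]
    keeps its coefficient 1 there and positivity applies. *)
Lemma next_e_neq0 k e f (kn : (k < n)%N) : frame_inv k e f ->
  om Om (next_e e f kn) (mulI (next_e e f kn)) != 0.
Proof.
move=> fr; have [_ pos _] := uOm; rewrite gt_eqF // pos //; apply/eqP => e0.
have [] := gram_schmidt_triangular (cbasis (Ordinal kn)) fr (i := Ordinal kn) (leqnn k).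
rewrite -/(next_e e f kn) e0 !mxE !eqxx => /eqP.
by rewrite eq_sym oner_eq0.
Qed.

Lemma frame_inv_step k e f (kn : (k < n)%N) : frame_inv k e f ->
  frame_inv k.+1 (extend k e (next_e e f kn)) (extend k f (next_f e f kn)).
Proof.
move=> fr; have [sk pos JJ] := uOm; have q0 := next_e_neq0 kn fr.
set e' := next_e e f kn; set f' := next_f e f kn; rewrite -/e' in q0.
have fE : f' = (om Om e' (mulI e'))^-1 *: mulI e' by [].
have orth j : (j < k)%N -> [/\ om Om (e j) e' = 0, om Om (e j) f' = 0,
    om Om (f j) e' = 0 & om Om (f j) f' = 0].
  move=> jk; have [oe of_] := gram_schmidt_orth (cbasis (Ordinal kn)) fr jk.
  rewrite -/(next_e e f kn) -/e' in oe of_.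
  have [q qn0 Je] := frame_mulI fr jk.
  (* Multiplication by i preserves om and exchanges the lines of e j and f j, so i e' is orthogonal
     to both as well. *)
  have oJf : om Om (mulI e') (f j) = 0.
    by apply: (mulfI qn0); rewrite -omZr -Je JJ oe mulr0.
  have oJe : om Om (mulI e') (e j) = 0.
    by rewrite -JJ mulIK Je omNl omZr of_ mulr0 oppr0.
  by split; rewrite (omC sk) ?fE ?omZl ?oe ?of_ ?oJe ?oJf ?mulr0 oppr0.
split.
- move=> j; rewrite ltnS leq_eqVlt /extend => /orP[/eqP->|jk].
    by rewrite eqxx fE omZr mulVf.
  by rewrite (ltn_eqF jk); exact: (frame_dual fr jk).
- move=> j; rewrite ltnS leq_eqVlt /extend => /orP[/eqP->|jk].
    rewrite eqxx; exists (om Om e' (mulI e')) => //.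
    by rewrite fE scalerA divff // scale1r.
  by rewrite (ltn_eqF jk); exact: (frame_mulI fr jk).
- move=> i j /andP[ij]; rewrite ltnS leq_eqVlt /extend => /orP[/eqP jE|jk].
    by rewrite jE in ij *; rewrite (ltn_eqF ij) eqxx; exact: orth.
  rewrite (ltn_eqF jk) (ltn_eqF (ltn_trans ij jk)).
  by have := @frame_orth _ _ _ fr i j; rewrite ij jk; exact.
- move=> j i /andP[]; rewrite ltnS leq_eqVlt /extend => /orP[/eqP->|jk] ki.
    rewrite eqxx; have [-> ->] := gram_schmidt_triangular (cbasis (Ordinal kn)) fr (ltnW ki).
    rewrite !mxE eq_rlshift eq_lshift /= -val_eqE /= gtn_eqF //.
  rewrite (ltn_eqF jk).
  by have := @frame_triangular _ _ _ fr j i; rewrite jk (ltnW ki); exact.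
- move=> S fS; have fS' j : (j < k)%N -> e j *m S = e j /\ f j *m S = f j.
    by move=> jk; have := fS j (ltnW jk); rewrite /extend (ltn_eqF jk).
  have [eS f'S] : e' *m S = e' /\ f' *m S = f'.
    by have := fS k (ltnSn k); rewrite /extend eqxx.
  have JeS : mulI e' *m S = mulI e'.
    have -> : mulI e' = om Om e' (mulI e') *: f' by rewrite fE scalerA divff // scale1r.
    by rewrite -scalemxAl f'S.
  have Jfix j : (j < k)%N -> mulI (e j) *m S = mulI (e j) /\ mulI (f j) *m S = mulI (f j).
    move=> jk; have [ejS fjS] := fS' j jk; have [q qn0 Je] := frame_mulI fr jk.
    split; first by rewrite Je -scalemxAl fjS.
    have -> : mulI (f j) = - q^-1 *: e j.
      apply: (scalerI qn0); rewrite scalerA mulrN divff // scaleN1r -mulIK Je.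
      by rewrite linearZ.
    by rewrite -scalemxAl ejS.
  (* The new basis vector is a combination of e' and the earlier pairs. All of these, and their
     multiples by i, are fixed by S. *)
  have cE : cbasis (Ordinal kn) = e' + \sum_(j < k)
      (om Om (cbasis (Ordinal kn)) (f j) *: e j - om Om (cbasis (Ordinal kn)) (e j) *: f j).
    by rewrite /e' /next_e /gram_schmidt subrK.
  move=> i; rewrite ltnS leq_eqVlt => /orP[/eqP ik|ik]; last exact: (frame_span fr fS').
  have -> : i = Ordinal kn by apply/val_inj.
  split; rewrite cE; first rewrite mulmxDl eS mulmx_suml.
    congr (_ + _); apply: eq_bigr => j _; have [h1 h2] := fS' j (ltn_ord j).
    by rewrite mulmxBl -!scalemxAl h1 h2.
  rewrite linearD /= linear_sum mulmxDl JeS mulmx_suml; congr (_ + _).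
  apply: eq_bigr => j _; have [h1 h2] := Jfix j (ltn_ord j).
  rewrite /=; have -> a b : mulI (a *: e j - b *: f j) = a *: mulI (e j) - b *: mulI (f j).
    by rewrite linearB !linearZ.
  by rewrite mulmxBl -!scalemxAl h1 h2.
Qed.

Lemma frame_complete e f (S : 'M[R]_m) : frame_inv n e f ->
  (forall j, (j < n)%N -> e j *m S = e j /\ f j *m S = f j) -> S = 1%:M.
Proof.
move=> fr /(frame_span fr) fS; apply/row_matrixP => i; rewrite !rowE mulmx1.
case: (split_ordP i) => j ->; have [h1 h2] := fS j (ltn_ord j); first exact: h1.
by rewrite mulI_cbasis in h2.
Qed.

End UnitaryFrame.

Section LocalFactorization.
Context {R : realType} {n : nat} {Y : topologicalType}.
Local Notation m := (n + n)%N.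
Variables (y0 : Y) (Om : Y -> 'M[R]_m).
Hypothesis Om_near : \forall y \near y0, {for y, continuous Om} /\ unitary_form (Om y).

Lemma continuous_mulI (v : Y -> 'rV[R]_m) y : {for y, continuous v} ->
  {for y, continuous (fun z => mulI (v z))}.
Proof.
move=> cv; rewrite (_ : (fun z => _) = fun z => v z *m lin1_mx (@mulI R n)).
  exact: (continuous_mulmx cv (@continuous_cst Y 'M[R]_m _ y)).
by apply/funext => z; exact: mulI_mx.
Qed.

(** Started from a constant basis, Gram-Schmidt gives rational expressions in the entries of Om with
    nonvanishing denominators; continuity is inherited. *)
Lemma unitary_frame : exists e f : nat -> Y -> 'rV[R]_m, \forall y \near y0,
  (forall j, (j < n)%N -> {for y, continuous (e j)} /\ {for y, continuous (f j)}) /\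
  frame_inv (Om y) n (e ^~ y) (f ^~ y).
Proof.
suff main k : (k <= n)%N -> exists e f : nat -> Y -> 'rV[R]_m, \forall y \near y0,
  (forall j, (j < k)%N -> {for y, continuous (e j)} /\ {for y, continuous (f j)}) /\
  frame_inv (Om y) k (e ^~ y) (f ^~ y) by exact: main.
elim: k => [|k IH] kn.
  by exists (fun _ _ => 0), (fun _ _ => 0); near=> y; split => //; split => // i j; rewrite ltn0 ?andbF.
have [e [f ef]] := IH (ltnW kn).
pose e' y := next_e (Om y) (e ^~ y) (f ^~ y) kn.
pose f' y := next_f (Om y) (e ^~ y) (f ^~ y) kn.
exists (fun j => if j == k then e' else e j), (fun j => if j == k then f' else f j).
near=> y.
have [cO uO] : {for y, continuous Om} /\ unitary_form (Om y) by near: y.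
have [cef fr] : (forall j, (j < k)%N -> {for y, continuous (e j)} /\ {for y, continuous (f j)})
  /\ frame_inv (Om y) k (e ^~ y) (f ^~ y) by near: y.
have ce' : {for y, continuous e'}.
  apply: continuous_add; first exact: (@continuous_cst Y 'rV[R]_m _ y).
  apply: continuous_opp; apply: continuous_sum => j.
  have [ce cf] := cef j (ltn_ord j).
  have cc := @continuous_cst Y 'rV[R]_m (cbasis (Ordinal kn)) y.
  exact: (continuous_add (continuous_scale (continuous_om cO cc cf) ce)
    (continuous_opp (continuous_scale (continuous_om cO cc ce) cf))).
have cf' : {for y, continuous f'}.
  have cJ := continuous_mulI ce'.
  have q0 : om (Om y) (e' y) (mulI (e' y)) != 0 := next_e_neq0 uO kn fr.
  have cq := @continuous_invr _ _ (fun z => om (Om z) (e' z) (mulI (e' z))) y q0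
    (continuous_om cO ce' cJ).
  exact: (continuous_scale cq cJ).
split=> [j|].
  by rewrite ltnS leq_eqVlt => /orP[/eqP->|jk]; [rewrite eqxx|rewrite (ltn_eqF jk); exact: cef].
have := frame_inv_step uO kn fr; congr (frame_inv _ _ _ _).
  by apply/funext => j; rewrite /extend; case: eqP.
by apply/funext => j; rewrite /extend; case: eqP.
Unshelve. all: by end_near. Qed.

Lemma local_factorization (S : Y -> 'M[R]_m) : S y0 = 1%:M ->
  (\forall y \near y0, {for y, continuous S} /\ S y *m Om y *m (S y)^T = Om y) ->
  exists l : seq (Y -> 'M[R]_m), shears_near y0 Om S l /\
    \forall y \near y0, sheared_seq S l y = 1%:M.
Proof.
move=> S0 Sn; have [e [f ef]] := unitary_frame.
have iS : isometry_near y0 Om S.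
  by apply: filterS2 Om_near Sn => y [cO [sk _ _]] [cS iso].
have fr : frame_near y0 Om n e f.
  apply: filterS ef => y [c fr]; split => [j jn|i j ijn].
    by have [ce cf] := c j jn; split => //; exact: (frame_dual fr jn).
  exact: (frame_orth fr ijn).
have [l [sl _ _ fl]] := eliminate_frame iS S0 fr.
exists l; split => //; apply: filterS2 ef fl => y [_ fry] fly.
exact: frame_complete fry fly.
Qed.

End LocalFactorization.

(** * The curvature in a chart *)

Section CurvatureEndomorphism.
Context {R : realType} {n : nat} {X : kahler_manifold R n}.
Local Notation m := (n + n)%N.
Implicit Types (i j : atlas X) (x : X) (W : vector_field X) (O : set X).
Variable nabla : vector_field X -> vector_field X -> vector_field X.
Hypothesis lc : levi_civita nabla.
Variables U V : vector_field X.
Hypotheses (sU : smooth_field setT U) (sV : smooth_field setT V).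

Let sU' O : smooth_field O U := smooth_field_sub (@subsetT _ O) sU.
Let sV' O : smooth_field O V := smooth_field_sub (@subsetT _ O) sV.
Local Notation E i a := (chart_field i (cst a)).

Definition curvature_mx i x : 'M[R]_m := \matrix_(a, b)
  component i (curvature_field nabla U V (E i (delta_mx 0 a))) (chart i x) 0 b.

Lemma curvature_field_mx i O W x : open O -> O x -> dom i x -> smooth_field O W ->
  curvature_field nabla U V W x =
  component i W (chart i x) *m curvature_mx i x *m change_mx i (at_ x) x.
Proof.
move=> oO0 Ox0 ix sW0; pose O' := O `&` dom i.
have oO : open O' by apply: openI => //; exact: dom_open.
have Oi : O' `<=` dom i by move=> y [].
have sW : smooth_field O' W by apply: smooth_field_sub sW0 => y [].
have Ox : O' x by [].
rewrite (@tensorial _ _ _ (fun W => curvature_field nabla U V W x) i O' x oO Oi Ox _ _ _ W sW).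
- rewrite [in RHS](row_sum_delta (component i W (chart i x))) !mulmx_suml; apply: eq_bigr => a _.
  rewrite -!scalemxAl; congr (_ *: _).
  rewrite -[LHS](chart_field_component (curvature_field nabla U V _) ix) /chart_field.
  rewrite (change_chartE _ ix (at_dom x)); congr (_ *m _).
  by apply/rowP => b; rewrite -rowE !mxE.
- by move=> B B' sB sB' BB'; exact: (curvature_field_ext lc oO (sU' O') (sV' O') sB sB' BB' Ox).
- by move=> B B' sB sB'; exact: (curvature_fieldD lc oO (sU' O') (sV' O') sB sB' Ox).
- by move=> f B sf sB; exact: (curvature_fieldZ lc oO (sU' O') (sV' O') sf sB Ox).
Qed.

(** The extension selected by [get] is unknown, but by tensoriality every extension of W x yields
    the same value. *)
Lemma curvatureE O W x : open O -> O x -> smooth_field O W ->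
  curvature nabla U V x (W x) = curvature_field nabla U V W x.
Proof.
move=> oO Ox sW; rewrite /curvature; set P := [set r | _].
have exP : exists r, P r by exists (curvature_field nabla U V W x), O, W.
have [Q [W' [oQ Qx sW' W'x ->]]] := getPex exP.
have ax := at_dom x; rewrite -/(curvature_field nabla U V W' x).
rewrite (curvature_field_mx oQ Qx ax sW') (curvature_field_mx oO Ox ax sW).
by rewrite !(component_chart _ ax) W'x.
Qed.

Lemma curvature_chart i x v : dom i x ->
  curvature nabla U V x (v *m change_mx i (at_ x) x) =
  v *m curvature_mx i x *m change_mx i (at_ x) x.
Proof.
move=> ix; have oi := dom_open i.
have sE := smooth_const_field v oi (@subset_refl _ (dom i)).
have Ev : E i v x = v *m change_mx i (at_ x) x.
  by rewrite /chart_field (change_chartE _ ix (at_dom x)).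
rewrite -Ev (curvatureE oi ix sE) (curvature_field_mx oi ix ix sE).
by rewrite (component_chart_field _ ix).
Qed.

Lemma continuous_curvature_mx i x : dom i x -> {for x, continuous (curvature_mx i)}.
Proof.
move=> ix; apply/continuous_mxP => a b; have oi := dom_open i.
have sE := smooth_const_field (delta_mx 0 a) oi (@subset_refl _ (dom i)).
have sC := smooth_curvature_field lc oi (sU' _) (sV' _) sE.
have c := (sC i 0) _ (chart_imageP ix ix).
rewrite (_ : (fun z => _) = fun z =>
    component i (curvature_field nabla U V (E i (delta_mx 0 a))) (chart i z) 0 b); last first.
  by apply/funext => z; rewrite mxE.
exact: (cvg_comp _ _ (cvg_comp _ _ (chart_continuous ix) c) (@coord_continuous _ _ _ 0 b _)).
Qed.

Definition kahler_mx i x : 'M[R]_m := \matrix_(a, b)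
  kahler_form x (change_chart i (at_ x) x (delta_mx 0 a)) (change_chart i (at_ x) x (delta_mx 0 b)).

Lemma om_kahler_mx i x v w : dom i x -> om (kahler_mx i x) v w =
  kahler_form x (v *m change_mx i (at_ x) x) (w *m change_mx i (at_ x) x).
Proof.
move=> ix; set P := change_mx i (at_ x) x.
rewrite {2}[v]row_sum_delta {2}[w]row_sum_delta !mulmx_suml /kahler_form.
rewrite linear_sum metric_suml /om mxE.
under eq_bigr do rewrite mxE mulr_suml.
rewrite exchange_big /=; apply: eq_bigr => a _; rewrite metric_sumr.
apply: eq_bigr => b _.
rewrite -!scalemxAl linearZ /= metricZl metricZr !mxE /kahler_form.
by rewrite !(change_chartE _ ix (at_dom x)) -/P; ring.
Qed.

Lemma continuous_kahler_mx i x : dom i x -> {for x, continuous (kahler_mx i)}.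
Proof.
move=> ix; apply/continuous_mxP => a b.
have sm := metric_smooth i (mulI (delta_mx 0 a)) (delta_mx 0 b) 0 (chart i x) (ex_intro2 _ _ x ix erefl).
apply: (@near_eq_continuous _ _ (fun y => tensor_component (@metric _ _ X) i
  (mulI (delta_mx 0 a)) (delta_mx 0 b) (chart i y))).
  have : nbhs x (dom i) by apply: open_nbhs_nbhs; split => //; exact: dom_open.
  apply: filterS => y iy; rewrite mxE /tensor_component (chartK iy) /kahler_form.
  by rewrite (change_chart_mulI _ iy (at_dom y)).
exact: (cvg_comp _ _ (chart_continuous ix) sm).
Qed.

Lemma kahler_mx_unitary i x : dom i x -> unitary_form (kahler_mx i x).
Proof.
move=> ix; have ax := at_dom x.
have P1 := change_mxV ix ax.
have JP v : mulI v *m change_mx i (at_ x) x = mulI (v *m change_mx i (at_ x) x).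
  by rewrite -!(change_chartE _ ix ax) (change_chart_mulI _ ix ax).
split.
- have kE a b : kahler_mx i x a b = kahler_form x (change_chart i (at_ x) x (delta_mx 0 a))
      (change_chart i (at_ x) x (delta_mx 0 b)) by rewrite mxE.
  apply/matrixP => a b; rewrite [LHS]mxE [RHS]mxE (kE b a) (kE a b) /kahler_form.
  by rewrite [LHS]metric_mulIl Defs.metric_sym.
- move=> v v0; rewrite (om_kahler_mx _ _ ix) JP /kahler_form metric_hermitian.
  apply: metric_pos; apply: contra_neq v0 => v0.
  by rewrite -(mulmx1 v) -P1 mulmxA v0 mul0mx.
- move=> v w; rewrite !(om_kahler_mx _ _ ix) !JP /kahler_form.
  by rewrite metric_hermitian.
Qed.

(** g(iRv, w) = g(R(iv), w) = - g(iv, Rw): commutation with i, then skewness for g. *)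
Lemma curvature_kahler x v w : kahler_form x (curvature nabla U V x v) w =
  - kahler_form x v (curvature nabla U V x w).
Proof.
have ax := at_dom x; have oa := dom_open (at_ x).
have sE u := smooth_const_field u oa (@subset_refl _ (dom (at_ x))).
have Ex u : E (at_ x) u x = u by rewrite /chart_field (change_chart_id _ ax).
have cE u : curvature nabla U V x u = curvature_field nabla U V (E (at_ x) u) x.
  by rewrite -(curvatureE oa ax (sE u)) Ex.
have key := curvature_field_metric lc oa (sU' _) (sV' _) (smooth_mulI oa (sE v)) (sE w) ax.
rewrite (curvature_field_mulI lc oa (sU' _) (sV' _) (sE v) ax) !Ex in key.
by rewrite /kahler_form !cE.
Qed.

Lemma curvature_mx_skew i x : dom i x ->
  curvature_mx i x *m kahler_mx i x = - (kahler_mx i x *m (curvature_mx i x)^T).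
Proof.
move=> ix; have omE (A B : 'M[R]_m) : (forall v w, om A v w = om B v w) -> A = B.
  move=> AB; apply/matrixP => a b; have := AB (delta_mx 0 a) (delta_mx 0 b).
  by rewrite /om trmx_delta -!rowE -!colE !mxE.
apply: omE => v w.
have -> : om (curvature_mx i x *m kahler_mx i x) v w =
    om (kahler_mx i x) (v *m curvature_mx i x) w by rewrite /om !mulmxA.
have -> : om (- (kahler_mx i x *m (curvature_mx i x)^T)) v w =
    - om (kahler_mx i x) v (w *m curvature_mx i x).
  by rewrite /om trmx_mul mulmxN mulNmx mxE !mulmxA.
by rewrite !(om_kahler_mx _ _ ix) -!(curvature_chart _ ix) curvature_kahler.
Qed.

End CurvatureEndomorphism.

(** * Bundle automorphisms *)

Lemma conj_mulmx (R : pzRingType) (m : nat) (w : 'rV[R]_m) (A B C D M : 'M[R]_m) :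
  A *m B = D -> C *m B = 1%:M -> w *m A *m (B *m M *m C) *m B = w *m D *m M.
Proof. by move=> <- CB; rewrite -!mulmxA CB mulmx1. Qed.

Lemma continuous_fst (S T Z : topologicalType) (f : S -> Z) (x : S) (v : T) :
  {for x, continuous f} -> {for (x, v), continuous (fun q : S * T => f q.1)}.
Proof.
move=> cf; have h : {for (x, v), continuous (@fst S T)} by exact: cvg_fst.
exact: (cvg_comp _ _ h cf).
Qed.

Section BundleMaps.
Context {R : realType} {n : nat} {X : kahler_manifold R n}.
Local Notation m := (n + n)%N.
Implicit Types (i j : atlas X) (x : X) (M N : X -> 'M[R]_m).

Definition fiber_map M (e : tangent_bundle X) : tangent_bundle X :=
  Tangent (foot e) (vec e *m M (foot e)).

Lemma fiber_map_comp M N : fiber_map M \o fiber_map N = fiber_map (fun x => N x *m M x).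
Proof. by apply/funext => e; rewrite /fiber_map /= mulmxA. Qed.

Lemma fiber_map1 : fiber_map (fun _ => 1%:M) = idfun.
Proof. by apply/funext => -[x v]; rewrite /fiber_map /= mulmx1. Qed.

(* M x is the matrix of an endomorphism of T_x X in the chart [at_ x], which is
   not continuous in x, so continuity is required in a fixed chart. *)
Definition continuous_endo M := forall x, exists2 i, dom i x &
  {for x, continuous (fun y => change_mx i (at_ y) y *m M y *m change_mx (at_ y) i y)}.

Lemma tangent_openE (A : set (tangent_bundle X)) : open A = tangent_open A.
Proof. by []. Qed.

(** An open set of TX is tested in every trivialization j, while M is known to be continuous in one
    chart i around x. Hence g reads the source in j and the target in i. *)
Lemma fiber_map_continuous M : continuous_endo M -> continuous (fiber_map M).
Proof.
move=> cM; apply/continuousP => A; rewrite !tangent_openE => oA j.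
rewrite openE => -[x v] /= [jx Ax].
have [i ix cMi] := cM x; rewrite /interior.
pose Mi y := change_mx i (at_ y) y *m M y *m change_mx (at_ y) i y.
pose g (q : X * 'rV[R]_m) := (q.1, q.2 *m change_mx j i q.1 *m Mi q.1).
have cg : {for (x, v), continuous g}.
  have cc : {for x, continuous (change_mx j i)}.
    by apply/continuous_mxP => a b; exact: change_mx_continuous.
  have c2 : {for (x, v), continuous (fun q : X * 'rV[R]_m => q.2)} by exact: cvg_snd.
  have c3 := continuous_mulmx (continuous_mulmx c2 (@continuous_fst _ _ _ _ x v cc)) (@continuous_fst _ _ _ _ x v cMi).
  have c1 : {for (x, v), continuous (fun q : X * 'rV[R]_m => q.1)} by exact: cvg_fst.
  exact: (cvg_pair c1 c3).
have gE y w : dom i y -> dom j y ->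
    Tangent y (change_chart i (at_ y) y (g (y, w)).2) =
    fiber_map M (Tangent y (change_chart j (at_ y) y w)).
  move=> iy jy; have ay := at_dom y; rewrite /fiber_map; congr Tangent.
  rewrite (change_chartE _ iy ay) (change_chartE _ jy ay).
  exact: (conj_mulmx _ _ (change_mx_trans jy iy ay) (change_mxV ay iy)).
have oAi := oA i.
have Ag : nbhs (g (x, v)) [set q : X * 'rV[R]_m |
    dom i q.1 /\ A (Tangent q.1 (change_chart i (at_ q.1) q.1 q.2))].
  by apply: open_nbhs_nbhs; split; [exact: oAi|split => //=; rewrite (gE x v ix jx)].
have nj : nbhs (x, v) [set q : X * 'rV[R]_m | dom j q.1].
  have h : {for (x, v), continuous (@fst X 'rV[R]_m)} by exact: cvg_fst.
  apply: (h (dom j)); apply: open_nbhs_nbhs; split => //; exact: dom_open.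
apply: filterS2 nj (cg _ Ag) => -[y w] /= jy [iy Ay]; split => //.
by rewrite -(gE y w iy jy).
Qed.

End BundleMaps.

Section Factorable.
Context {R : realType} {n : nat} {X : kahler_manifold R n}.
Local Notation m := (n + n)%N.
Implicit Types (i j : atlas X) (x : X) (M N : X -> 'M[R]_m) (s t : tangent_bundle X -> tangent_bundle X).

Lemma kahlerDl x u v w : kahler_form (X := X) x (u + v) w = kahler_form x u w + kahler_form x v w.
Proof. by rewrite /kahler_form linearD metricDl. Qed.

Lemma kahlerDr x u v w : kahler_form (X := X) x u (v + w) = kahler_form x u v + kahler_form x u w.
Proof. by rewrite /kahler_form metricDr. Qed.

Lemma kahlerNr x u v : kahler_form (X := X) x u (- v) = - kahler_form x u v.
Proof. by rewrite /kahler_form metricNr. Qed.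

Lemma kahlerNl x u v : kahler_form (X := X) x (- u) v = - kahler_form x u v.
Proof. by rewrite /kahler_form linearN metricNl. Qed.

Lemma kahler0r x u : kahler_form (X := X) x u 0 = 0.
Proof. by rewrite /kahler_form metric0r. Qed.

Record square_zero_section N : Prop := SquareZeroSection {
  section_square : forall x, N x *m N x = 0;
  section_skew : forall x v w,
    kahler_form x (v *m N x) w = - kahler_form x v (w *m N x);
  section_continuous : continuous_endo N }.

Lemma square_zero_sectionN N : square_zero_section N -> square_zero_section (fun x => - N x).
Proof.
move=> [sq sk cN]; split.
- by move=> x; rewrite mulmxN mulNmx sq !oppr0.
- by move=> x v w; rewrite !mulmxN kahlerNr kahlerNl sk !opprK.
- move=> x; have [i ix ci] := cN x; exists i; first exact: ix.
  have co := continuous_opp ci; apply: (near_eq_continuous _ co).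
  by near=> y; rewrite mulmxN mulNmx.
Unshelve. all: by end_near. Qed.

Lemma continuous_endo_add1 N : continuous_endo N -> continuous_endo (fun x => 1%:M + N x).
Proof.
move=> cN x; have [i ix ci] := cN x; exists i; first exact: ix.
apply: (near_eq_continuous _ (continuous_add (@continuous_cst X 'M[R]_m 1%:M x) ci)).
have : nbhs x (dom i) by apply: open_nbhs_nbhs; split => //; exact: dom_open.
apply: filterS => y iy; rewrite mulmxDr mulmxDl mulmx1 change_mxV //.
exact: at_dom.
Qed.

Definition unipotent_factor s := [/\ bundle_automorphism s, symplectic s & unipotent s].

Lemma square_zero_factor N : square_zero_section N ->
  unipotent_factor (fiber_map (fun x => 1%:M + N x)).
Proof.
move=> sN; have sN' := square_zero_sectionN sN; have sq := section_square sN.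
have sk := section_skew sN.
split.
- split.
  + exists (fiber_map (fun x => 1%:M - N x)); split.
    * move=> [x v]; rewrite /fiber_map /= -mulmxA; congr Tangent.
      by rewrite mulmxBr mulmx1 mulmxDl mul1mx sq addr0 addrK mulmx1.
    * move=> [x v]; rewrite /fiber_map /= -mulmxA; congr Tangent.
      by rewrite mulmxDr mulmx1 mulmxBl mul1mx sq subr0 subrK mulmx1.
    * exact/fiber_map_continuous/continuous_endo_add1/(section_continuous sN).
    * exact/fiber_map_continuous/continuous_endo_add1/(section_continuous sN').
  + by move=> [x v].
  + by move=> x a v w; rewrite /on_fiber /= mulmxDl scalemxAl.
- move=> x v w; rewrite /on_fiber /= !mulmxDr !mulmx1 kahlerDl !kahlerDr !sk.
  by rewrite -mulmxA sq mulmx0 kahler0r oppr0 addr0 addrK.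
- move=> x; exists 2%N => v; rewrite /= /on_fiber /=.
  have E w : w *m (1%:M + N x) - w = w *m N x.
    by rewrite mulmxDr mulmx1 addrC addKr.
  by rewrite !E -mulmxA sq mulmx0.
Qed.

Inductive factorable : (tangent_bundle X -> tangent_bundle X) -> Prop :=
| factorable_id : factorable idfun
| factorable_cons s t : unipotent_factor s -> factorable t -> factorable (s \o t).

Lemma factorable_comp s t : factorable s -> factorable t -> factorable (s \o t).
Proof.
elim=> [//|s1 s2 f1 _ IH] ft; rewrite -compA.
by apply: factorable_cons => //; exact: IH.
Qed.

Lemma factorable_bigcomp s : factorable s ->
  exists (N : nat) (u : 'I_N -> tangent_bundle X -> tangent_bundle X),
    (forall k, unipotent_factor (u k)) /\ s = \big[comp/idfun]_(k < N) u k.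
Proof.
elim=> [|s1 s2 f1 _ [N [u [fu ->]]]].
  by exists 0%N, (fun _ => idfun); split; [case|rewrite big_ord0].
exists N.+1, (fun k => if unlift ord0 k is Some j then u j else s1); split=> [k|].
  by case: unliftP.
rewrite big_ord_recl unlift_none; congr (_ \o _).
by apply: eq_bigr => k _; rewrite liftK.
Qed.

Lemma factorable_automorphism s : factorable s -> bundle_automorphism s /\ symplectic s.
Proof.
elim=> [|s1 s2 [[inv1 foot1 lin1] symp1 _] _ [[inv2 foot2 lin2] symp2]].
  split; last by [].
  split; [|by []|by []].
  by exists idfun; split => // x; exact: cvg_id.
have onf x v : on_fiber (s1 \o s2) x v = on_fiber s1 x (on_fiber s2 x v).
  rewrite /on_fiber /=; congr (vec (s1 _)); have := foot2 (Tangent x v).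
  by case: (s2 _) => y w /= ->.
split; last by move=> x v w; rewrite !onf symp1 symp2.
split.
- have [t1 [k1 k1' c1 c1']] := inv1; have [t2 [k2 k2' c2 c2']] := inv2.
  exists (t2 \o t1); split.
  + exact: can_comp.
  + exact: can_comp.
  + by move=> e; apply: continuous_comp; [exact: c2|exact: c1].
  + by move=> e; apply: continuous_comp; [exact: c1'|exact: c2'].
- by move=> e; rewrite /= foot1 foot2.
- by move=> x a v w; rewrite !onf lin2 lin1.
Qed.

(** Elimination reduces A to 1 by multiplications on the right. As matrices act on row vectors,
    undoing the first of them, by 1 - N, is the outermost map of the composition. *)
Lemma factorable_word (A : X -> 'M[R]_m) (l : seq (X -> 'M[R]_m)) :
  foldr (fun N P => square_zero_section N /\ P) True l ->
  (forall x, foldl (fun B N => B *m (1%:M + N x)) (A x) l = 1%:M) ->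
  factorable (fiber_map A).
Proof.
elim: l A => [|N l IH] A /= => [_ A1|[sN sl] AN].
  rewrite (_ : A = fun _ => 1%:M); last exact/funext.
  by rewrite fiber_map1; exact: factorable_id.
have fA := IH (fun x => A x *m (1%:M + N x)) sl AN.
have -> : fiber_map A = fiber_map (fun x => 1%:M - N x) \o fiber_map (fun x => A x *m (1%:M + N x)).
  rewrite fiber_map_comp; congr fiber_map; apply/funext => x.
  rewrite -mulmxA mulmxBr mulmx1 mulmxDl mul1mx (section_square sN) addr0 addrK.
  by rewrite mulmx1.
by apply: factorable_cons fA; exact/square_zero_factor/square_zero_sectionN.
Qed.

End Factorable.

(** * Cutting off and gluing the local factors *)

Lemma expmx_conj (R : realType) (m : nat) (P Q M : 'M[R]_m) : P *m Q = 1%:M -> Q *m P = 1%:M ->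
  expmx (Q *m M *m P) = Q *m expmx M *m P.
Proof.
move=> PQ QP; apply: cvg_lim => //.
rewrite (_ : exp_term _ = (fun k => Q *m exp_term M k *m P)); first exact: expmx_lim.
apply/funext => k; rewrite /exp_term -scalemxAr -scalemxAl; congr (_ *: _).
elim: k => [|k IH]; first by rewrite !expr0 mulmx1.
rewrite !exprSr -[LHS]/((Q *m M *m P) ^+ k *m (Q *m M *m P)) IH -[M ^+ k * M]/(M ^+ k *m M).
by rewrite !mulmxA -(mulmxA _ P Q) PQ mulmx1.
Qed.

Lemma foldr_andP (T : Type) (P : T -> Prop) (x0 : T) (l : seq T) :
  (forall j, (j < size l)%N -> P (nth x0 l j)) -> foldr (fun a Q => P a /\ Q) True l.
Proof.
elim: l => [//|a l IH] /= h; split; first exact: (h 0%N).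
by apply: IH => j jl; exact: (h j.+1).
Qed.

Lemma foldl_conj (R : pzRingType) (m : nat) (T T' : Type) (l : seq T) (f : T -> 'M[R]_m)
    (g : T -> T') (h : T' -> 'M[R]_m) (P Q A : 'M[R]_m) : P *m Q = 1%:M ->
  (forall a, h (g a) = Q *m f a *m P) ->
  foldl (fun B a => B *m (1%:M + h a)) (Q *m A *m P) (map g l) =
  Q *m foldl (fun B a => B *m (1%:M + f a)) A l *m P.
Proof.
move=> PQ hg; elim: l A => [//|a l IH] A /=; rewrite -IH; congr foldl.
by rewrite hg !mulmxDr !mulmx1 mulmxDl !mulmxA -(mulmxA _ P Q) PQ mulmx1.
Qed.

Section Conjugation.
Context {R : pzRingType} {m : nat}.
Implicit Types (P Q A B : 'M[R]_m) (v : 'rV[R]_m).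

Lemma conj_mulmx_mul P Q A B : P *m Q = 1%:M ->
  (Q *m A *m P) *m (Q *m B *m P) = Q *m (A *m B) *m P.
Proof. by move=> PQ; rewrite -!mulmxA (mulmxA P) PQ mul1mx. Qed.

Lemma conj_mulmxK P Q A : P *m Q = 1%:M -> P *m (Q *m A *m P) *m Q = A.
Proof. by move=> PQ; rewrite !mulmxA PQ mul1mx -mulmxA PQ mulmx1. Qed.

Lemma mulmx_conj P Q A v : P *m Q = 1%:M -> v *m (Q *m A *m P) *m Q = v *m Q *m A.
Proof. by move=> PQ; rewrite !mulmxA -mulmxA PQ mulmx1. Qed.
End Conjugation.

Lemma om_skew (R : realType) (m : nat) (Om N : 'M[R]_m) (v w : 'rV[R]_m) :
  N *m Om = - (Om *m N^T) -> om Om (v *m N) w = - om Om v (w *m N).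
Proof.
move=> NO; rewrite /om -(mulmxA v) NO trmx_mul mulmxN mulNmx mxE.
by rewrite !mulmxA.
Qed.

Section Gluing.
Context {R : realType} {n : nat} {X : kahler_manifold R n}.
Local Notation m := (n + n)%N.
Implicit Types (i : atlas X) (x : X) (psi : X -> R) (O K : set X).
Variable nabla : vector_field X -> vector_field X -> vector_field X.
Hypothesis lc : levi_civita nabla.
Variables U V : vector_field X.
Hypotheses (sU : smooth_field setT U) (sV : smooth_field setT V).

Local Notation Kc i := (curvature_mx nabla U V i).
Local Notation toi i x := (change_mx (at_ x) i x).
Local Notation fromi i x := (change_mx i (at_ x) x).

Definition curvature_at x : 'M[R]_m := Kc (at_ x) x.

Lemma curvature_atE i x : dom i x -> curvature_at x = toi i x *m Kc i x *m fromi i x.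
Proof.
move=> ix; have ax := at_dom x; apply/row_matrixP => a; rewrite !rowE !mulmxA.
have := curvature_chart lc sU sV (delta_mx 0 a *m toi i x) ix.
rewrite -(mulmxA _ (toi i x)) (change_mxV ax ix) mulmx1 => <-.
have := curvature_chart lc sU sV (delta_mx 0 a) ax.
by rewrite (change_mx1 ax) !mulmx1 => <-.
Qed.

Definition exp_multiple psi := fiber_map (X := X) (fun x => expmx (psi x *: curvature_at x)).

(* Multiples of one endomorphism commute. *)
Lemma exp_multipleD psi psi' :
  exp_multiple (fun x => psi x + psi' x) = exp_multiple psi \o exp_multiple psi'.
Proof.
rewrite /exp_multiple fiber_map_comp; congr fiber_map; apply/funext => x.
by rewrite expmxD addrC.
Qed.

Lemma exp_multiple0 psi : (forall x, psi x = 0) -> exp_multiple psi = idfun.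
Proof.
move=> psi0; rewrite -fiber_map1; congr fiber_map; apply/funext => x.
by rewrite psi0 scale0r expmx0.
Qed.

Lemma factorable_multiple psi k : factorable (exp_multiple psi) ->
  factorable (exp_multiple (fun x => k%:R * psi x)).
Proof.
move=> fpsi; elim: k => [|k IH].
  by rewrite exp_multiple0 => [|x]; [exact: factorable_id|rewrite mul0r].
rewrite (_ : (fun x => _) = (fun x => psi x + k%:R * psi x)).
  by rewrite exp_multipleD; exact: factorable_comp.
by apply/funext => x; rewrite -addn1 natrD mulrDl mul1r addrC.
Qed.

Section LocalFactors.
Variables (x0 : X).
Let i := at_ x0.
Let Om (y : X * R) := kahler_mx i y.1.
Let S (y : X * R) := expmx (y.2 *: Kc i y.1).

Let near_dom : \forall y \near (x0, 0 : R), dom i y.1.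
Proof.
have h : {for (x0, 0 : R), continuous (@fst X R)} by exact: cvg_fst.
by apply: (h (dom i)); apply: open_nbhs_nbhs; split; [exact: dom_open|exact: at_dom].
Qed.

(** The elimination is run over X x R at (x0, 0), where S = 1. A product neighbourhood, with one
    word valid for all small t, admits any small continuous function of x in the place of t. *)
Lemma local_exp_factors : exists (l : seq (X * R -> 'M[R]_m)) (O : set X) (eps : R),
  [/\ open O, O x0, O `<=` dom i, 0 < eps
    & forall x t, O x -> `|t| < eps ->
      (forall j, (j < size l)%N -> let N := nth 0 l j in
         [/\ {for (x, t), continuous N}, N (x, t) *m N (x, t) = 0,
             N (x, t) *m Om (x, t) = - (Om (x, t) *m (N (x, t))^T)
           & S (x, t) = 1%:M -> N (x, t) = 0]) /\ sheared_seq S l (x, t) = 1%:M].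
Proof.
have Om_near : \forall y \near (x0, 0 : R), {for y, continuous Om} /\ unitary_form (Om y).
  apply: filterS near_dom => -[x t] /= ix; split; last exact: kahler_mx_unitary.
  exact: (@continuous_fst _ _ _ _ x t (continuous_kahler_mx ix)).
have S0 : S (x0, 0) = 1%:M by rewrite /S /= scale0r expmx0.
have S_near : \forall y \near (x0, 0 : R), {for y, continuous S} /\ S y *m Om y *m (S y)^T = Om y.
  apply: filterS near_dom => -[x t] /= ix; split.
    apply: continuous_expmx.
    have c2 : {for (x, t), continuous (fun y : X * R => y.2)} by exact: cvg_snd.
    exact: (continuous_scale c2 (@continuous_fst _ _ _ _ x t (continuous_curvature_mx lc sU sV ix))).
  apply: expmx_isometry; rewrite /Om /= -scalemxAl (curvature_mx_skew lc sU sV ix).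
  rewrite scalerN; congr (- _); rewrite scalemxAr; congr (_ *m _).
  by apply/matrixP => a b; rewrite !mxE.
have [l [sl l1]] := local_factorization Om_near S0 S_near.
have sj j : (j < size l)%N -> shear_near (x0, 0 : R) Om S (nth 0 l j).
  move: sl; elim: (l) (S) j => [//|N l' IH] S' [|j] /= [sN sl'] jl //.
  exact: (shear_near_sheared sN (IH _ j sl' jl)).
pose P (j : 'I_(size l)) (y : X * R) := let N := nth 0 l j in
  [/\ {for y, continuous N}, N y *m N y = 0, N y *m Om y = - (Om y *m (N y)^T)
    & S y = 1%:M -> N y = 0].
have allj : \forall y \near (x0, 0 : R), forall j, P j y.
  have Pj j : \forall y \near (x0, 0 : R), P j y by exact: (sj j (ltn_ord j)).
  exact: (@filter_forall _ _ P _ _ Pj).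
have [[A B] /= [Ax0 B0] AB] := filterI near_dom (filterI l1 allj).
have [Q [[oQ Qx0] QA]] : exists Q, open_nbhs x0 Q /\ Q `<=` A.
  by move: Ax0; rewrite nbhsE => -[Q h1 h2]; exists Q.
have /nbhs_ballP[eps /= eps0 epsB] : nbhs (0 : R) B by [].
exists l, Q, eps; split => //.
- by move=> x Qx; have [] := AB (x, 0) (conj (QA x Qx) (nbhs_singleton B0)).
- move=> x t Qx te; have [|_ [h1 h2]] := AB (x, t).
    by split; [exact: QA|apply: epsB; rewrite -ball_normE /= sub0r normrN].
  by split=> // j jl; have := h2 (Ordinal jl).
Qed.

End LocalFactors.

Lemma local_exp_factorable x0 : exists O, [/\ open O, O x0 & forall psi K, continuous psi ->
   (forall x, 0 <= psi x <= 1) -> closed K -> K `<=` O -> (forall x, ~ K x -> psi x = 0) ->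
   factorable (exp_multiple psi)].
Proof.
have [l [Q [eps [oQ Qx0 Qi eps0 good]]]] := local_exp_factors x0.
exists Q; split => // psi K cpsi psi01 cK KQ psi0.
set i := at_ x0 in Qi good.
(* The exponential of psi R is a power of the exponential of th R, where th = psi / (k + 1) is below
   eps whatever psi is. *)
have [k ke] : exists k : nat, (k.+1%:R : R)^-1 < eps.
  by near \oo => k; exists k; near: k; exact: near_infty_natSinv_lt (PosNum eps0).
pose th x := k.+1%:R^-1 * psi x.
have th_eps x : `|th x| < eps.
  have /andP[p0 p1] := psi01 x; rewrite /th normrM ger0_norm ?invr_ge0 // ger0_norm //.
  by apply: le_lt_trans ke; rewrite ler_piMr // invr_ge0.
have cth : continuous th.
  by move=> x; exact: (@continuous_mulr R X (fun _ => k.+1%:R^-1) psi x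
    (@continuous_cst X R _ x) (cpsi x)).
have th0 x : ~ K x -> th x = 0 by move=> /psi0 p0; rewrite /th p0 mulr0.
rewrite (_ : psi = fun x => k.+1%:R * th x); last first.
  by apply/funext => x; rewrite /th mulrA divff ?mul1r // pnatr_eq0.
apply: factorable_multiple.
(* The factor along the graph of th, carried from the chart i to the coordinates of [at_ x], and
   extended by 0. *)
pose g (N : X * R -> 'M[R]_m) x : 'M[R]_m :=
  if `[< Q x >] then toi i x *m N (x, th x) *m fromi i x else 0.
have gQ N x : Q x -> g N x = toi i x *m N (x, th x) *m fromi i x.
  by move=> Qx; rewrite /g; case: asboolP.
have gN N x : ~ Q x -> g N x = 0 by move=> Qx; rewrite /g; case: asboolP.
apply: (factorable_word (l := map g l)); last first.
  move=> x; have ax := at_dom x; have [Qx|Qx] := pselect (Q x).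
    have ix := Qi x Qx; have [_ l1] := good x (th x) Qx (th_eps x).
    rewrite (curvature_atE ix) -(mulmxA (toi i x)) scalemxAr scalemxAl mulmxA.
    rewrite (expmx_conj _ (change_mxV ix ax) (change_mxV ax ix)).
    rewrite (@foldl_conj _ _ _ _ l (fun N => N (x, th x)) g (fun N => N x) _ _ _ (change_mxV ix ax)).
      by rewrite [X in _ *m X *m _]l1 mulmx1 (change_mxV ax ix).
    by move=> N; exact: gQ.
  have -> : expmx (th x *: curvature_at x) = 1%:M.
    by rewrite th0 ?scale0r ?expmx0 // => /KQ.
  elim: (l) => [//|N l' IH] /=; rewrite gN // addr0 mulmx1; exact: IH.
apply: (foldr_andP (x0 := 0)) => j; rewrite size_map => jl.
rewrite (nth_map 0) //; set N := nth 0 l j.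
have gd x : Q x -> [/\ {for (x, th x), continuous N}, N (x, th x) *m N (x, th x) = 0,
    N (x, th x) *m kahler_mx i x = - (kahler_mx i x *m (N (x, th x))^T)
  & expmx (th x *: Kc i x) = 1%:M -> N (x, th x) = 0].
  by move=> Qx; have [h _] := good x (th x) Qx (th_eps x); exact: h.
split.
- move=> x; have [Qx|Qx] := pselect (Q x); last by rewrite gN // mulmx0.
  have ix := Qi x Qx; have [_ NN _ _] := gd x Qx; rewrite gQ //.
  by rewrite (conj_mulmx_mul _ _ (change_mxV ix (at_dom x))) NN mulmx0 mul0mx.
- move=> x v w; have [Qx|Qx] := pselect (Q x); last first.
    by rewrite gN // !mulmx0 kahler0r oppr0 /kahler_form linear0 Defs.metric_sym metric0r.
  have ix := Qi x Qx; have [_ _ NO _] := gd x Qx; have ax := at_dom x; rewrite gQ //.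
  have PQ := change_mxV ix ax.
  have kE u u' : kahler_form x u u' = om (kahler_mx i x) (u *m toi i x) (u' *m toi i x).
    by rewrite (om_kahler_mx _ _ ix) -!mulmxA (change_mxV ax ix) !mulmx1.
  by rewrite !kE !(mulmx_conj _ _ PQ) (om_skew _ _ NO).
- move=> x; have ax := at_dom x; have [Qx|Qx] := pselect (Q x).
    have ix := Qi x Qx; exists i; first exact: ix.
    have [cN _ _ _] := gd x Qx.
    have cp : {for x, continuous (fun y : X => (y, th y))}.
      have cid : {for x, continuous (fun y : X => y)} by exact: cvg_id.
      exact: (cvg_pair cid (cth x)).
    apply: (@near_eq_continuous _ _ (fun y => N (y, th y))).
      have : nbhs x Q by exact: open_nbhs_nbhs.
      apply: filterS => y Qy; have iy := Qi y Qy; have ay := at_dom y.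
      by rewrite gQ // (conj_mulmxK _ (change_mxV iy ay)).
    exact: (cvg_comp _ _ cp cN).
  (* The open sets Q and the complement of K cover X. On the latter th = 0, hence S = 1 and N = 0
     even at points of Q, so the section is locally 0. *)
  exists (at_ x); first exact: ax.
  apply: (near_eq_continuous _ (@continuous_cst X 'M[R]_m 0 x)).
  have : nbhs x (~` K).
    by apply: open_nbhs_nbhs; split; [exact: closed_openC|move=> /KQ].
  apply: filterS => y Ky; suff g0 : g N y = 0 by rewrite g0 mulmx0 mul0mx.
  have [Qy|Qy] := pselect (Q y); last exact: gN.
  have [_ _ _ N0] := gd y Qy.
  have N0' : N (y, th y) = 0 by apply: N0; rewrite (th0 y Ky) scale0r expmx0.
  by rewrite (gQ N y Qy) N0' mulmx0 mul0mx.
Unshelve. all: by end_near. Qed.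

End Gluing.

(* [compact_cover] needs a pointed space, but the manifold may be empty. *)
Lemma compact_finite_cover (T : topologicalType) (W : T -> set T) :
  compact [set: T] -> (forall x, open (W x)) -> (forall x, W x x) ->
  exists s : seq T, forall y, exists2 x, x \in s & W x y.
Proof.
move=> cT oW Wx; apply: contrapT => nocover.
(* A set is in F when finitely many W x cover its complement. F is proper as there is no finite
   cover, but the complement of W x is in F, so F has no cluster point. *)
pose F : set_system T := [set A | exists s : seq T, forall y, A y \/ exists2 x, x \in s & W x y].
have FF : ProperFilter F.
  split.
    by move=> [s sP]; apply: nocover; exists s => y; case: (sP y).
  split.
  - by exists [::] => y; left.
  - move=> A B [s sP] [t tP]; exists (s ++ t) => y.
    have [Ay|[x xs Wy]] := sP y; last first.
      by right; exists x => //; rewrite mem_cat xs.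
    have [By|[x xt Wy]] := tP y; first by left.
    by right; exists x => //; rewrite mem_cat xt orbT.
  - move=> A B AB [s sP]; exists s => y; case: (sP y) => [Ay|]; last by right.
    by left; exact: AB.
have [x [_ clx]] := cT F FF (ex_intro _ [::] (fun y => or_introl I)).
have FC : F (~` W x).
  exists [:: x] => y; have [Wy|Wy] := pselect (W x y); last by left.
  by right; exists x => //; rewrite inE.
have nW : nbhs x (W x) by apply: open_nbhs_nbhs; split; [exact: oW|exact: Wx].
by have [y [/= nWy Wy]] := clx _ _ FC nW.
Qed.

(** The Urysohn function u of x and the complement of O is only known to be 1 at x itself. A second
    one, separating the levels u <= 1/3 and u >= 2/3, is 1 on a neighbourhood of x and 0 off the
    closed set u >= 1/3, contained in O. *)
Lemma bump_function (R : realType) (T : topologicalType) (O : set T) (x : T) :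
  hausdorff_space T -> compact [set: T] -> open O -> O x ->
  exists (phi : T -> R) (W K : set T), [/\ continuous phi, forall y, 0 <= phi y <= 1,
     open W /\ W x /\ (forall y, W y -> phi y = 1),
     closed K /\ K `<=` O & forall y, ~ K y -> phi y = 0].
Proof.
move=> hT cT oO Ox; have sepT := (@normal_separatorP R T).1 (compact_normal hT cT).
have rng (A B : set T) y : 0 <= @Urysohn T R A B y <= 1.
  have := @Urysohn_range T R A B (Urysohn A B y) (ex_intro2 _ _ y I erefl).
  by rewrite /= in_itv.
pose u := @Urysohn T R (~` O) [set x].
have cu : continuous u by exact: Urysohn_continuous.
have sep1 : uniform_separator (~` O) [set x].
  apply: sepT; first exact: open_closedC.
    by apply: accessible_closed_set1; exact: hausdorff_accessible.
  by apply/seteqP; split => // y [/= nOy yx]; apply: nOy; rewrite yx.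
have u0 y : ~ O y -> u y = 0.
  by move=> nOy; apply: (Urysohn_sub0 sep1); exists y.
have u1 : u x = 1 by apply: (Urysohn_sub1 sep1); exists x.
pose A := u @^-1` [set t | t <= 3^-1]; pose B := u @^-1` [set t | 2 / 3 <= t].
have cA : closed A by apply: (continuous_closedP _).1 cu _ _; exact: closed_le.
have cB : closed B by apply: (continuous_closedP _).1 cu _ _; exact: closed_ge.
have sep2 : uniform_separator A B.
  apply: sepT => //; apply/seteqP; split => // y [/= h1 h2].
  have : (2 / 3 : R) <= 3^-1 by exact: le_trans h2 h1.
  lra.
exists (@Urysohn T R A B), (u @^-1` [set t | 2 / 3 < t]), (u @^-1` [set t | 3^-1 <= t]).
split.
- exact: Urysohn_continuous.
- exact: rng.
- split; [|split].
  + by move/continuousP: (cu); apply; exact: open_gt.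
  + by rewrite /= u1; lra.
  + by move=> y /= uy; apply: (Urysohn_sub1 sep2); exists y => //; exact: ltW.
- split; first by apply: (continuous_closedP _).1 cu _ _; exact: closed_ge.
  by move=> y /= uy; apply: contrapT => /u0 uy0; move: uy; rewrite uy0; lra.
- move=> y /= uy; apply: (Urysohn_sub0 sep2); exists y => //=.
  by rewrite /A /=; have [|/ltW] := leP (3^-1) (u y).
Qed.

(** * From local to global factorization *)

Section Globalization.
Context {R : realType} {n : nat} {X : kahler_manifold R n}.
Variable nabla : vector_field X -> vector_field X -> vector_field X.
Hypothesis lc : levi_civita nabla.
Variables U V : vector_field X.
Hypotheses (sU : smooth_field setT U) (sV : smooth_field setT V).
Hypothesis X_compact : compact [set: X].

Local Notation exp_multiple := (exp_multiple nabla U V).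

Lemma exp_multiple_factorable : factorable (exp_multiple (fun _ => 1)).
Proof.
(* The function c is arbitrary, because phi will multiply what earlier steps have left of the
   exponent. *)
pose good (W : set X) := exists2 phi : X -> R, continuous phi /\ (forall y, W y -> phi y = 1) /\
   (forall y, 0 <= phi y <= 1) & forall c : X -> R, continuous c -> (forall y, 0 <= c y <= 1) ->
   factorable (exp_multiple (fun y => phi y * c y)).
have goodx x : exists W, [/\ open W, W x & good W].
  have [Q [oQ Qx facQ]] := local_exp_factorable lc sU sV x.
  have [phi [W [K [cphi phi01 [oW [Wx phi1]] [cK KQ] phi0]]]] :=
    @bump_function R X Q x (@carrier_hausdorff _ _ X) X_compact oQ Qx.
  exists W; split => //; exists phi => // c cc c01.
  apply: (facQ _ K) => //.
  - by move=> y; exact: (@continuous_mulr R X phi c y (cphi y) (cc y)).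
  - move=> y; have /andP[p0 p1] := phi01 y; have /andP[c0 c1] := c01 y.
    by rewrite mulr_ge0 //= mulr_ile1.
  - by move=> y Ky; rewrite phi0 // mul0r.
have [W WP] := choice goodx.
have [s sP] := compact_finite_cover X_compact (fun x => let: And3 h _ _ := WP x in h)
  (fun x => let: And3 _ h _ := WP x in h).
(* The exponent c vanishes outside the sets still to be treated, and is 1 at the start. Since phi =
   1 on W x, the remainder (1 - phi) c vanishes there too, and at the empty list nothing is left. *)
suff main : forall (r : seq X) (c : X -> R), continuous c -> (forall y, 0 <= c y <= 1) ->
    (forall y, (exists2 x, x \in r & W x y) \/ c y = 0) -> factorable (exp_multiple c).
  apply: (main s) => [y|y|y]; first exact: (@continuous_cst X R).
    by rewrite ler01 lexx.
  by left.
elim=> [|x r IH] c cc c01 cr.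
  rewrite exp_multiple0; first exact: factorable_id.
  by move=> y; have [[]|] := cr y.
have [_ _ [phi [cphi [phi1 phi01]] fphi]] := WP x.
have c1phi : continuous (fun y => (1 - phi y) * c y).
  move=> y; exact: (continuous_mulr (continuous_subr (@continuous_cst X R 1 y) (cphi y)) (cc y)).
have -> : c = fun y => phi y * c y + (1 - phi y) * c y.
  by apply/funext => y; rewrite -mulrDl addrC subrK mul1r.
rewrite exp_multipleD; apply: factorable_comp; first exact: fphi.
apply: IH => // y.
  have /andP[p0 p1] := phi01 y; have /andP[c0 c1] := c01 y.
  by rewrite mulr_ge0 ?subr_ge0 //= mulr_ile1 ?subr_ge0 // lerBlDr lerDl.
have [[z zr Wz]|->] := cr y; last by right; rewrite mulr0.
move: zr; rewrite inE => /orP[/eqP zx|zr]; last by left; exists z.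
by right; rewrite phi1 ?subrr ?mul0r // -zx.
Qed.

Lemma exp_curvature_multiple : exp_curvature nabla U V = exp_multiple (fun _ => 1).
Proof.
apply/funext => -[x v]; rewrite /exp_curvature /exp_multiple /fiber_map /=; congr Tangent.
have ax := at_dom x.
have AP w : curvature nabla U V x (w *m 1%:M) = w *m curvature_at nabla U V x *m 1%:M.
  by have := curvature_chart lc sU sV w ax; rewrite (change_mx1 ax).
have := exp_endo_mx AP v; rewrite !mulmx1 scale1r; exact.
Qed.

End Globalization.

Theorem corollary12 (R : realType) (n : nat) (X : kahler_manifold R n)
    (X_compact : compact [set: X])
    (nabla : vector_field X -> vector_field X -> vector_field X)
    (nabla_LC : levi_civita nabla)
    (U V : vector_field X)
    (U_smooth : smooth_field [set: X] U) (V_smooth : smooth_field [set: X] V) :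
  [/\ bundle_automorphism (exp_curvature nabla U V),
      symplectic (exp_curvature nabla U V)
    & exists (N : nat) (s : 'I_N -> tangent_bundle X -> tangent_bundle X),
        (forall k, [/\ bundle_automorphism (s k), symplectic (s k)
                     & unipotent (s k)])
        /\ exp_curvature nabla U V = \big[comp/idfun]_(k < N) s k].
Proof.
have fexp : factorable (exp_curvature nabla U V).
  rewrite (exp_curvature_multiple nabla_LC U_smooth V_smooth).
  exact: exp_multiple_factorable.
have [aut symp] := factorable_automorphism fexp.
by split => //; exact: factorable_bigcomp.
Qed.
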